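(* Let $A$ be a commutative $C^*$-algebra, let $E_A$ be a countably generated Hilbert $A$-module, and let $1\le p<\infty$. Then $\mathcal L^p(E_A)$ is a two-sided ideal of $\mathcal L(E_A)$ and is contained in $\mathcal K(E_A)$.
   Context: $\mathcal L(E_A)$ is the $C^*$-algebra of adjointable operators on $E_A$, and $\mathcal K(E_A)$ is the ideal of compact operators in the Hilbert module sense (the norm closure of the span of the operators $|v\rangle\langle w|\colon u\mapsto v\cdot\langle w,u\rangle$, $v,w\in E_A$). $\widehat A$ is the space of characters of $A$ (weak-$*$ topology), so $A\cong C_0(\widehat A)$. For $\chi\in\widehat A$, $\chi_*E_A:=E_A\otimes_A\mathbb C$ (with $A$ acting on $\mathbb C$ via $\chi$) is the localized Hilbert space, and for $T\in\mathcal L(E_A)$, $\chi_*T:=T\otimes 1\in B(\chi_*E_A)$. For $1\le p<\infty$, the $p$-th Schatten class $\mathcal L^p(E_A)$ is the set of all $T\in\mathcal L(E_A)$ for which the function $\operatorname{tr}|T|^p\colon\widehat A\to\mathbb R\cup\{\infty\}$, $\chi\mapsto\operatorname{tr}|\chi_*T|^p$ (the usual Hilbert space trace), lies in $A\cong C_0(\widehat A)$. *)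

(* Defs.v *)
From HB Require Import structures.
From mathcomp Require Import all_boot all_order all_algebra.
From mathcomp Require Import complex ring.
From mathcomp Require Import all_classical all_reals all_analysis.

Set Implicit Arguments.
Unset Strict Implicit.
Unset Printing Implicit Defensive.

Import Order.TTheory GRing.Theory Num.Theory.
Import numFieldNormedType.Exports.

Local Open Scope classical_set_scope.
Local Open Scope complex_scope.
Local Open Scope ring_scope.

HB.instance Definition _ (R : realType) := NormedModule.copy R[i] R[i]^o.

Section complex_complete.
Variable R : realType.

Let le_normc_ReIm (z : R[i]) : `|z| <= `|complex.Re z|%:C + `|complex.Im z|%:C.
Proof.
rewrite {1}[z]complexE (le_trans (ler_normD _ _))// lerD//.
  by rewrite normc_def /= expr0n /= addr0 sqrtr_sqr.
rewrite normrM [`|'i|]normc_def /= !expr0n expr1n /= add0r sqrtr1 mul1r.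
by rewrite normc_def /= expr0n /= addr0 sqrtr_sqr.
Qed.

Let normc_ge_Im (z : R[i]) : `|complex.Im z|%:C <= `|z|.
Proof.
rewrite normc_def lecR -sqrtr_sqr ler_sqrt ?lerDr ?sqr_ge0//.
by rewrite addr_ge0 ?sqr_ge0.
Qed.

Lemma complex_complete (F : set_system R[i]) :
  ProperFilter F -> cauchy F -> cvg F.
Proof.
move=> FF /cauchyP Fc.
have reF : cauchy ((@complex.Re R) @ F).
  apply/cauchy_exP => e e0.
  have [|z Fz] := Fc e%:C; first by rewrite ltcR.
  exists (complex.Re z); rewrite /nbhs /=.
  apply: (@filterS _ F _ (ball z e%:C)) Fz => w; rewrite -ball_normE /= => zw.
  rewrite /ball /= -ltcR; apply: le_lt_trans zw.
  by rewrite -raddfB normc_ge_Re.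
have imF : cauchy ((@complex.Im R) @ F).
  apply/cauchy_exP => e e0.
  have [|z Fz] := Fc e%:C; first by rewrite ltcR.
  exists (complex.Im z); rewrite /nbhs /=.
  apply: (@filterS _ F _ (ball z e%:C)) Fz => w; rewrite -ball_normE /= => zw.
  rewrite /ball /= -ltcR; apply: le_lt_trans zw.
  by rewrite -raddfB normc_ge_Im.
have cre : (@complex.Re R) @ F --> lim ((@complex.Re R) @ F) by exact: cauchy_cvg.
have cim : (@complex.Im R) @ F --> lim ((@complex.Im R) @ F) by exact: cauchy_cvg.
apply: (cvgP (lim ((@complex.Re R) @ F) +i* lim ((@complex.Im R) @ F))).
apply/cvgrPdist_lt => e e0.
have eE : e = (complex.Re e)%:C by rewrite RRe_real// gtr0_real.
move: e0; rewrite eE ltcR => e0.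
near=> w; apply: le_lt_trans (le_normc_ReIm _) _.
rewrite !raddfB /= -rmorphD ltcR [ltRHS]splitr ltrD//.
  by near: w; move/cvgrPdist_lt : cre; apply; rewrite divr_gt0.
by near: w; move/cvgrPdist_lt : cim; apply; rewrite divr_gt0.
Unshelve. all: by end_near. Qed.

End complex_complete.

HB.instance Definition _ (R : realType) :=
  Uniform_isComplete.Build R[i] (@complex_complete R).

Lemma complex_cvg_unique (R : realType) (z : nat -> R[i]) (a b : R[i]) :
  z @ \oo --> a -> z @ \oo --> b -> a = b.
Proof.
move=> za zb.
have ha := cvg_lim (@norm_hausdorff _ (R[i] : normedModType R[i])) za.
have hb := cvg_lim (@norm_hausdorff _ (R[i] : normedModType R[i])) zb.
by rewrite -ha -hb.
Qed.

(* Conjugate-linear in the first variable, linear in the second. *)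
Record semiInner (R : realType) (V : lmodType R[i]) := SemiInner {
  sip :> V -> V -> R[i] ;
  sip_linear : forall x a y z, sip x (a *: y + z) = a * sip x y + sip x z ;
  sip_conj : forall x y, (sip x y)^* = sip y x ;
  sip_ge0 : forall x, 0 <= sip x x }.

Section completion.
Variables (R : realType) (V : lmodType R[i]) (s : semiInner V).
Implicit Types (x y z : V) (u v : nat -> V) (phi psi : V -> R[i]).

Definition snorm x : R[i] := sqrtC (s x x).

Lemma sipDr x y z : s x (y + z) = s x y + s x z.
Proof. by rewrite -[y]scale1r sip_linear mul1r scale1r. Qed.

Lemma sip0r x : s x 0 = 0.
Proof. by apply: (addrI (s x 0)); rewrite -sipDr !addr0. Qed.

Lemma sipZr x a y : s x (a *: y) = a * s x y.
Proof. by rewrite -[_ *: _]addr0 sip_linear sip0r addr0. Qed.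

Lemma sipNr x y : s x (- y) = - s x y.
Proof. by rewrite -scaleN1r sipZr mulN1r. Qed.

Lemma sipBr x y z : s x (y - z) = s x y - s x z.
Proof. by rewrite sipDr sipNr. Qed.

Lemma sipDl x y z : s (x + y) z = s x z + s y z.
Proof. by rewrite -sip_conj sipDr rmorphD/= !sip_conj. Qed.

Lemma sipZl a x y : s (a *: x) y = a^* * s x y.
Proof. by rewrite -sip_conj sipZr rmorphM/= sip_conj. Qed.

Lemma sipNl x y : s (- x) y = - s x y.
Proof. by rewrite -sip_conj sipNr rmorphN/= sip_conj. Qed.

Lemma sipBl x y z : s (x - y) z = s x z - s y z.
Proof. by rewrite sipDl sipNl. Qed.

Lemma snorm_ge0 x : 0 <= snorm x.
Proof. by rewrite sqrtC_ge0 sip_ge0. Qed.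

Lemma snormK x : snorm x ^+ 2 = s x x.
Proof. exact: sqrtCK. Qed.

Lemma sip_CauchySchwarz x y : `|s x y| <= snorm x * snorm y.
Proof.
rewrite -(@ler_pXn2r _ 2) ?nnegrE ?mulr_ge0 ?snorm_ge0//.
rewrite exprMn !snormK.
set b := _ ^+ 2; have b0 : 0 <= b by rewrite exprn_ge0.
have bE : b = s x y * s y x by rewrite /b normCK sip_conj.
have H t : 0 <= t -> 2 * t * b - t ^+ 2 * b * s y y <= s x x.
  move=> t0; rewrite -subr_ge0.
  have := sip_ge0 s (x - (t * s y x) *: y).
  rewrite sipBl !sipBr !sipZl !sipZr rmorphM/= sip_conj (geC0_conj t0).
  by congr (_ <= _); rewrite bE; ring.
apply/ler_addgt0Pr => e e0.
have sx1 : 0 < s x x + 1 by rewrite ltr_wpDl ?sip_ge0.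
pose d := e / (s x x + 1); have d0 : 0 < d by rewrite divr_gt0.
pose q := s y y + d; have q0 : 0 < q by rewrite ltr_wpDl ?sip_ge0.
have bq : b / q <= s x x.
  have := H q^-1; rewrite invr_ge0 ltW// => /(_ isT); apply: le_trans.
  rewrite -subr_ge0.
  have -> : 2 * q^-1 * b - q^-1 ^+ 2 * b * s y y - b / q = b * q^-1 ^+ 2 * d.
    have qn := lt0r_neq0 q0; have -> : s y y = q - d by rewrite /q addrK.
    by field.
  apply: mulr_ge0 (ltW d0); apply: mulr_ge0 b0 _.
  by rewrite exprn_ge0 ?invr_ge0 ?ltW.
move: bq; rewrite ler_pdivrMr// => /le_trans; apply.
rewrite /q mulrDr lerD2l /d mulrCA ger_pMr// ler_pdivrMr// mul1r.
by rewrite lerDl ler01.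
Qed.

Lemma snormD x y : snorm (x + y) <= snorm x + snorm y.
Proof.
rewrite -(@ler_pXn2r _ 2) ?nnegrE ?addr_ge0 ?snorm_ge0// sqrrD !snormK.
rewrite sipDl !sipDr -(sip_conj s x y) addrA lerD2r -addrA lerD2l.
have xyr : s x y + (s x y)^* \is Num.real.
  by apply/CrealP; rewrite rmorphD/= conjCK addrC.
rewrite (le_trans (real_ler_norm xyr))// (le_trans (ler_normD _ _))//.
by rewrite norm_conjC mulr2n lerD ?sip_CauchySchwarz.
Qed.

Lemma snormZ a x : snorm (a *: x) = `|a| * snorm x.
Proof.
rewrite /snorm sipZl sipZr mulrA [_^* * _]mulrC -normCK sqrtCM ?nnegrE ?exprn_ge0 ?sip_ge0//.
by rewrite sqrCK.
Qed.

Lemma snormN x : snorm (- x) = snorm x.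
Proof. by rewrite -scaleN1r snormZ normrN1 mul1r. Qed.

Lemma snormBC x y : snorm (x - y) = snorm (y - x).
Proof. by rewrite -snormN opprB. Qed.

Lemma snorm0 : snorm 0 = 0.
Proof. by rewrite /snorm sip0r sqrtC0. Qed.

Definition scauchy u := forall e : R[i], 0 < e ->
  exists N, forall m n, (N <= m)%N -> (N <= n)%N -> snorm (u m - u n) < e.

Lemma scauchy_cst x : scauchy (fun=> x).
Proof. by move=> e e0; exists 0%N => m n _ _; rewrite subrr snorm0. Qed.

Lemma scauchy_lin a u v :
  scauchy u -> scauchy v -> scauchy (fun n => a *: u n + v n).
Proof.
move=> cu cv e e0; have a1 : 0 < `|a| + 1 by rewrite ltr_wpDl.
have [|N1 H1] := cu (e / 2 / (`|a| + 1)); first by rewrite !divr_gt0.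
have [|N2 H2] := cv (e / 2); first by rewrite divr_gt0.
exists (maxn N1 N2) => m n; rewrite !geq_max => /andP[m1 m2] /andP[n1 n2].
rewrite opprD addrACA -scalerBr; apply: le_lt_trans (snormD _ _) _.
rewrite [ltRHS]splitr; apply: ler_ltD (H2 _ _ m2 n2).
rewrite snormZ; have /ltW := H1 _ _ m1 n1; rewrite ler_pdivlMr// mulrC.
by apply: le_trans; rewrite ler_wpM2r ?snorm_ge0// lerDl ler01.
Qed.

Lemma scauchyB u v : scauchy u -> scauchy v -> scauchy (fun n => u n - v n).
Proof.
move=> cu cv; have := scauchy_lin (-1) cv cu.
by under eq_fun do rewrite scaleN1r addrC.
Qed.

Lemma scauchy_bounded u : scauchy u ->
  exists2 M, 0 < M & \forall n \near \oo, snorm (u n) <= M.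
Proof.
move=> /(_ 1 ltr01)[N HN]; exists (snorm (u N) + 1).
  by rewrite ltr_wpDl ?snorm_ge0.
exists N => // n /= Nn; rewrite -[u n](subrK (u N)) addrC.
by rewrite (le_trans (snormD _ _))// lerD2l ltW// HN.
Qed.

Lemma sip_cvg u v : scauchy u -> scauchy v -> cvgn (fun n => s (u n) (v n)).
Proof.
move=> cu cv; apply/cauchy_cvgP/cauchy_exP => e e0.
have [M M0 bu] := scauchy_bounded cu; have [K K0 bv] := scauchy_bounded cv.
have [|N1 H1] := cu (e / 2 / K); first by rewrite !divr_gt0.
have [|N2 H2] := cv (e / 2 / M); first by rewrite !divr_gt0.
have [N [N1N N2N bvN]] : exists N, [/\ (N1 <= N)%N, (N2 <= N)%N & snorm (v N) <= K].
  near \oo => N; exists N; split.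
  - by near: N; exact: nbhs_infty_ge.
  - by near: N; exact: nbhs_infty_ge.
  - by near: N.
exists (s (u N) (v N)); rewrite /nbhs /=; near=> n.
rewrite -ball_normE /= -opprB normrN.
have -> : s (u n) (v n) - s (u N) (v N) =
    s (u n - u N) (v N) + s (u n) (v n - v N).
  by rewrite sipBl sipBr; ring.
apply: le_lt_trans (ler_normD _ _) _; rewrite [ltRHS]splitr ltrD//.
  apply: le_lt_trans (sip_CauchySchwarz _ _) _.
  apply: le_lt_trans (ler_wpM2l (snorm_ge0 _) bvN) _.
  rewrite -ltr_pdivlMr// H1//; near: n; exact: nbhs_infty_ge.
apply: le_lt_trans (sip_CauchySchwarz _ _) _.
apply: (@le_lt_trans _ _ (M * snorm (v n - v N))).
  by rewrite ler_wpM2r ?snorm_ge0//; near: n.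
rewrite mulrC -ltr_pdivlMr// H2//; near: n; exact: nbhs_infty_ge.
Unshelve. all: by end_near. Qed.

Lemma sip_cvg0 u v : scauchy v -> snorm (u n) @[n --> \oo] --> (0 : R[i]) ->
  s (u n) (v n) @[n --> \oo] --> (0 : R[i]).
Proof.
move=> cv u0; have [K K0 bv] := scauchy_bounded cv.
apply/cvgrPdist_lt => e e0; near=> n; rewrite sub0r normrN.
apply: le_lt_trans (sip_CauchySchwarz _ _) _.
apply: (@le_lt_trans _ _ (snorm (u n) * K)).
  by rewrite ler_wpM2l ?snorm_ge0//; near: n.
rewrite -ltr_pdivlMr// -[ltLHS]ger0_norm ?snorm_ge0// -normrN -sub0r; near: n.
by move/cvgrPdist_lt : u0; apply; rewrite divr_gt0.
Unshelve. all: by end_near. Qed.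

Lemma snorm_cvg0 u : scauchy u ->
  (forall y, s y (u n) @[n --> \oo] --> (0 : R[i])) ->
  snorm (u n) @[n --> \oo] --> (0 : R[i]).
Proof.
move=> cu u0; have [M M0 bu] := scauchy_bounded cu.
apply/cvgrPdist_lt => e e0; pose d := e ^+ 2 / 2.
have d0 : 0 < d by rewrite divr_gt0 ?exprn_gt0.
have [|N H] := cu (d / M); first by rewrite divr_gt0.
near=> n; rewrite sub0r normrN ger0_norm ?snorm_ge0//.
rewrite -(@ltr_pXn2r _ 2) ?nnegrE ?snorm_ge0 ?ltW// snormK.
rewrite -[ltLHS]ger0_norm ?sip_ge0//.
have -> : s (u n) (u n) = s (u n - u N) (u n) + s (u N) (u n).
  by rewrite sipBl subrK.
have -> : e ^+ 2 = d + d by rewrite /d -splitr.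
apply: le_lt_trans (ler_normD _ _) _; apply: ltrD.
  apply: le_lt_trans (sip_CauchySchwarz _ _) _.
  apply: (@le_lt_trans _ _ (snorm (u n - u N) * M)).
    by rewrite ler_wpM2l ?snorm_ge0//; near: n.
  by rewrite -ltr_pdivlMr// H//; near: n; exact: nbhs_infty_ge.
rewrite -normrN -sub0r; near: n.
by move/cvgrPdist_lt : (u0 (u N)); apply.
Unshelve. all: by end_near. Qed.

(* The Hilbert space completion of (V, s) is realised inside the functionals
   V -> R[i]: a Cauchy sequence u is encoded by y |-> lim s y (u n), so that two
   sequences are identified exactly when their difference is s-null. See
   cdot_embed, embed_dense and completion_complete. *)
Definition represents u phi :=
  scauchy u /\ forall y, s y (u n) @[n --> \oo] --> phi y.

Definition completion_pred : {pred V -> R[i]} :=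
  [pred phi | `[< exists u, represents u phi >]].

Lemma represents_lin a u v phi psi : represents u phi -> represents v psi ->
  represents (fun n => a *: u n + v n) (a *: phi + psi).
Proof.
move=> [cu hu] [cv hv]; split; first exact: scauchy_lin.
move=> y; under eq_fun do rewrite sip_linear.
apply: cvgD (hv y); exact: (cvgM (cvg_cst a) (hu y)).
Qed.

Lemma represents_cst x : represents (fun=> x) (s ^~ x).
Proof. by split=> [|y]; [exact: scauchy_cst|exact: cvg_cst]. Qed.

Lemma completion_submod : GRing.submod_closed completion_pred.
Proof.
split=> [|a phi psi].
  apply/asboolP; exists (fun=> 0).
  have -> : (0 : V -> R[i]) = s ^~ 0 by apply/funext => y; rewrite sip0r.
  exact: represents_cst.
move=> /asboolP[u hu] /asboolP[v hv].
by apply/asboolP; eexists; exact: represents_lin hu hv.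
Qed.

HB.instance Definition _ :=
  GRing.isSubmodClosed.Build R[i] (V -> R[i]) completion_pred completion_submod.

Record completion := Completion {
  completion_val :> V -> R[i] ;
  completion_valP : completion_val \in completion_pred }.

HB.instance Definition _ := [isSub for completion_val].
HB.instance Definition _ := [Choice of completion by <:].
HB.instance Definition _ := [SubChoice_isSubLmodule of completion by <:].

Implicit Types p q : completion.

Lemma completion_repr p : {u | represents u p}.
Proof. by apply/cid; move: (completion_valP p) => /asboolP. Qed.

Definition crepr p := projT1 (completion_repr p).

Lemma creprP p : represents (crepr p) p.
Proof. exact: projT2 (completion_repr p). Qed.

Definition cdot p q : R[i] := limn (fun n => s (crepr p n) (crepr q n)).

Lemma represents_uniq u v phi : represents u phi -> represents v phi ->
  snorm (u n - v n) @[n --> \oo] --> (0 : R[i]).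
Proof.
move=> [cu hu] [cv hv]; apply: snorm_cvg0; first exact: scauchyB.
move=> y; under eq_fun do rewrite sipBr.
by rewrite -(subrr (phi y)); exact: cvgB.
Qed.

Lemma cvg_cdot u v p q : represents u p -> represents v q ->
  s (u n) (v n) @[n --> \oo] --> cdot p q.
Proof.
move=> hu hv; have := sip_cvg (creprP p).1 (creprP q).1; rewrite -/(cdot p q).
move=> h.
have -> : (fun n => s (u n) (v n)) = (fun n =>
  s (crepr p n) (crepr q n) + s (u n - crepr p n) (v n) +
  (s (v n - crepr q n) (crepr p n))^*).
  by apply/funext => n; rewrite sip_conj sipBl sipBr; ring.
rewrite -[cdot p q]addr0 -[cdot p q]addr0; apply: cvgD.
  apply: cvgD; first exact: h.
  by apply: sip_cvg0; [exact: hv.1|exact: represents_uniq hu (creprP p)].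
under eq_fun do rewrite sip_conj.
have h0 : s (v n - crepr q n) (crepr p n) @[n --> \oo] --> (0 : R[i]).
  by apply: sip_cvg0; [exact: (creprP p).1|exact: represents_uniq hv (creprP q)].
apply/cvgrPdist_lt => e e0; move/cvgrPdist_lt : h0 => /(_ e e0).
apply: filterS => n; rewrite !sub0r !normrN -sip_conj.
by rewrite norm_conjC.
Qed.

Lemma complex_cvg_ge0 (z : nat -> R[i]) l :
  (\forall n \near \oo, 0 <= z n) -> z @ \oo --> l -> 0 <= l.
Proof.
move=> z0 zl; suff -> : l = `|l| by [].
apply/eqP; rewrite -subr_eq0 -normr_le0; apply/ler_addgt0Pr => e e0.
rewrite add0r; near \oo => n.
have zn0 : 0 <= z n by near: n.
have -> : l - `|l| = (l - z n) + (`|z n| - `|l|).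
  by rewrite (ger0_norm zn0) addrA subrK.
rewrite (le_trans (ler_normD _ _))// [leRHS]splitr lerD//.
  by apply: ltW; near: n; move/cvgrPdist_lt : zl; apply; rewrite divr_gt0.
rewrite (le_trans (ler_dist_dist _ _))// distrC.
by apply: ltW; near: n; move/cvgrPdist_lt : zl; apply; rewrite divr_gt0.
Unshelve. all: by end_near. Qed.

Lemma complex_cvg_le (z : nat -> R[i]) l b :
  (\forall n \near \oo, z n <= b) -> z @ \oo --> l -> l <= b.
Proof.
move=> zb zl; rewrite -subr_ge0.
have h : (fun n => b - z n) @ \oo --> b - l by exact: cvgB (cvg_cst b) zl.
by apply: complex_cvg_ge0 h; apply: filterS zb => n; rewrite subr_ge0.
Qed.

Lemma completion_valD a p q : completion_val (a *: p + q) =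
  a *: completion_val p + completion_val q.
Proof. by []. Qed.

Lemma represents_valD a u v p q : represents u p -> represents v q ->
  represents (fun n => a *: u n + v n) (a *: p + q).
Proof.
move=> hu hv; rewrite completion_valD; exact: represents_lin.
Qed.

Lemma cdot_linear p a q r : cdot p (a *: q + r) = a * cdot p q + cdot p r.
Proof.
have h := cvg_cdot (creprP p) (creprP q).
have k := cvg_cdot (creprP p) (creprP r).
have l := cvg_cdot (creprP p) (represents_valD a (creprP q) (creprP r)).
have m : s (crepr p n) (a *: crepr q n + crepr r n) @[n --> \oo]
    --> a * cdot p q + cdot p r.
  under eq_fun do rewrite sip_linear.
  by apply: cvgD k; exact: (cvgM (cvg_cst a) h).
exact: complex_cvg_unique l m.
Qed.

Lemma cdot_conj p q : (cdot p q)^* = cdot q p.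
Proof.
have h := cvg_cdot (creprP q) (creprP p).
have k := cvg_cdot (creprP p) (creprP q).
suff l : s (crepr q n) (crepr p n) @[n --> \oo] --> (cdot p q)^*.
  exact: complex_cvg_unique l h.
have -> : (fun n => s (crepr q n) (crepr p n)) =
    (fun n => (s (crepr p n) (crepr q n))^*).
  by apply/funext => n; exact/esym/sip_conj.
move: (crepr p) (crepr q) (cdot p q) k => u v l k.
apply/cvgrPdist_lt => e e0; move/cvgrPdist_lt : k => /(_ e e0).
by apply: filterS => n h1; rewrite -norm_conjC rmorphB/= !conjCK.
Qed.

Lemma cdot_ge0 p : 0 <= cdot p p.
Proof.
apply: complex_cvg_ge0 (cvg_cdot (creprP p) (creprP p)).
by near=> n; exact: sip_ge0.
Unshelve. all: by end_near.
Qed.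

Definition completion_semiInner : semiInner completion :=
  SemiInner cdot_linear cdot_conj cdot_ge0.

Lemma embed_subproof x : (s ^~ x : V -> R[i]) \in completion_pred.
Proof. by apply/asboolP; eexists; exact: represents_cst. Qed.

Definition embed x : completion := Completion (embed_subproof x).

Lemma cdot_embedl x p : cdot (embed x) p = p x.
Proof.
have hx : represents (fun=> x) (embed x) by exact: represents_cst.
have h := cvg_cdot hx (creprP p).
exact: complex_cvg_unique h ((creprP p).2 x).
Qed.

Lemma cdot_embed x y : cdot (embed x) (embed y) = s x y.
Proof. exact: cdot_embedl. Qed.

End completion.

Section completion_norm.
Variables (R : realType) (V : lmodType R[i]) (s : semiInner V).
Local Notation H := (completion s).
Local Notation dot := (completion_semiInner s).
Implicit Types (x : V) (p q : H).

Lemma completion_norm0 p : snorm dot p = 0 -> p = 0.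
Proof.
move=> p0; apply/val_inj/funext => x /=.
apply/eqP; rewrite -normr_le0 -cdot_embedl.
by rewrite (le_trans (sip_CauchySchwarz dot _ _))// p0 mulr0.
Qed.

HB.instance Definition _ := Lmodule_isNormed.Build R[i] H
  (snormD dot) (snormZ dot) completion_norm0.

Lemma completion_normE p : `|p| ^+ 2 = dot p p.
Proof. exact: snormK. Qed.

Lemma embed_lin a x y : embed s (a *: x + y) = a *: embed s x + embed s y.
Proof. by apply/val_inj/funext => z; exact: sip_linear. Qed.

Lemma embedB x y : embed s (x - y) = embed s x - embed s y.
Proof.
have := embed_lin (-1) y x.
by rewrite (scaleN1r y) (scaleN1r (embed s y)) addrC => ->; rewrite addrC.
Qed.

Lemma norm_embed x : `|embed s x| = snorm s x.
Proof. exact: (congr1 sqrtC (cdot_embed s x x)). Qed.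

Lemma represents_dist (u : nat -> V) p N (e : R[i]) : represents s u p -> 0 <= e ->
  (forall n, (N <= n)%N -> snorm s (u n - u N) <= e) -> `|p - embed s (u N)| <= e.
Proof.
move=> hu e0 he.
rewrite -(@ler_pXn2r _ 2) ?nnegrE// completion_normE.
have hN : represents s (fun=> u N) (embed s (u N)) by exact: represents_cst.
have := represents_valD (-1) hN hu.
rewrite (scaleN1r (embed s (u N))) (addrC (- embed s (u N)) p) => hv.
apply: complex_cvg_le (cvg_cdot hv hv); exists N => // n Nn /=.
by rewrite -snormK addrC scaleN1r ler_pXn2r ?nnegrE ?snorm_ge0 ?he.
Qed.

Lemma embed_dense p (e : R[i]) : 0 < e -> exists x, `|p - embed s x| < e.
Proof.
move=> e0; have [u hu] := completion_repr p.
have [|N H] := hu.1 (e / 2); first by rewrite divr_gt0.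
exists (u N); apply: (@le_lt_trans _ _ (e / 2)).
  apply: represents_dist hu _ _ => [|n Nn]; first by rewrite ltW ?divr_gt0.
  exact/ltW/H.
by rewrite ltr_pdivrMr// ltr_pMr// ltr1n.
Qed.

Lemma completion_complete (F : set_system H) :
  ProperFilter F -> cauchy F -> cvg F.
Proof.
move=> FF /cauchyP Fc.
pose d k : R[i] := (k.+1%:R^-1)%:C.
have d0 k : 0 < d k by rewrite ltcR.
have d2 k : 0 < d k / 2 by rewrite divr_gt0.
have ex k : exists x, F (ball (embed s x) (d k)).
  have [p Fp] := Fc _ (d2 k); have [x px] := embed_dense p (d2 k).
  exists x; apply: filterS Fp => q; rewrite -!ball_normE /= => pq.
  apply: le_lt_trans (ler_distD p _ _) _; rewrite [ltRHS]splitr.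
  by apply: ltrD pq; rewrite (distrC (embed s x) p).
have [x hx] := choice ex.
have near_d (e : R[i]) : 0 < e -> exists N, forall n, (N <= n)%N -> d n < e.
  move=> e0; have eE : e = (complex.Re e)%:C by rewrite RRe_real// gtr0_real.
  move: e0; rewrite eE ltcR => e0.
  have [N _ HN] := near_infty_natSinv_lt (PosNum e0).
  by exists N => n Nn; rewrite ltcR; exact: HN.
have cx : scauchy s x.
  move=> e e0; have [|N HN] := near_d (e / 2); first by rewrite divr_gt0.
  exists N => m n Nm Nn.
  have [q [qm qn]] := filter_ex (filterI (hx m) (hx n)).
  move: qm qn; rewrite -!ball_normE /= => qm qn.
  rewrite -norm_embed embedB.
  apply: le_lt_trans (ler_distD q _ _) _; rewrite [ltRHS]splitr.
  apply: ltrD; first exact: lt_trans qm (HN _ Nm).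
  by rewrite (distrC q); exact: lt_trans qn (HN _ Nn).
have cvgx y : cvgn (fun n => s y (x n)) by exact: sip_cvg (scauchy_cst s y) cx.
pose phi : V -> R[i] := fun y => limn (fun n => s y (x n)).
have rphi : represents s x phi by split.
have phiP : phi \in completion_pred s by apply/asboolP; exists x.
apply: (cvgP (Completion phiP)); apply/cvgrPdist_lt => e e0.
have [|N1 H1] := near_d (e / 2); first by rewrite divr_gt0.
have [|N2 H2] := cx (e / 2); first by rewrite divr_gt0.
pose N := maxn N1 N2.
have dN : `|Completion phiP - embed s (x N)| <= e / 2.
  apply: (@represents_dist x (Completion phiP)) => //.
    by rewrite ltW ?divr_gt0.
  move=> n Nn; apply/ltW/H2; last exact: leq_maxr.
  by apply: leq_trans Nn; exact: leq_maxr.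
apply: filterS (hx N) => q; rewrite -ball_normE /= => qN.
apply: le_lt_trans (ler_distD (embed s (x N)) _ _) _; rewrite [ltRHS]splitr.
apply: ler_ltD dN _; apply: lt_trans qN (H1 _ _); exact: leq_maxl.
Qed.

HB.instance Definition _ := Uniform_isComplete.Build H completion_complete.

End completion_norm.

(* No unit is assumed. *)
Record commCstarAlgebra (R : realType) := CommCstarAlgebra {
  ca_sort :> completeNormedModType R[i] ;
  ca_mul : ca_sort -> ca_sort -> ca_sort ;
  ca_star : ca_sort -> ca_sort ;
  ca_mulA : associative ca_mul ;
  ca_mulC : commutative ca_mul ;
  ca_mul_linear : forall a z b c,
    ca_mul a (z *: b + c) = z *: ca_mul a b + ca_mul a c ;
  ca_starK : involutive ca_star ;
  ca_star_linear : forall z a b,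
    ca_star (z *: a + b) = z^* *: ca_star a + ca_star b ;
  ca_starM : forall a b, ca_star (ca_mul a b) = ca_mul (ca_star b) (ca_star a) ;
  ca_normM : forall a b, `|ca_mul a b| <= `|a| * `|b| ;
  ca_norm_starM : forall a, `|ca_mul (ca_star a) a| = `|a| ^+ 2 }.

(* Inner products are linear in the second variable. *)
Record hilbertModule (R : realType) (A : commCstarAlgebra R) := HilbertModule {
  hm_sort :> completeNormedModType R[i] ;
  hm_act : hm_sort -> A -> hm_sort ;
  hm_inner : hm_sort -> hm_sort -> A ;
  hm_act_linearl : forall a z u v,
    hm_act (z *: u + v) a = z *: hm_act u a + hm_act v a ;
  hm_act_linearr : forall u z a b,
    hm_act u (z *: a + b) = z *: hm_act u a + hm_act u b ;
  hm_actM : forall u a b, hm_act u (ca_mul a b) = hm_act (hm_act u a) b ;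
  hm_inner_linear : forall u z v w,
    hm_inner u (z *: v + w) = z *: hm_inner u v + hm_inner u w ;
  hm_inner_act : forall u v a,
    hm_inner u (hm_act v a) = ca_mul (hm_inner u v) a ;
  hm_inner_star : forall u v, ca_star (hm_inner u v) = hm_inner v u ;
  hm_inner_ge0 : forall u, exists a, hm_inner u u = ca_mul (ca_star a) a ;
  hm_normE : forall u, `|u| ^+ 2 = `|hm_inner u u| }.

Record hilbertSpace (R : realType) := HilbertSpace {
  hs_sort :> completeNormedModType R[i] ;
  hs_dot : hs_sort -> hs_sort -> R[i] ;
  hs_dot_linear : forall x z y w,
    hs_dot x (z *: y + w) = z * hs_dot x y + hs_dot x w ;
  hs_dot_conj : forall x y, (hs_dot x y)^* = hs_dot y x ;
  hs_normE : forall x, `|x| ^+ 2 = hs_dot x x }.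

Section hilbert_space_operators.
Variables (R : realType) (H : hilbertSpace R).
Implicit Types (S P B : H -> H).

Definition hs_adjoint S : H -> H :=
  xget (fun=> 0) [set S' | forall x y, hs_dot (S x) y = hs_dot x (S' y)].

Definition op_poly (q : {poly R}) P : H -> H :=
  fun x => \sum_(i < size q) (q`_i)%:C *: iter i P x.

(* B = f(P) for the continuous functional calculus of a bounded positive
   operator P: the spectrum of P lies in [0, M], and f(P) is the norm limit of
   q_n(P) for polynomials q_n converging to f uniformly on [0, M]. *)
Definition is_fun_calculus (f : R -> R) P B := exists (M : R) (q : nat -> {poly R}),
  [/\ forall x, `|P x| <= M%:C * `|x|,
      forall e : R, 0 < e -> \forall n \near \oo,
        forall t : R, 0 <= t <= M -> `|(q n).[t] - f t| <= e
    & forall e : R, 0 < e -> \forall n \near \oo,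
        forall x, `|op_poly (q n) P x - B x| <= e%:C * `|x| ].

Definition fun_calculus (f : R -> R) P : H -> H :=
  xget (fun=> 0) (is_fun_calculus f P).

Definition op_abs S : H -> H := fun_calculus Num.sqrt (hs_adjoint S \o S).

Definition op_abs_powR S (p : R) : H -> H :=
  fun_calculus (fun t => t `^ p) (op_abs S).

Definition orthonormal_basis (X : set H) :=
  (forall e f, X e -> X f -> hs_dot e f = (e == f)%:R) /\
  (forall x, (forall e, X e -> hs_dot e x = 0) -> x = 0).

(* Meant for positive P, where the sum does not depend on the basis. *)
Definition trace P : \bar R :=
  \esum_(e in xget set0 orthonormal_basis) (complex.Re (hs_dot e (P e)))%:E.

End hilbert_space_operators.

Section characters.
Variables (R : realType) (A : commCstarAlgebra R).

Record character := Character {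
  character_fun :> A -> R[i] ;
  character_linear : forall z a b,
    character_fun (z *: a + b) = z * character_fun a + character_fun b ;
  characterM : forall a b,
    character_fun (ca_mul a b) = character_fun a * character_fun b ;
  character_star : forall a, character_fun (ca_star a) = (character_fun a)^* ;
  character_neq0 : exists a, character_fun a != 0 }.

HB.instance Definition _ := gen_eqMixin character.
HB.instance Definition _ := gen_choiceMixin character.

(* The weak-* topology, i.e. the one of pointwise convergence on A. *)
HB.instance Definition _ := Topological.copy character
  (initial_topology (character_fun : character -> prod_topology (fun=> R[i]))).

(* f takes finite values and lies in C_0 of the space of characters. *)
Definition in_C0 (f : character -> \bar R) := exists g : character -> R,
  [/\ forall chi, f chi = (g chi)%:E,
      continuous g
    & forall e : R, 0 < e -> exists2 K, compact K &
        forall chi, ~ K chi -> `|g chi| < e ].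

End characters.

Section hilbert_module_operators.
Variables (R : realType) (A : commCstarAlgebra R) (E : hilbertModule A).
Implicit Types (S T : E -> E) (u v w : E) (chi : character A).

Definition countably_generated := exists g : nat -> E,
  closure [set u | exists n (a : 'I_n -> A),
    u = \sum_(i < n) hm_act (g i) (a i)] = setT.

Definition adjointable : set (E -> E) := [set T |
  exists S, forall u v, hm_inner (T u) v = hm_inner u (S v)].

Definition rank_one v w : E -> E := fun u => hm_act v (hm_inner w u).

Definition compact_operators : set (E -> E) := [set T | adjointable T /\
  forall e : R, 0 < e -> exists n (v w : 'I_n -> E),
    forall u, `|T u - \sum_(i < n) rank_one (v i) (w i) u| <= e%:C * `|u| ].

Definition two_sided_ideal (J : set (E -> E)) :=
  [/\ J `<=` adjointable,
      J (fun=> 0),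
      forall S T, J S -> J T -> J (fun u => S u + T u),
      forall z T, J T -> J (fun u => z *: T u)
    & forall S T, adjointable S -> J T -> J (S \o T) /\ J (T \o S) ].

Section localization.
Variable chi : character A.

Definition localized_dot u v : R[i] := chi (hm_inner u v).

Lemma localized_dot_linear u z v w : localized_dot u (z *: v + w) =
  z * localized_dot u v + localized_dot u w.
Proof. by rewrite /localized_dot hm_inner_linear character_linear. Qed.

Lemma localized_dot_conj u v : (localized_dot u v)^* = localized_dot v u.
Proof. by rewrite /localized_dot -character_star hm_inner_star. Qed.

Lemma localized_dot_ge0 u : 0 <= localized_dot u u.
Proof.
rewrite /localized_dot; have [a ->] := hm_inner_ge0 u.
by rewrite characterM character_star mulrC -normCK exprn_ge0.
Qed.

Definition localized_form : semiInner E :=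
  SemiInner localized_dot_linear localized_dot_conj localized_dot_ge0.

(* The interior tensor product of E and C over A along chi: the completion of
   E (= the algebraic tensor product of E and C over C) for the form
   <u (x) y, v (x) z> = y^* * chi <u, v> * z. *)
Definition localized_space : hilbertSpace R := @HilbertSpace R
  (completion localized_form) (@cdot _ _ localized_form)
  (@cdot_linear _ _ localized_form) (@cdot_conj _ _ localized_form)
  (@completion_normE _ _ localized_form).

Definition tensor u (z : R[i]) : localized_space := z *: embed localized_form u.

Lemma tensor_act u a z : tensor (hm_act u a) z = tensor u (chi a * z).
Proof.
rewrite /tensor mulrC -scalerA; congr (_ *: _); apply/val_inj/funext => v.
change (chi (hm_inner v (hm_act u a)) = chi a * chi (hm_inner v u)).
by rewrite hm_inner_act characterM mulrC.
Qed.

Lemma dot_tensor u y v z :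
  hs_dot (tensor u y) (tensor v z) = y^* * chi (hm_inner u v) * z.
Proof.
have dotE := sipZr (completion_semiInner localized_form).
have dotEl := sipZl (completion_semiInner localized_form).
rewrite [LHS]dotE [X in _ * X]dotEl [z * _]mulrC; congr (_ * _ * _).
exact: cdot_embed.
Qed.

(* T (x) 1 *)
Definition localized_op T : localized_space -> localized_space :=
  xget (fun=> 0) [set S : localized_space -> localized_space |
    [/\ linear S, continuous S & forall u z, S (tensor u z) = tensor (T u) z] ].

End localization.

Definition schatten_class (p : R) : set (E -> E) := [set T | adjointable T /\
  in_C0 (fun chi => trace (op_abs_powR (localized_op (chi := chi) T) p))].

End hilbert_module_operators.

Arguments countably_generated {R A} E.
Arguments adjointable {R A} E.
Arguments compact_operators {R A} E.
Arguments two_sided_ideal {R A} E J.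
Arguments localized_space {R A} E chi.
Arguments localized_op {R A E} chi T _.
Arguments schatten_class {R A} E p.

(* Main.v *)
(* For a character chi let sigma_k(chi) be the k-th Gelfand number of chi_* T, i.e. the
   infimum of the norms of chi_* T on the orthogonal complements of k vectors. On a
   Hilbert space, a finite tr |T|^p forces T to be compact, and then tr |T|^p is the sum
   of the sigma_k^p. Lifting almost singular vectors of chi0_* T to E shows that sigma_k is
   lower semicontinuous at chi0; since the sum of the sigma_k^p is continuous, so is each
   sigma_k, and by Dini's theorem the tails of the sum are uniformly small.

   T is then compact: Ky Fan's maximum principle for the lifted vectors gives finitely
   many v in E with |T x|_chi <= eps |x|_chi + sum_v |chi <v, x>| for all chi and x. For
   h = sum_v |v><v|, M >= |h| and N large this makes T (1 - h / M)^N small in all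
   localizations, hence in norm, whereas T - T (1 - h / M)^N has finite rank.

   Conversely, compactness and uniformly small tails imply membership in the Schatten
   class, and they pass to sums and products because
   sigma_{2k}(S + T) <= sigma_k(S) + sigma_k(T) and sigma_k(S T) <= |S| sigma_k(T).

   The norm of E is the supremum of the localized seminorms because A has enough
   characters: a minimal one among the C*-seminorms p with p(a) = |a| and
   p(a x) = |a| p(x) is multiplicative and, by Gelfand-Mazur, the modulus of a character. *)

Require Import Defs.
From mathcomp Require Import all_boot all_order all_algebra.
From mathcomp Require Import complex ring lra.
From mathcomp Require Import all_classical all_reals all_analysis.

Set Implicit Arguments.
Unset Strict Implicit.
Unset Printing Implicit Defensive.

Import Order.TTheory GRing.Theory Num.Theory.
Import numFieldNormedType.Exports.

Local Open Scope classical_set_scope.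
Local Open Scope complex_scope.
Local Open Scope ring_scope.

(** * Seminorms and Gelfand numbers *)

(** Upper semicontinuity of a singular value can fail for an adjointable operator. Both directions
    of the proof extract it from a sum that is upper semicontinuous as a whole and whose terms are
    lower semicontinuous ([usc_of_sum]). For a Schatten operator this sum is the trace. In the
    converse direction T is a norm limit of finite rank operators F, and the squares of the singular
    values of chi_* F add up to the real part of chi at one fixed element of A.

    Gelfand numbers make sense for every bounded operator and are defined by inequalities between
    vectors, so sums, products and norm limits need no spectral theory; only [svd] identifies them
    with eigenvalue data. Many estimates are stated for a semi-inner product and so apply both to E
    with the degenerate form of a character and to its completion.

    The operator |T|^p is given only as a choice of a limit of polynomials. What is retained of it
    is positivity, boundedness, its action on eigenvectors of T^* T, and a two-sided comparison of
    its quadratic form with that of T^* T ([op_abs_powR_spec]). *)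

Lemma natSinv_small (R : realType) (e : R) : 0 < e ->
  exists n, forall m, (n <= m)%N -> m.+1%:R^-1 <= e.
Proof.
move=> e0; have [n _ hn] := near_infty_natSinv_lt (PosNum e0).
by exists n => m nm; rewrite ltW//; exact: (hn m nm).
Qed.

Section real_norm.
Variables (R : realType) (W : normedZmodType R[i]).
Implicit Types x y : W.

(** The norm takes values in R[i]; its real part has a totally ordered codomain, in which infima and
    linear arithmetic are available. *)
Definition nr x : R := complex.Re `|x|.

Lemma nrE x : (nr x)%:C = `|x|.
Proof. by rewrite /nr RRe_real// normr_real. Qed.

Lemma nr_ge0 x : 0 <= nr x.
Proof. by rewrite -ler0c nrE. Qed.

Lemma ler_nrD x y : nr (x + y) <= nr x + nr y.
Proof. by rewrite -lecR rmorphD/= !nrE ler_normD. Qed.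

Lemma nrN x : nr (- x) = nr x.
Proof. by rewrite /nr normrN. Qed.

Lemma nr0 : nr 0 = 0.
Proof. by rewrite /nr normr0. Qed.

Lemma nrBC x y : nr (x - y) = nr (y - x).
Proof. by rewrite /nr distrC. Qed.

Lemma nr_eq0 x : (nr x == 0) = (x == 0).
Proof. by rewrite -[RHS]normr_eq0 -nrE (inj_eq (@complexI R)). Qed.

Lemma nr_sum (I : Type) (r : seq I) (P : pred I) (F : I -> W) :
  nr (\sum_(i <- r | P i) F i) <= \sum_(i <- r | P i) nr (F i).
Proof.
elim/big_ind2 : _ => [|x a y b xa yb|//]; first by rewrite nr0.
exact: le_trans (ler_nrD _ _) (lerD xa yb).
Qed.

Lemma le_nrP x (e : R) : `|x| <= e%:C <-> nr x <= e.
Proof. by rewrite -nrE lecR. Qed.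

Lemma lt_nrP x (e : R) : `|x| < e%:C <-> nr x < e.
Proof. by rewrite -nrE ltcR. Qed.

End real_norm.

Lemma nrZ (R : realType) (W : normedModType R[i]) (a : R[i]) (x : W) :
  nr (a *: x) = nr a * nr x.
Proof. by apply: complexI; rewrite rmorphM/= !nrE normrZ. Qed.

Section complex_modulus.
Variable R : realType.
Implicit Types a b : R[i].

Lemma nrM a b : nr (a * b) = nr a * nr b.
Proof. by apply: complexI; rewrite rmorphM/= !nrE normrM. Qed.

Lemma nr_real (r : R) : nr r%:C = `|r|.
Proof. by rewrite /nr normc_def /= expr0n /= addr0 sqrtr_sqr. Qed.

Lemma nr1 : nr (1 : R[i]) = 1.
Proof. by rewrite /nr normr1. Qed.

Lemma nr_conj a : nr a^* = nr a.
Proof. by rewrite /nr norm_conjC. Qed.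

Lemma norm_Re_le_nr a : `|complex.Re a| <= nr a.
Proof. by rewrite -lecR nrE normc_ge_Re. Qed.

Lemma Re_le_nr a : complex.Re a <= nr a.
Proof. exact: le_trans (ler_norm _) (norm_Re_le_nr a). Qed.

Lemma norm_Im_le_nr a : `|complex.Im a| <= nr a.
Proof.
rewrite -lecR nrE normc_def lecR -sqrtr_sqr ler_sqrt ?lerDr ?sqr_ge0//.
by rewrite addr_ge0 ?sqr_ge0.
Qed.

Lemma nr_conjM a : a^* * a = (nr a ^+ 2)%:C.
Proof. by rewrite mulrC -normCK rmorphXn/= nrE. Qed.

Lemma Re_realM (r : R) a : complex.Re (r%:C * a) = r * complex.Re a.
Proof. by case: a => x y /=; rewrite mul0r subr0. Qed.

Lemma conj_real (r : R) : (r%:C)^* = r%:C :> R[i].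
Proof. by rewrite conj_Creal//; apply/complex_realP; exists r. Qed.

Lemma ReD a b : complex.Re (a + b) = complex.Re a + complex.Re b.
Proof. exact: raddfD. Qed.

Lemma ReB a b : complex.Re (a - b) = complex.Re a - complex.Re b.
Proof. exact: raddfB. Qed.

Lemma Re_conj a : complex.Re (a^*) = complex.Re a.
Proof. by case: a => x y. Qed.

Lemma Re_sum (I : Type) (r : seq I) (P : pred I) (F : I -> R[i]) :
  complex.Re (\sum_(i <- r | P i) F i) = \sum_(i <- r | P i) complex.Re (F i).
Proof. exact: (raddf_sum (@complex.Re R)). Qed.

End complex_modulus.

Section seminorm.
Variables (R : realType) (V : lmodType R[i]) (s : semiInner V).
Implicit Types (x y z : V) (a : R[i]).

Definition sn x : R := complex.Re (snorm s x).

Lemma snE x : (sn x)%:C = snorm s x.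
Proof. by rewrite /sn RRe_real// ger0_real// snorm_ge0. Qed.

Lemma sn_ge0 x : 0 <= sn x.
Proof. by rewrite -ler0c snE snorm_ge0. Qed.
Hint Resolve sn_ge0 : core.

Lemma sip_sqr x : s x x = (sn x ^+ 2)%:C.
Proof. by rewrite rmorphXn/= snE snormK. Qed.

Lemma sn_sqr x : sn x ^+ 2 = complex.Re (s x x).
Proof. by rewrite sip_sqr. Qed.

Lemma ler_snD x y : sn (x + y) <= sn x + sn y.
Proof. by rewrite -lecR rmorphD/= !snE snormD. Qed.

Lemma snZ a x : sn (a *: x) = nr a * sn x.
Proof. by apply: complexI; rewrite rmorphM/= nrE !snE snormZ. Qed.

Lemma snN x : sn (- x) = sn x.
Proof. by rewrite /sn snormN. Qed.

Lemma snBC x y : sn (x - y) = sn (y - x).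
Proof. by rewrite /sn snormBC. Qed.

Lemma sn0 : sn 0 = 0.
Proof. by rewrite /sn snorm0. Qed.

Lemma ler_snB x y : sn (x - y) <= sn x + sn y.
Proof. by rewrite -(snN y) ler_snD. Qed.

Lemma ler_sn_dist x y : sn x <= sn y + sn (x - y).
Proof. by rewrite -{1}(subrK y x) addrC ler_snD. Qed.

Lemma CauchySchwarz x y : nr (s x y) <= sn x * sn y.
Proof. by rewrite -lecR rmorphM/= nrE !snE sip_CauchySchwarz. Qed.

Lemma sip0l x : s 0 x = 0.
Proof. by rewrite -sip_conj sip0r conjC0. Qed.

Lemma sip_sumr x (I : Type) (r : seq I) (P : pred I) (F : I -> V) :
  s x (\sum_(i <- r | P i) F i) = \sum_(i <- r | P i) s x (F i).
Proof.
elim/big_ind2 : _ => [|u a v b <- <-|//]; first exact: sip0r.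
exact: sipDr.
Qed.

Lemma sip_suml x (I : Type) (r : seq I) (P : pred I) (F : I -> V) :
  s (\sum_(i <- r | P i) F i) x = \sum_(i <- r | P i) s (F i) x.
Proof.
elim/big_ind2 : _ => [|u a v b <- <-|//]; first exact: sip0l.
exact: sipDl.
Qed.

Lemma sn_sum (I : Type) (r : seq I) (P : pred I) (F : I -> V) :
  sn (\sum_(i <- r | P i) F i) <= \sum_(i <- r | P i) sn (F i).
Proof.
elim/big_ind2 : _ => [|x a y b xa yb|//]; first by rewrite sn0.
exact: le_trans (ler_snD _ _) (lerD xa yb).
Qed.

Lemma sn_sqrD x y :
  sn (x + y) ^+ 2 = sn x ^+ 2 + 2 * complex.Re (s x y) + sn y ^+ 2.
Proof.
rewrite !sn_sqr sipDl !sipDr -(sip_conj s x y) !raddfD /= Re_conj; ring.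
Qed.

Lemma sn_sqrB x y :
  sn (x - y) ^+ 2 = sn x ^+ 2 - 2 * complex.Re (s x y) + sn y ^+ 2.
Proof. by rewrite sn_sqrD sipNr snN raddfN mulrN. Qed.

Lemma Pythagoras x y : s x y = 0 -> sn (x + y) ^+ 2 = sn x ^+ 2 + sn y ^+ 2.
Proof. by move=> xy; rewrite sn_sqrD xy mulr0 addr0. Qed.

Lemma sn_null x : (forall y, s y x = 0) -> sn x = 0.
Proof. by move=> /(_ x) h; apply/eqP; rewrite -sqrf_eq0 sn_sqr h. Qed.

Lemma sip_eq0_sym x y : s x y = 0 -> s y x = 0.
Proof. by move=> h; rewrite -sip_conj h conjC0. Qed.

(* Orthonormal up to vanishing members. *)
Definition onf (f : nat -> V) := (forall i j, i != j -> s (f i) (f j) = 0) /\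
  forall i, f i = 0 \/ sn (f i) = 1.

(** Zero members of f contribute nothing, so a finite orthonormal system can be padded to a
    sequence. *)
Definition proj (f : nat -> V) n x := \sum_(i < n) s (f i) x *: f i.

Variable f : nat -> V.
Hypothesis fon : onf f.

Lemma onf_le1 i : sn (f i) <= 1.
Proof. by have [->|->] := fon.2 i; rewrite ?sn0 ?ler01. Qed.

Lemma onf_dotK i x : s (f i) (f i) * s (f i) x = s (f i) x.
Proof.
have [->|fi] := fon.2 i; first by rewrite !sip0l mulr0.
by rewrite sip_sqr fi expr1n mul1r.
Qed.

Lemma onf_dot_sum n j (c : nat -> R[i]) : (j < n)%N ->
  s (f j) (\sum_(i < n) c i *: f i) = c j * s (f j) (f j).
Proof.
move=> jn; rewrite sip_sumr (bigD1 (Ordinal jn))//= sipZr big1 ?addr0// => i ij.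
by rewrite sipZr fon.1 ?mulr0// eq_sym.
Qed.

Lemma dot_proj n j x : (j < n)%N -> s (f j) (proj f n x) = s (f j) x.
Proof.
move=> jn; rewrite /proj (@onf_dot_sum n j (fun i => s (f i) x))// mulrC.
exact: onf_dotK.
Qed.

Lemma dot_sub_proj n j x : (j < n)%N -> s (f j) (x - proj f n x) = 0.
Proof. by move=> jn; rewrite sipBr dot_proj// subrr. Qed.

Lemma onf_sum_sqr n (c : nat -> R[i]) :
  sn (\sum_(i < n) c i *: f i) ^+ 2 = \sum_(i < n) nr (c i) ^+ 2 * sn (f i) ^+ 2.
Proof.
rewrite sn_sqr sip_suml Re_sum; apply: eq_bigr => i _.
by rewrite sipZl onf_dot_sum// mulrA nr_conjM sip_sqr Re_realM.
Qed.

Lemma sn_proj n x : sn (proj f n x) ^+ 2 = \sum_(i < n) nr (s (f i) x) ^+ 2.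
Proof.
rewrite /proj (onf_sum_sqr n (fun i => s (f i) x)); apply: eq_bigr => i _.
have [->|->] := fon.2 i; last by rewrite expr1n mulr1.
by rewrite sip0l nr0 expr0n /= mul0r.
Qed.

Lemma dot_sub_projl n x y : (forall j, (j < n)%N -> s (f j) x = 0) ->
  s (proj f n y) x = 0.
Proof.
by move=> h; rewrite sip_suml big1// => i _; rewrite sipZl h ?mulr0.
Qed.

Lemma sn_sub_proj n x :
  sn x ^+ 2 = \sum_(i < n) nr (s (f i) x) ^+ 2 + sn (x - proj f n x) ^+ 2.
Proof.
rewrite -sn_proj -Pythagoras ?[proj _ _ _ + _]addrC ?subrK//.
by apply: dot_sub_projl => j jn; exact: dot_sub_proj.
Qed.

Lemma sn_sub_proj_le n x : sn (x - proj f n x) <= sn x.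
Proof.
rewrite -(@ler_pXn2r _ 2) ?nnegrE// (sn_sub_proj n x) lerDr.
by apply: sumr_ge0 => i _; rewrite exprn_ge0 ?nr_ge0.
Qed.

End seminorm.
#[global] Hint Extern 0 (is_true (0 <= sn _ _)) => exact: sn_ge0 : core.
#[global] Hint Extern 0 (is_true (0 <= nr _)) => exact: nr_ge0 : core.

Section linear_maps.
Variables (R : realType) (V : lmodType R[i]).
Implicit Types (S : V -> V) (x y : V) (a : R[i]).

Lemma lin0 S : linear S -> S 0 = 0.
Proof. by move=> Sl; have := Sl (-1) 0 0; rewrite scaler0 addr0 scaleN1r addNr. Qed.

Lemma linB S x y : linear S -> S (x - y) = S x - S y.
Proof.
move=> Sl; have -> : x - y = -1 *: y + x by rewrite scaleN1r addrC.
by rewrite Sl scaleN1r addrC.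
Qed.

Lemma linZ S a x : linear S -> S (a *: x) = a *: S x.
Proof. by move=> Sl; have := Sl a x 0; rewrite (lin0 Sl) !addr0. Qed.

Lemma linD S x y : linear S -> S (x + y) = S x + S y.
Proof. by move=> Sl; have := Sl 1 x y; rewrite !scale1r. Qed.

Lemma linear_comb (I : Type) (r : seq I) (P : pred I) (a : I -> R[i]) (F : I -> V) S :
  linear S -> S (\sum_(i <- r | P i) a i *: F i) = \sum_(i <- r | P i) a i *: S (F i).
Proof.
move=> Sl; rewrite (big_morph S (fun x y => linD x y Sl) (lin0 Sl)).
by apply: eq_bigr => i _; rewrite linZ.
Qed.

End linear_maps.

Section operators.
Variables (R : realType) (V : lmodType R[i]) (s : semiInner V).
Implicit Types (x y z : V) (a : R[i]) (S T : V -> V) (c d M : R) (b : seq V).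

Definition definite := forall x, sn s x = 0 -> x = 0.

Definition adjoints T T' := forall x y, s (T x) y = s x (T' y).

Definition bounded_by T M := forall x, sn s (T x) <= M * sn s x.

Definition orthogonal_to b x := forall y, y \in b -> s y x = 0.

(* The k-th Gelfand number of T, counted from 0, is at most c. *)
Definition gelfand_le T k c :=
  exists2 b, (size b <= k)%N & forall x, orthogonal_to b x -> sn s (T x) <= c * sn s x.

Definition compact_op T := forall e, 0 < e -> exists k, gelfand_le T k e.

(** The constraint [0 <= c] keeps the set bounded below: if only null vectors are orthogonal to some
    short list, every c would be admissible. *)
Definition gelfand T k : R := inf [set c | 0 <= c /\ gelfand_le T k c].

Lemma adjoints_sym T T' : adjoints T T' -> adjoints T' T.
Proof. by move=> h x y; rewrite -sip_conj -h sip_conj. Qed.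

Lemma adjoints_linear T T' : definite -> adjoints T T' -> linear T.
Proof.
move=> sd h a x y; apply/eqP; rewrite -subr_eq0; apply/eqP/sd/sn_null => z.
rewrite sipBr sip_linear.
have E u : s z (T u) = s (T' z) u by rewrite (adjoints_sym h).
by rewrite !E sip_linear subrr.
Qed.

Lemma adjoints_bounded T T' M : 0 <= M -> adjoints T T' -> bounded_by T M -> bounded_by T' M.
Proof.
move=> M0 TT TM x; have [->|x0] := eqVneq (sn s (T' x)) 0; first exact: mulr_ge0.
have : sn s (T' x) ^+ 2 <= sn s (T' x) * (M * sn s x).
  rewrite sn_sqr -TT (le_trans (Re_le_nr _))// (le_trans (CauchySchwarz _ _ _))//.
  by rewrite mulrCA mulrA ler_wpM2r.
by rewrite expr2 ler_pM2l// lt0r x0 sn_ge0.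
Qed.

Lemma gelfand_le_ge0 T k c c' : 0 <= c -> c <= c' -> gelfand_le T k c -> gelfand_le T k c'.
Proof.
move=> c0 cc' [b bk h]; exists b => // x /h; move=> /le_trans; apply.
exact: ler_wpM2r.
Qed.

Lemma gelfand_le_leq T k l c : (k <= l)%N -> gelfand_le T k c -> gelfand_le T l c.
Proof. by move=> kl [b bk h]; exists b => //; exact: leq_trans bk kl. Qed.

Lemma gelfand_le_bounded T M k : bounded_by T M -> gelfand_le T k M.
Proof. by move=> h; exists [::] => // x _; exact: h. Qed.

Lemma gelfand_le_comp S T M k c : 0 <= M -> bounded_by S M -> gelfand_le T k c ->
  gelfand_le (S \o T) k (M * c).
Proof.
move=> M0 hS [b bk h]; exists b => // x /h hx /=.
by rewrite (le_trans (hS _))// -mulrA ler_wpM2l.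
Qed.

(** S x is orthogonal to b exactly when x is orthogonal to the images of b under the adjoint, a list
    of the same length. *)
Lemma gelfand_le_precomp S S' T M k c : 0 <= c -> adjoints S S' -> bounded_by S M ->
  gelfand_le T k c -> gelfand_le (T \o S) k (c * M).
Proof.
move=> c0 hSS hS [b bk h]; exists (map S' b); first by rewrite size_map.
move=> x hx; have /h : orthogonal_to b (S x).
  move=> y yb; rewrite -(adjoints_sym hSS); apply: hx; exact: map_f.
by move=> /le_trans; apply; rewrite -mulrA ler_wpM2l.
Qed.

Lemma gelfand_leD S T k l c d : gelfand_le S k c -> gelfand_le T l d ->
  gelfand_le (fun x => S x + T x) (k + l) (c + d).
Proof.
move=> [b bk hb] [b' bl hb']; exists (b ++ b'); first by rewrite size_cat leq_add.
move=> x hx; rewrite (le_trans (ler_snD _ _ _))// mulrDl lerD//.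
  by apply: hb => y yb; apply: hx; rewrite mem_cat yb.
by apply: hb' => y yb; apply: hx; rewrite mem_cat yb orbT.
Qed.

Lemma gelfand_leZ T k a c : gelfand_le T k c ->
  gelfand_le (fun x => a *: T x) k (nr a * c).
Proof. by move=> [b bk h]; exists b => // x /h hx; rewrite snZ -mulrA ler_wpM2l. Qed.

Lemma gelfand_ge0 T k : 0 <= gelfand T k.
Proof.
rewrite /gelfand; set A := [set _ | _]; have [->|/set0P A0] := eqVneq A set0; last by apply: lb_le_inf => // c [].
by rewrite inf0.
Qed.

Lemma gelfand_lb T k : has_lbound [set c | 0 <= c /\ gelfand_le T k c].
Proof. by exists 0 => c []. Qed.

Lemma gelfand_min T k c : 0 <= c -> gelfand_le T k c -> gelfand T k <= c.
Proof. by move=> c0 h; apply: ge_inf => //; exact: gelfand_lb. Qed.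

Lemma gelfand_lt T M k c : 0 <= M -> bounded_by T M -> gelfand T k < c -> gelfand_le T k c.
Proof.
move=> M0 hM; rewrite /gelfand => /inf_lt[].
  by exists M; split => //; exact: gelfand_le_bounded.
by move=> d [d0 hd] /ltW dc; exact: gelfand_le_ge0 hd.
Qed.

Lemma gelfand_ge T k c :
  (exists d, 0 <= d /\ gelfand_le T k d) ->
  (forall d, 0 <= d -> gelfand_le T k d -> c <= d) -> c <= gelfand T k.
Proof.
by move=> [d hd] h; apply: lb_le_inf; [exists d|move=> e [e0]; exact: h].
Qed.

Lemma gelfand_anti T M k l : 0 <= M -> bounded_by T M -> (k <= l)%N ->
  gelfand T l <= gelfand T k.
Proof.
move=> M0 hM kl; apply/ler_addgt0Pr => e e0; apply: gelfand_min.
  by rewrite addr_ge0 ?gelfand_ge0// ltW.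
by apply: gelfand_le_leq kl _; apply: gelfand_lt hM _ => //; rewrite ltrDl.
Qed.

(** There are k + 1 unknown coefficients against at most k linear conditions. The coefficients are
    normalised rather than the combination, because f may be linearly dependent. This dimension
    count is behind all lower bounds for Gelfand numbers. *)
Lemma kernel_comb (f : nat -> V) b k : (size b <= k)%N ->
  exists c : nat -> R[i], \sum_(i < k.+1) nr (c i) ^+ 2 = 1 /\
    orthogonal_to b (\sum_(i < k.+1) c i *: f i).
Proof.
move=> bk; pose Mx := \matrix_(i < k.+1, j < size b) s (nth 0 b j) (f i).
have kM : kermx Mx != 0.
  rewrite -mxrank_eq0 mxrank_ker -lt0n subn_gt0.
  by rewrite (leq_ltn_trans (rank_leq_col _)).
have [v /sub_kermxP vM v0] := rowV0Pn kM.
have [i0 vi0] : exists i, v ord0 i != 0.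
  apply/existsP; apply: contraNT v0; rewrite negb_exists => /forallP h.
  by apply/eqP/rowP => i; rewrite mxE; apply/eqP; move: (h i); rewrite negbK.
pose N := \sum_(i < k.+1) nr (v ord0 i) ^+ 2.
have N0 : 0 < N.
  rewrite /N (bigD1 i0)//=; apply: ltr_wpDr.
    by apply: sumr_ge0 => i _; rewrite exprn_ge0.
  by rewrite exprn_gt0// lt0r nr_eq0 vi0 nr_ge0.
pose r := (Num.sqrt N)^-1.
have r0 : 0 <= r by rewrite invr_ge0 sqrtr_ge0.
exists (fun i => r%:C * v ord0 (inord i)); split.
  under eq_bigr => i _.
    rewrite inord_val nrM exprMn nr_real real_normK ?num_real//.
    over.
  rewrite -mulr_sumr -/N /r exprVn sqr_sqrtr ?ltW// mulVf//.
  by rewrite gt_eqF.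
move=> y /(nthP 0)[j jb <-]; rewrite sip_sumr.
under eq_bigr => i _ do rewrite sipZr inord_val -mulrA.
rewrite -mulr_sumr; have := congr1 (fun z : 'rV[R[i]]_(size b) => z ord0 (Ordinal jb)) vM.
rewrite !mxE => h; rewrite [X in _ * X](_ : _ = 0) ?mulr0// -[RHS]h.
by apply: eq_bigr => i _; rewrite mxE.
Qed.

(** Every entry of b keeps its index: an entry that depends on its predecessors leaves a zero there,
    which [onf] permits. *)
Lemma Gram_Schmidt b : definite -> exists f, [/\ onf s f,
  forall i, (size b <= i)%N -> f i = 0 & forall y, y \in b -> y = proj s f (size b) y].
Proof.
move=> sd; elim/last_ind: b => [|b y [f [fo f0 fb]]].
  exists (fun=> 0); split => //; split => [i j _|i]; last by left.
  exact: sip0l.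
set n := size b in f0 fb *; pose r := y - proj s f n y; rewrite size_rcons -/n.
have rE : y = proj s f n y + r by rewrite /r addrC subrK.
have pS g z : proj s g n.+1 z = proj s g n z + s (g n) z *: g n.
  by rewrite /proj big_ord_recr.
have [r0|r0] := eqVneq (sn s r) 0.
  have r00 := sd _ r0; exists f; split => // [i ni|z]; first by rewrite f0// ltnW.
  rewrite mem_rcons inE pS f0// scaler0 addr0 => /predU1P[->|/fb//].
  by rewrite {1}rE r00 addr0.
pose g i := if i == n then ((sn s r)^-1)%:C *: r else f i.
have gf i : (i < n)%N -> g i = f i by rewrite /g; case: eqP => // ->; rewrite ltnn.
have gn : g n = ((sn s r)^-1)%:C *: r by rewrite /g eqxx.
have pg z : proj s g n z = proj s f n z.
  by apply: eq_bigr => i _; rewrite gf.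
have fr i : s (f i) r = 0.
  have [ni|ni] := ltnP i n; first exact: dot_sub_proj.
  by rewrite f0// sip0l.
have rf i : s r (f i) = 0 by exact/sip_eq0_sym.
exists g; split.
- split => [i j ij|i]; rewrite /g.
    case: eqP => [ei|_]; case: eqP => [ej|_].
    + by rewrite ei ej eqxx in ij.
    + by rewrite sipZl rf mulr0.
    + by rewrite sipZr fr mulr0.
    + exact: fo.1.
  case: eqP => _; last exact: fo.2.
  by right; rewrite snZ nr_real ger0_norm ?invr_ge0// mulVf.
- move=> i ni; rewrite /g; case: eqP => [ei|_]; first by rewrite ei ltnn in ni.
  by rewrite f0// ltnW.
- move=> z; rewrite mem_rcons inE pS pg gn => /predU1P[->|zb].
    have ry : s r y = (sn s r ^+ 2)%:C.
      rewrite {1}rE sipDr sip_sqr sip_sumr big1 ?add0r// => i _.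
      by rewrite sipZr rf mulr0.
    rewrite sipZl ry scalerA conj_real -!rmorphM/= expr2.
    rewrite {1}rE; congr (_ + _).
    by rewrite mulKf// mulfV// scale1r.
  have zE := fb _ zb; rewrite sipZl [s r z](_ : _ = 0) ?mulr0 ?scale0r ?addr0//.
  by rewrite zE sip_sumr big1// => i _; rewrite sipZr rf mulr0.
Qed.

End operators.

(** * Continuous functional calculus *)

Section polynomial_calculus.
Variables (R : realType) (V : lmodType R[i]) (s : semiInner V) (P : V -> V).
Implicit Types (x y z : V) (a : R[i]) (p q : {poly R[i]}).
Hypothesis Pl : linear P.

(** Complex coefficients, although the functional calculus uses real polynomials, because
    [rpoly_bounded] factors a polynomial over its complex roots. *)
Definition polyop p x : V := \sum_(i < size p) p`_i *: iter i P x.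

Lemma polyop_widen p n x : (size p <= n)%N ->
  polyop p x = \sum_(i < n) p`_i *: iter i P x.
Proof.
move=> pn; rewrite /polyop (big_ord_widen n (fun i => p`_i *: iter i P x))//.
rewrite [RHS](bigID (fun i : 'I_n => (i < size p)%N))/= [X in _ + X]big1 ?addr0//.
by move=> i; rewrite -leqNgt => h; rewrite nth_default// scale0r.
Qed.

Lemma polyop_lin a p q x : polyop (a *: p + q) x = a *: polyop p x + polyop q x.
Proof.
pose n := maxn (size p) (size q).
rewrite (@polyop_widen _ n); last first.
  rewrite (leq_trans (size_polyD _ _))// geq_max leq_maxr andbT.
  by rewrite (leq_trans (size_scale_leq _ _)) ?leq_maxl.
rewrite (@polyop_widen p n) ?leq_maxl// (@polyop_widen q n) ?leq_maxr//.
rewrite scaler_sumr -big_split/=; apply: eq_bigr => i _.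
by rewrite coefD coefZ scalerDl scalerA.
Qed.

Lemma polyop0 x : polyop 0 x = 0.
Proof. by rewrite /polyop size_poly0 big_ord0. Qed.

Lemma polyopD p q x : polyop (p + q) x = polyop p x + polyop q x.
Proof. by rewrite -[p]scale1r polyop_lin !scale1r. Qed.

Lemma polyopZ a p x : polyop (a *: p) x = a *: polyop p x.
Proof. by rewrite -[_ *: p]addr0 polyop_lin polyop0 addr0. Qed.

Lemma polyopB p q x : polyop (p - q) x = polyop p x - polyop q x.
Proof. by have := polyop_lin (-1) q p x; rewrite !scaleN1r addrC => ->; rewrite addrC. Qed.

Lemma iter_linear n : linear (iter n P).
Proof.
elim: n => [//|n IH] a x y; rewrite !iterS.
by rewrite IH Pl.
Qed.

Lemma polyop_linear p : linear (polyop p).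
Proof.
move=> a x y; rewrite /polyop scaler_sumr -big_split; apply: eq_bigr => i _.
by rewrite iter_linear scalerDr !scalerA mulrC.
Qed.

Lemma polyopC a x : polyop a%:P x = a *: x.
Proof.
rewrite (@polyop_widen _ 1) ?size_polyC; last by case: (a != 0).
by rewrite big_ord1 coefC.
Qed.

Lemma polyop_mulX p x : polyop (p * 'X) x = P (polyop p x).
Proof.
rewrite (@polyop_widen _ (size p).+1); last first.
  by rewrite (leq_trans (size_polyMleq _ _))// size_polyX addn2.
rewrite big_ord_recl coefMX /= scale0r add0r /polyop.
rewrite linear_comb//.
by apply: eq_bigr => i _; rewrite coefMX.
Qed.

Lemma polyopX x : polyop 'X x = P x.
Proof. by have := polyop_mulX 1%:P x; rewrite mul1r polyopC scale1r. Qed.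

Lemma polyopM p q x : polyop (p * q) x = polyop p (polyop q x).
Proof.
elim/poly_ind: p x => [|p c IH] x; first by rewrite mul0r !polyop0.
rewrite mulrDl !polyopD mul_polyC polyopZ polyopC; congr (_ + _).
by rewrite mulrAC !polyop_mulX IH.
Qed.

Lemma polyop_bounded (M : R) p : bounded_by s P M -> 0 <= M ->
  exists2 K, 0 <= K & bounded_by s (polyop p) K.
Proof.
move=> hP M0; exists (\sum_(i < size p) nr p`_i * M ^+ i).
  by apply: sumr_ge0 => i _; rewrite mulr_ge0// exprn_ge0.
move=> x; rewrite (le_trans (sn_sum _ _ _ _))// mulr_suml ler_sum// => i _.
rewrite snZ -mulrA ler_wpM2l//; move: (i : nat) => n; elim: n => [|n IH] /=.
  by rewrite expr0 mul1r.
by rewrite (le_trans (hP _))// exprS -mulrA ler_wpM2l.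
Qed.

End polynomial_calculus.

Section selfadjoint_calculus.
Variables (R : realType) (V : lmodType R[i]) (s : semiInner V) (P : V -> V) (M : R).
Implicit Types (x y z : V) (a : R[i]) (p q : {poly R}).
Hypothesis Pl : linear P.
Hypothesis Psa : adjoints s P P.
Hypothesis P0 : forall x, 0 <= complex.Re (s x (P x)).
Hypothesis PM : bounded_by s P M.
Hypothesis M0 : 0 <= M.

Local Notation toC p := (map_poly (real_complex R) p).
Local Notation rpoly p := (polyop P (toC p)).

Lemma iter_adjoints n : adjoints s (iter n P) (iter n P).
Proof. by elim: n => [|n IH] x y //=; rewrite Psa IH -iterS iterSr. Qed.

Lemma rpoly_adjoints p : adjoints s (rpoly p) (rpoly p).
Proof.
move=> x y; rewrite /polyop sip_suml sip_sumr; apply: eq_bigr => i _.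
by rewrite sipZl sipZr coef_map/= conj_real iter_adjoints.
Qed.

Lemma selfadjoint_real x : s x (P x) = (complex.Re (s x (P x)))%:C.
Proof.
rewrite RRe_real//; apply/CrealP.
by rewrite sip_conj Psa.
Qed.

Lemma resolvent_bound (z : R[i]) : (forall t, 0 <= t <= M -> z != t%:C) ->
  exists2 d, 0 < d & forall x, d * sn s x <= sn s (P x - z *: x).
Proof.
move=> zM; suff [d d0 h] : exists2 d, 0 < d & forall x,
    d * sn s x ^+ 2 <= nr (s x (P x - z *: x)).
  exists d => // x; have [->|x0] := eqVneq (sn s x) 0; first by rewrite mulr0.
  have := le_trans (h x) (CauchySchwarz s _ _).
  by rewrite expr2 mulrA mulrC ler_pM2l// lt0r x0 sn_ge0.
have E x : s x (P x - z *: x) =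
    (complex.Re (s x (P x)) - complex.Re z * sn s x ^+ 2) -i*
      (complex.Im z * sn s x ^+ 2).
  rewrite sipBr sipZr {1}selfadjoint_real sip_sqr.
  by case: z {zM} => a b; simpc.
have [b0|b0] := eqVneq (complex.Im z) 0; last first.
  exists `|complex.Im z|; first by rewrite normr_gt0.
  move=> x; apply: (le_trans _ (norm_Im_le_nr _)); rewrite E /=.
  by rewrite normrN normrM [X in _ <= _ * X]ger0_norm ?exprn_ge0.
have zE : z = (complex.Re z)%:C by case: z b0 {zM E} => a b /= ->.
have tM x : complex.Re (s x (P x)) <= M * sn s x ^+ 2.
  rewrite (le_trans (Re_le_nr _))// (le_trans (CauchySchwarz _ _ _))//.
  by rewrite mulrC expr2 mulrA ler_wpM2r.
have [a0|a0] := ltP (complex.Re z) 0.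
  exists (- complex.Re z); first by rewrite oppr_gt0.
  move=> x; apply: (le_trans _ (Re_le_nr _)); rewrite E /=.
  by have := P0 x; lra.
have aM : M < complex.Re z.
  by rewrite ltNge; apply/negP => aM; have := zM _ (introT andP (conj a0 aM)); rewrite -zE eqxx.
exists (complex.Re z - M); first by rewrite subr_gt0.
move=> x; rewrite -nrN; apply: (le_trans _ (Re_le_nr _)); rewrite E /=.
by have := tM x; lra.
Qed.

Lemma prod_bound (zs : seq R[i]) :
  (forall z : R[i], z \in zs -> forall t, 0 <= t <= M -> z != t%:C) ->
  exists2 d, 0 < d & forall x,
    d * sn s x <= sn s (polyop P (\prod_(z <- zs) ('X - z%:P)) x).
Proof.
elim: zs => [|z zs IH] h.
  by exists 1 => // x; rewrite big_nil polyopC scale1r mul1r.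
have [|d d0 hd] := IH; first by move=> w wz; apply: h; rewrite inE wz orbT.
have [|e e0 he] := @resolvent_bound z; first by apply: h; rewrite inE eqxx.
exists (e * d) => [|x]; first by rewrite mulr_gt0.
rewrite big_cons polyopM// polyopB polyopC polyopX//.
apply: (le_trans _ (he _)); rewrite -mulrA ler_wpM2l ?hd//; exact: ltW.
Qed.

Lemma bounded_sup (S : V -> V) K : 0 <= K -> linear S -> bounded_by s S K ->
  exists L, [/\ 0 <= L, bounded_by s S L &
    forall e, 0 < e -> exists2 x, sn s x <= 1 & L - e < sn s (S x)].
Proof.
move=> K0 Sl hS; pose A := [set r | exists2 x, sn s x <= 1 & r = sn s (S x)].
have S0 := lin0 Sl.
have A0 : A 0 by exists 0; rewrite ?S0 sn0.
have supA : has_sup A.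
  split; first by exists 0.
  exists K => _ [x x1 ->]; apply: le_trans (hS x) _; rewrite -[leRHS]mulr1.
  exact: ler_wpM2l.
exists (sup A); split => [|x|e e0].
- by apply: ub_le_sup => //; exact: supA.2.
- have [x0|x0] := eqVneq (sn s x) 0.
    by have := hS x; rewrite x0 !mulr0.
  have xp : 0 < sn s x by rewrite lt0r x0 sn_ge0.
  rewrite -ler_pdivrMr//; apply: ub_le_sup; first exact: supA.2.
  exists (((sn s x)^-1)%:C *: x).
    by rewrite snZ nr_real ger0_norm ?invr_ge0// mulVf.
  have -> : S (((sn s x)^-1)%:C *: x) = ((sn s x)^-1)%:C *: S x.
    by have := Sl ((sn s x)^-1)%:C x 0; rewrite S0 !addr0.
  by rewrite snZ nr_real ger0_norm ?invr_ge0// mulrC.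
- have [_ [x x1 ->] h] := sup_adherent e0 supA; by exists x.
Qed.

(* If |q(P)| > c, then L = |q(P)| makes L^2 - q^2 free of zeros on [0, M], so
   that the product L^2 - q(P)^2 of shifts of P is bounded below; but unit
   vectors nearly maximising |q(P)x| are nearly annihilated by it. *)
Lemma rpoly_bounded q c : (forall t, 0 <= t <= M -> `|q.[t]| <= c) ->
  bounded_by s (rpoly q) c.
Proof.
move=> qc; have c0 : 0 <= c.
  by apply: le_trans (qc 0 _); rewrite ?normr_ge0 ?lexx.
have [K K0 hK] := @polyop_bounded _ _ s P M (toC q) PM M0.
have [L [L0 hL Lsup]] := bounded_sup K0 (polyop_linear Pl (toC q)) hK.
suff Lc : L <= c by move=> x; rewrite (le_trans (hL x))// ler_wpM2r.
rewrite leNgt; apply/negP => cL.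
have Lp : 0 < L by exact: le_lt_trans cL.
pose r : {poly R} := (L ^+ 2)%:P - q ^+ 2.
have r_pos t : 0 <= t <= M -> 0 < r.[t].
  move=> tM; rewrite /r hornerD hornerN hornerC horner_exp subr_gt0.
  rewrite -real_normK ?num_real// ltr_pXn2r ?nnegrE//.
  exact: le_lt_trans (qc _ tM) cL.
have r0 : r != 0.
  by apply/eqP => rE; have := r_pos 0; rewrite rE horner0 ltxx lexx M0 => /(_ isT).
have rC0 : toC r != 0 by rewrite map_poly_eq0.
have [zs zsE] := closed_field_poly_normal (toC r).
have [|d d0 hd] := @prod_bound zs.
  move=> z zzs t tM; apply: contraTneq (r_pos _ tM) => zt.
  have : root (toC r) z.
    by rewrite zsE rootZ ?lead_coef_eq0// root_prod_XsubC.
  rewrite zt /root horner_map/= fmorph_eq0 => /eqP ->; by rewrite ltxx.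
pose l := nr (lead_coef (toC r)).
have l0 : 0 < l by rewrite lt0r nr_eq0 lead_coef_eq0 rC0 nr_ge0.
pose D := l * d; have D0 : 0 < D by rewrite mulr_gt0.
have hD x : D * sn s x <= sn s ((L ^+ 2)%:C *: x - rpoly q (rpoly q x)).
  have -> : (L ^+ 2)%:C *: x - rpoly q (rpoly q x) = rpoly r x.
    by rewrite /r rmorphB/= polyopB map_polyC/= polyopC [toC (q ^+ 2)]rmorphXn/= [toC q ^+ 2]expr2 polyopM.
  by rewrite zsE polyopZ snZ -/l /D -mulrA ler_pM2l.
(* Near-maximality up to e will give D^2 (L^2 - e) <= L^4 e; this e is half of the least value for
   which that inequality can hold. *)
pose e := D ^+ 2 * L ^+ 2 / (2 * (D ^+ 2 + L ^+ 4)).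
have DL : 0 < D ^+ 2 + L ^+ 4 by apply: addr_gt0; exact: exprn_gt0.
have e0 : 0 < e by apply: divr_gt0; apply: mulr_gt0 => //; exact: exprn_gt0.
have eE : e * (D ^+ 2 + L ^+ 4) = D ^+ 2 * L ^+ 2 / 2.
  by rewrite /e; field; rewrite lt0r_neq0.
have eL : 0 < e / (2 * L) by apply: divr_gt0 => //; apply: mulr_gt0.
have [x x1 hx] := Lsup (e / (2 * L)) eL.
have hx2 : L ^+ 2 - e <= sn s (rpoly q x) ^+ 2.
  have h1 : L - e / (2 * L) <= sn s (rpoly q x) by exact: ltW.
  have [h2|h2] := leP 0 (L - e / (2 * L)); last first.
    have : L ^+ 2 - e <= 0; last by move=> /le_trans; apply; rewrite exprn_ge0.
    move: h2; rewrite subr_lt0 ltr_pdivlMr ?mulr_gt0// => h2.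
    have : L * (2 * L) = L ^+ 2 + L ^+ 2 by ring.
    have := exprn_gt0 2 Lp; lra.
  have := h1; rewrite -(@ler_pXn2r _ 2) ?nnegrE// => /(le_trans _); apply.
  rewrite sqrrB; have : L * (e / (2 * L)) *+ 2 = e.
    by rewrite mulr2n; field; rewrite lt0r_neq0.
  by have := sqr_ge0 (e / (2 * L)); move=> ? ->; lra.
set a := sn s (rpoly q x) in hx2.
have a0 : 0 <= a by exact: sn_ge0.
have hSS : sn s (rpoly q (rpoly q x)) <= L * a := hL _.
have aL : a <= L * sn s x := hL _.
have key : sn s ((L ^+ 2)%:C *: x - rpoly q (rpoly q x)) ^+ 2 <= L ^+ 2 * e.
  rewrite sn_sqrB snZ nr_real ger0_norm ?exprn_ge0// sipZl conj_real Re_realM.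
  rewrite -rpoly_adjoints -sn_sqr -/a.
  have : sn s (rpoly q (rpoly q x)) ^+ 2 <= L ^+ 2 * a ^+ 2.
    by rewrite -exprMn ler_pXn2r ?nnegrE ?mulr_ge0.
  have : (L ^+ 2 * sn s x) ^+ 2 <= L ^+ 2 * L ^+ 2.
    rewrite exprMn -expr2 -[leRHS]mulr1 ler_wpM2l ?exprn_ge0//.
    by rewrite expr_le1.
  have : L ^+ 2 * (L ^+ 2 - e) <= L ^+ 2 * a ^+ 2.
    by rewrite ler_wpM2l ?exprn_ge0.
  rewrite mulrBr; lra.
have k2 : D ^+ 2 * sn s x ^+ 2 <= L ^+ 2 * e.
  apply: le_trans key; rewrite -exprMn ler_pXn2r ?nnegrE ?mulr_ge0// ltW//.
have k3 : a ^+ 2 <= L ^+ 2 * sn s x ^+ 2.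
  by rewrite -exprMn ler_pXn2r ?nnegrE ?mulr_ge0.
have k4 : D ^+ 2 * a ^+ 2 <= L ^+ 2 * (L ^+ 2 * e).
  apply: le_trans (_ : D ^+ 2 * (L ^+ 2 * sn s x ^+ 2) <= _).
    by rewrite ler_wpM2l ?exprn_ge0// ltW.
  by rewrite mulrCA ler_wpM2l ?exprn_ge0.
have k5 : D ^+ 2 * (L ^+ 2 - e) <= D ^+ 2 * a ^+ 2.
  by rewrite ler_wpM2l ?exprn_ge0// ltW.
have := le_trans k5 k4; rewrite mulrBr.
have -> : L ^+ 2 * (L ^+ 2 * e) = e * L ^+ 4 by ring.
have : 0 < D ^+ 2 * L ^+ 2 by rewrite mulr_gt0 ?exprn_gt0.
move: eE; rewrite mulrDr (mulrC e (D ^+ 2)); lra.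
Qed.

(** The norm bound yields the order bound by recentring: if q - c takes values in [0, B], then B / 2
    + c - q is at most B / 2 in modulus. *)
Lemma rpoly_ge q c : (forall t, 0 <= t <= M -> c <= q.[t]) ->
  forall x, c * sn s x ^+ 2 <= complex.Re (s x (rpoly q x)).
Proof.
move=> qc x.
have [B B0 hB] : exists2 B, 0 <= B & forall t, 0 <= t <= M -> q.[t] - c <= B.
  exists (\sum_(i < size q) `|q`_i| * M ^+ i + `|c|) => [|t /andP[t0 tM]].
    rewrite addr_ge0// sumr_ge0// => i _; rewrite mulr_ge0// exprn_ge0//.
  apply: lerD; last by rewrite -normrN ler_norm.
  rewrite horner_coef ler_sum// => i _; apply: le_trans (ler_norm _) _.
  rewrite normrM ler_wpM2l// normrX lerXn2r ?nnegrE ?normr_ge0//.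
  by rewrite ger0_norm.
pose r : {poly R} := (B / 2 + c)%:P - q.
have : bounded_by s (rpoly r) (B / 2).
  apply: rpoly_bounded => t tM; rewrite /r hornerD hornerN hornerC.
  by have := qc _ tM; have := hB _ tM; rewrite ler_norml; lra.
move=> /(_ x) h; have := CauchySchwarz s x (rpoly r x).
move=> /(le_trans (Re_le_nr _)) h2.
have := le_trans h2 (ler_wpM2l (sn_ge0 _ _) h).
rewrite /r rmorphB/= polyopB map_polyC/= polyopC sipBr sipZr raddfB/= sip_sqr -rmorphM /=.
rewrite mulrDl; have -> : sn s x * (B / 2 * sn s x) = B / 2 * sn s x ^+ 2 by ring.
lra.
Qed.

Lemma rpoly_eigen q x (l : R) : P x = l%:C *: x -> rpoly q x = (q.[l])%:C *: x.
Proof.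
move=> h; have hi n : iter n P x = (l ^+ n)%:C *: x.
  elim: n => [|n IH] /=; first by rewrite expr0 scale1r.
  by rewrite IH (linZ _ _ Pl) h scalerA -rmorphM/= exprSr.
rewrite /polyop size_map_poly horner_coef rmorph_sum scaler_suml.
by apply: eq_bigr => i _; rewrite coef_map hi scalerA -rmorphM.
Qed.

End selfadjoint_calculus.

(** * Bernstein polynomials and Weierstrass approximation *)

Section Bernstein.
Variable R : realType.
Implicit Types (f g : nat -> R) (t a : R) (n : nat).

(* The value at t is the expectation of f under the binomial law (n, t). *)
Fixpoint bernstein n f : {poly R} :=
  if n is m.+1 then (1 - 'X) * bernstein m f + 'X * bernstein m (f \o S)
  else (f 0%N)%:P.

Lemma bernsteinS n f t : (bernstein n.+1 f).[t] =
  (1 - t) * (bernstein n f).[t] + t * (bernstein n (f \o S)).[t].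
Proof. by rewrite /= hornerD !hornerM hornerD hornerN hornerX hornerC. Qed.

Lemma bernstein_le n f g t : 0 <= t <= 1 -> (forall k, (k <= n)%N -> f k <= g k) ->
  (bernstein n f).[t] <= (bernstein n g).[t].
Proof.
move=> /andP[t0 t1]; elim: n f g => [|n IH] f g fg; first by rewrite /= !hornerC fg.
rewrite !bernsteinS lerD// ler_wpM2l ?subr_ge0// IH// => k kn /=; rewrite fg//.
exact: leqW.
Qed.

(** The second moment of the binomial law. The centre a stays free because the shift of k in the
    recursion moves it to a - 1. *)
Lemma bernstein_variance n a b c t : (bernstein n (fun k => b + c * (k%:R - a) ^+ 2)).[t] =
  b + c * ((n%:R * t - a) ^+ 2 + n%:R * t * (1 - t)).
Proof.
elim: n a => [|n IH] a; first by rewrite /= hornerC; ring.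
have h : (fun k => b + c * (k%:R - a) ^+ 2) \o S = fun k => b + c * (k%:R - (a - 1)) ^+ 2.
  by apply/funext => k /=; rewrite -natr1; ring.
rewrite bernsteinS h !IH -natr1; ring.
Qed.

Lemma bernsteinB n f b t : (bernstein n f).[t] - b = (bernstein n (fun k => f k - b)).[t].
Proof.
elim: n f => [|n IH] f; first by rewrite /= !hornerC.
rewrite !bernsteinS -[X in _ = _ + _ * X]IH -[X in _ = _ * X + _]IH; ring.
Qed.

(** The deviation is dominated by a quadratic, whose expectation is explicit; the variance t (1 - t)
    / n of k / n is at most 1 / n. *)
Lemma bernstein_approx n f b c d t : 0 <= t <= 1 -> 0 <= c ->
  (forall k, (k <= n.+1)%N -> `|f k - d| <= b + c * (k%:R / n.+1%:R - t) ^+ 2) ->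
  `|(bernstein n.+1 f).[t] - d| <= b + c / n.+1%:R.
Proof.
have n0 : n.+1%:R != 0 :> R by rewrite pnatr_eq0.
move=> t01 c0 h; pose g k := b + c / n.+1%:R ^+ 2 * (k%:R - n.+1%:R * t) ^+ 2.
have gE k : g k = b + c * (k%:R / n.+1%:R - t) ^+ 2.
  by rewrite /g; congr (_ + _); move: (n.+1%:R) n0 => N n0; field.
have gb : (bernstein n.+1 g).[t] <= b + c / n.+1%:R.
  rewrite bernstein_variance subrr expr0n /= add0r lerD2l.
  have -> : c / n.+1%:R ^+ 2 * (n.+1%:R * t * (1 - t)) = c / n.+1%:R * (t * (1 - t)).
    by move: (n.+1%:R) n0 => N n0; field.
  by rewrite ler_piMr ?divr_ge0//; nra.
have gN : (bernstein n.+1 (fun k => - g k)).[t] = - (bernstein n.+1 g).[t].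
  have -> : (fun k => - g k) = fun k => - b + (- (c / n.+1%:R ^+ 2)) * (k%:R - n.+1%:R * t) ^+ 2.
    by apply/funext => k; rewrite /g; ring.
  by rewrite !bernstein_variance; ring.
rewrite bernsteinB ler_norml; apply/andP; split.
  apply: (@le_trans _ _ (- (bernstein n.+1 g).[t])); first by rewrite lerN2.
  by rewrite -gN; apply: bernstein_le => // k /h; rewrite -gE ler_norml => /andP[].
apply: le_trans gb.
by apply: bernstein_le => // k /h; rewrite -gE ler_norml => /andP[].
Qed.

(** Uniform continuity in a form that can be averaged directly against the binomial law, without
    separating near from far values of k. *)
Definition quadratic_modulus (f : R -> R) (M : R) := forall e : R, 0 < e ->
  exists2 C, 0 <= C & forall t u, 0 <= t <= M -> 0 <= u <= M ->
    `|f t - f u| <= e + C * (t - u) ^+ 2.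

Lemma Weierstrass (f : R -> R) M : 0 < M -> quadratic_modulus f M ->
  exists q : nat -> {poly R}, forall e, 0 < e -> \forall n \near \oo,
    forall t, 0 <= t <= M -> `|(q n).[t] - f t| <= e.
Proof.
move=> M0 fM.
exists (fun n => bernstein n (fun k => f (M * (k%:R / n%:R))) \Po (M^-1 *: 'X)).
move=> e e0; have [|C C0 hC] := fM (e / 2); first by rewrite divr_gt0.
near=> n; have n0 : (0 < n)%N by near: n; exact: nbhs_infty_gt.
have nC : C * M ^+ 2 / n%:R <= e / 2.
  rewrite ler_pdivrMr ?ltr0n// -ler_pdivrMl ?divr_gt0//.
  by near: n; exact: nbhs_infty_ger.
move: (n) n0 nC => [//|m] _ nC t /andP[t0 tM]; rewrite horner_comp hornerZ hornerX.
apply: (@le_trans _ _ (e / 2 + C * M ^+ 2 / m.+1%:R)); last by rewrite [leRHS]splitr lerD2l.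
apply: bernstein_approx; first by rewrite mulrC divr_ge0 ?(ltW M0)//= ler_pdivrMr ?mul1r.
  by rewrite mulr_ge0 ?exprn_ge0// ltW.
move=> k kn; apply: le_trans (hC _ _ _ _) _; last 2 first.
- by rewrite t0 tM.
- rewrite -[C * M ^+ 2 * _]mulrA -exprMn [M * (_ - _)]mulrBr mulVKf ?gt_eqF//.
rewrite mulr_ge0 ?divr_ge0 ?(ltW M0)//= ler_piMr ?(ltW M0)//.
by rewrite ler_pdivrMr ?ltr0n// mul1r ler_nat.
Unshelve. all: by end_near. Qed.

(** The difference of the roots is at most r = sqrt |t - u|, and either r <= e or r <= r^4 / e^3. *)
Lemma sqrt_modulus M : quadratic_modulus (@Num.sqrt R) M.
Proof.
move=> e e0; exists (e ^+ 3)^-1; first by rewrite invr_ge0 exprn_ge0 ?ltW.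
suff h t u : 0 <= t <= u -> Num.sqrt u - Num.sqrt t <= e + (e ^+ 3)^-1 * (t - u) ^+ 2.
  move=> t u /andP[t0 _] /andP[u0 _]; have [tu|ut] := leP t u.
    by rewrite distrC ger0_norm ?subr_ge0 ?ler_wsqrtr// h// t0.
  by rewrite ger0_norm ?subr_ge0 ?ler_wsqrtr ?(ltW ut)// -[t - u]opprB sqrrN h// u0 ltW.
move=> /andP[t0 tu]; pose d := u - t; have d0 : 0 <= d by rewrite subr_ge0.
have h1 : Num.sqrt u - Num.sqrt t <= Num.sqrt d.
  rewrite lerBlDr -(@ler_pXn2r _ 2) ?nnegrE ?addr_ge0 ?sqrtr_ge0//.
  have u0 : 0 <= u by exact: le_trans tu.
  rewrite sqrrD !sqr_sqrtr// /d.
  have := mulr_ge0 (sqrtr_ge0 (u - t)) (sqrtr_ge0 t); rewrite mulr2n; lra.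
apply: le_trans h1 _; rewrite -sqrrN opprB -/d.
set r := Num.sqrt d; have r0 : 0 <= r by exact: sqrtr_ge0.
have -> : d = r ^+ 2 by rewrite sqr_sqrtr.
have [re|er] := leP r e.
  by rewrite (le_trans re)// lerDl mulr_ge0 ?exprn_ge0// invr_ge0 exprn_ge0 ?ltW.
apply: (@le_trans _ _ ((e ^+ 3)^-1 * (r ^+ 2) ^+ 2)); last by rewrite lerDr ltW.
rewrite mulrC ler_pdivlMr ?exprn_gt0// -exprM.
have -> : r ^+ (2 * 2) = r * r ^+ 3 by rewrite -exprS.
by apply: ler_wpM2l => //; rewrite lerXn2r ?nnegrE ?(ltW er) ?(ltW e0).
Qed.

Lemma lipschitz_modulus (f : R -> R) M L : 0 <= L ->
  (forall t u, 0 <= t <= M -> 0 <= u <= M -> t <= u -> `|f t - f u| <= L * (u - t)) ->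
  quadratic_modulus f M.
Proof.
move=> L0 h e e0; exists (L ^+ 2 / e); first by rewrite divr_ge0 ?exprn_ge0// ltW.
have {}h t u : 0 <= t <= M -> 0 <= u <= M -> `|f t - f u| <= L * `|t - u|.
  move=> tM uM; have [tu|ut] := leP t u.
    have -> : `|t - u| = u - t by rewrite distrC ger0_norm ?subr_ge0.
    exact: h.
  have -> : `|t - u| = t - u by rewrite ger0_norm ?subr_ge0 ?(ltW ut).
  by rewrite distrC; apply: h => //; exact: ltW.
move=> t u tM uM; apply: le_trans (h _ _ tM uM) _.
rewrite -[(t - u) ^+ 2]real_normK ?num_real//; set d := `|t - u|.
rewrite -subr_ge0; have -> : e + L ^+ 2 / e * d ^+ 2 - L * d =
  ((e - L * d / 2) ^+ 2 + 3 / 4 * (L * d) ^+ 2) / e by field; rewrite gt_eqF.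
by rewrite divr_ge0 ?(ltW e0)// addr_ge0 ?sqr_ge0// mulr_ge0 ?sqr_ge0// divr_ge0.
Qed.

(** Convexity replaces the derivative: u lies between t and [M + 1], and the chord from t to
    [M + 1], a point at distance at least 1 from t, has slope at most (M + 1)^p. *)
Lemma powR_modulus (p M : R) : 1 <= p -> quadratic_modulus (fun t => t `^ p) M.
Proof.
move=> p1; have p0 : 0 <= p by exact: le_trans p1.
pose T := M + 1; apply: (@lipschitz_modulus _ _ (T `^ p)); first exact: powR_ge0.
move=> t u /andP[t0 tM] /andP[u0 uM] tu.
have tpu : t `^ p <= u `^ p by rewrite ge0_ler_powR ?nnegrE.
rewrite distrC ger0_norm ?subr_ge0//.
have [/eqP|tu'] := eqVneq t u; first by move=> /eqP ->; rewrite !subrr mulr0.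
have Tt : 0 < T - t by rewrite /T; lra.
pose l := (u - t) / (T - t).
have l01 : 0 <= l <= 1.
  apply/andP; split; first by apply: divr_ge0; [rewrite subr_ge0|exact: ltW].
  by rewrite /l ler_pdivrMr// mul1r /T; lra.
have l01' : 0 <= 1 - l <= 1 by lra.
have ul : u = (1 - l) * t + l * T by rewrite /l; field; rewrite gt_eqF.
have /andP[l0' l1'] := l01'.
have := @convex_powR R p p1 (Itv01 l0' l1') t T; rewrite !inE /= !in_itv /= !andbT.
move=> /(_ t0); rewrite [X in X `^ _ <= _]convRE convRE /= /unstable.onem (_ : 1 - (1 - l) = l) -?ul; last by ring.
have T0 : 0 <= T by rewrite /T; lra.
move=> /(_ T0) h; apply: (@le_trans _ _ (l * T `^ p)).
  have := mulr_ge0 (_ : 0 <= l) (powR_ge0 t p); move/andP: l01 => [l0 _] /(_ l0); lra.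
rewrite mulrC ler_wpM2l ?powR_ge0// /l ler_pdivrMr// ler_peMr ?subr_ge0//.
by rewrite /T; lra.
Qed.

End Bernstein.

Section continuous_calculus.
Variables (R : realType) (V : lmodType R[i]) (s : semiInner V) (P : V -> V) (M : R).
Implicit Types (x y z : V) (a : R[i]) (p q : {poly R}) (f : R -> R).
Hypothesis Pl : linear P.
Hypothesis Psa : adjoints s P P.
Hypothesis P0 : forall x, 0 <= complex.Re (s x (P x)).
Hypothesis PM : bounded_by s P M.
Hypothesis M0 : 0 <= M.

Local Notation toC p := (map_poly (real_complex R) p).
Local Notation rpoly p := (polyop P (toC p)).

Definition calculus f B := forall e : R, 0 < e -> exists q,
  (forall t, 0 <= t <= M -> `|q.[t] - f t| <= e) /\
  forall x, sn s (rpoly q x - B x) <= e * sn s x.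

Definition seq_complete := forall u : nat -> V,
  (forall e : R, 0 < e -> exists N, forall m n, (N <= m)%N -> (N <= n)%N ->
     sn s (u m - u n) <= e) ->
  exists x, forall e : R, 0 < e -> exists N, forall n, (N <= n)%N -> sn s (u n - x) <= e.

Lemma rpolyB q r x : rpoly q x - rpoly r x = rpoly (q - r) x.
Proof. by rewrite rmorphB/= polyopB. Qed.

Lemma calculus_exists f (q : nat -> {poly R}) : seq_complete ->
  (forall e, 0 < e -> \forall n \near \oo, forall t, 0 <= t <= M -> `|(q n).[t] - f t| <= e) ->
  exists B, forall e, 0 < e -> \forall n \near \oo, forall x,
    sn s (rpoly (q n) x - B x) <= e * sn s x.
Proof.
move=> sc qf.
have cau e : 0 < e -> exists N, forall m n, (N <= m)%N -> (N <= n)%N ->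
    forall x, sn s (rpoly (q m) x - rpoly (q n) x) <= e * sn s x.
  move=> e0; have [|N _ hN] := qf (e / 2); first by rewrite divr_gt0.
  exists N => m n Nm Nn x; rewrite rpolyB.
  apply: (rpoly_bounded Pl Psa P0 PM M0) => t tM.
  rewrite hornerD hornerN -[X in X - _](subrK (f t)) -addrA.
  rewrite (le_trans (ler_normD _ _))// [leRHS]splitr lerD//; first exact: hN.
  by rewrite distrC; exact: hN.
have ex x : exists y, forall e : R, 0 < e ->
    exists N, forall n, (N <= n)%N -> sn s (rpoly (q n) x - y) <= e.
  apply: sc => e e0.
  have x1 : 0 < sn s x + 1 by rewrite ltr_wpDl.
  have [|N hN] := cau (e / (sn s x + 1)); first by rewrite divr_gt0.
  exists N => m n Nm Nn; apply: le_trans (hN _ _ Nm Nn x) _.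
  rewrite mulrAC ler_pdivrMr// ler_wpM2l ?(ltW e0)//.
  by rewrite lerDl.
have [B hB] := choice ex; exists B => e e0.
have [N hN] := cau e e0; exists N => // n /= Nn x.
apply/ler_addgt0Pr => d d0; have [N' hN'] := hB x d d0.
pose k := maxn N N'.
rewrite -[rpoly (q n) x](subrK (rpoly (q k) x)) -addrA.
apply: le_trans (ler_snD _ _ _) _; rewrite lerD ?hN ?hN'//.
  exact: leq_maxl.
exact: leq_maxr.
Qed.

Variables (f : R -> R) (B : V -> V).
Hypothesis fB : calculus f B.

(** Order properties of f(P) are needed only against polynomials: for q close to f, the polynomial C
    q - r is at least -|C| e on [0, M], and [rpoly_ge] transfers this to the forms. *)
Lemma calculus_poly_le r (C : R) : (forall t, 0 <= t <= M -> r.[t] <= C * f t) ->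
  forall x, complex.Re (s x (rpoly r x)) <= C * complex.Re (s x (B x)).
Proof.
move=> rf x; apply/ler_addgt0Pr => d d0.
pose D := `|C| * 2 * sn s x ^+ 2 + 1.
have D0 : 0 < D by rewrite ltr_wpDl ?mulr_ge0 ?exprn_ge0.
pose e := d / D; have e0 : 0 < e by rewrite divr_gt0.
have [q [qf qB]] := fB e0.
have := @rpoly_ge _ _ _ _ _ Pl Psa P0 PM M0 (C *: q - r) (- (`|C| * e)).
have h0 t : 0 <= t <= M -> - (`|C| * e) <= (C *: q - r).[t].
  move=> tM; rewrite hornerD hornerN hornerZ.
  have h1 : `|C * (q.[t] - f t)| <= `|C| * e by rewrite normrM ler_wpM2l// qf.
  by move: h1 (rf t tM); rewrite ler_norml mulrBr; lra.
move=> /(_ h0 x); rewrite rmorphB/= polyopB map_polyZ polyopZ.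
rewrite sipBr sipZr raddfB/= Re_realM => h2.
have h3 : `|C| * complex.Re (s x (rpoly q x - B x)) <= `|C| * (e * sn s x ^+ 2).
  rewrite ler_wpM2l// (le_trans (Re_le_nr _))// (le_trans (CauchySchwarz _ _ _))//.
  by rewrite expr2 mulrCA ler_wpM2l.
have h3' : `|C| * complex.Re (s x (B x - rpoly q x)) <= `|C| * (e * sn s x ^+ 2).
  rewrite ler_wpM2l// (le_trans (Re_le_nr _))// (le_trans (CauchySchwarz _ _ _))//.
  by rewrite expr2 mulrCA snBC ler_wpM2l.
move: h3 h3'; rewrite !sipBr !raddfB/= => h3 h3'.
have h4 : C * (complex.Re (s x (rpoly q x)) - complex.Re (s x (B x)))
    <= `|C| * (e * sn s x ^+ 2).
  have [C0|C0] := leP 0 C; first by move: h3; rewrite (ger0_norm C0).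
  by move: h3'; rewrite (ltr0_norm C0); lra.
have h5 : `|C| * e * sn s x ^+ 2 + `|C| * (e * sn s x ^+ 2) <= d.
  have -> : d = e * D by rewrite /e divfK// gt_eqF.
  by rewrite /D; lra.
by move: h2 h4 h5; rewrite mulrBr; lra.
Qed.

Lemma calculus_adjoints : adjoints s B B.
Proof.
move=> x y; apply/eqP; rewrite -subr_eq0 -nr_eq0 eq_le nr_ge0 andbT.
apply/ler_addgt0Pr => d d0; rewrite add0r.
pose D := 2 * sn s x * sn s y + 1.
have D0 : 0 < D by rewrite ltr_wpDl ?mulr_ge0.
have e0 : 0 < d / D by rewrite divr_gt0.
have [q [_ qB]] := fB e0.
have -> : s (B x) y - s x (B y) = s x (rpoly q y - B y) - s (rpoly q x - B x) y.
  by rewrite sipBr sipBl -rpoly_adjoints//; ring.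
rewrite (le_trans (ler_nrD _ _))// nrN.
have h1 := le_trans (CauchySchwarz s x (rpoly q y - B y)) (ler_wpM2l (sn_ge0 _ _) (qB y)).
have h2 := le_trans (CauchySchwarz s (rpoly q x - B x) y) (ler_wpM2r (sn_ge0 _ _) (qB x)).
apply: le_trans (lerD h1 h2) _.
have -> : sn s x * (d / D * sn s y) + d / D * sn s x * sn s y = d / D * (D - 1).
  by rewrite /D; ring.
by rewrite mulrBr mulr1 divfK ?gt_eqF// gerBl ltW.
Qed.

Lemma calculus_bounded : exists2 K, 0 <= K & bounded_by s B K.
Proof.
have [q [_ qB]] := fB ltr01.
have [K K0 hK] := @polyop_bounded _ _ s P M (toC q) PM M0.
exists (K + 1) => [|x]; first by rewrite addr_ge0.
rewrite -[B x](subrK (rpoly q x)) (le_trans (ler_snD _ _ _))// addrC mulrDl.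
by rewrite lerD// snBC qB.
Qed.

Lemma calculus_eigen x (l : R) : 0 <= l <= M -> P x = l%:C *: x ->
  sn s (B x - (f l)%:C *: x) = 0.
Proof.
move=> lM h; apply/eqP; rewrite eq_le sn_ge0 andbT.
apply/ler_addgt0Pr => d d0; rewrite add0r.
pose D := 2 * sn s x + 1.
have D0 : 0 < D by rewrite ltr_wpDl ?mulr_ge0.
have e0 : 0 < d / D by rewrite divr_gt0.
have [q [qf qB]] := fB e0.
rewrite -[B x](subrK (rpoly q x)) -addrA (rpoly_eigen Pl _ h) -scalerBl -rmorphB.
rewrite (le_trans (ler_snD _ _ _))// snZ nr_real.
apply: (@le_trans _ _ (d / D * sn s x + d / D * sn s x)).
  by rewrite lerD// ?ler_wpM2r ?qf// snBC -(rpoly_eigen Pl _ h).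
have -> : d / D * sn s x + d / D * sn s x = d / D * (D - 1) by rewrite /D; ring.
by rewrite mulrBr mulr1 divfK ?gt_eqF// gerBl ltW.
Qed.

End continuous_calculus.

Lemma complete_seq (R : realType) (W : completeNormedModType R[i]) (u : nat -> W) :
  (forall e : R, 0 < e -> exists N, forall m n, (N <= m)%N -> (N <= n)%N ->
     nr (u m - u n) <= e) ->
  exists x, forall e : R, 0 < e -> exists N, forall n, (N <= n)%N -> nr (u n - x) <= e.
Proof.
move=> uc; have real_pos (e : R[i]) : 0 < e -> exists2 r : R, 0 < r & e = r%:C.
  by move=> e0; exists (complex.Re e); rewrite ?RRe_real ?gtr0_real// -ltcR RRe_real// gtr0_real.
have cu : cvgn u.
  apply/cauchy_cvgP/cauchy_exP => e /real_pos[r r0 ->].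
  have [|N hN] := uc (r / 2); first by rewrite divr_gt0.
  exists (u N); exists N => // n /= Nn; rewrite -ball_normE /=.
  apply/lt_nrP; apply: le_lt_trans (hN N n (leqnn _) Nn) _.
  by rewrite ltr_pdivrMr// ltr_pMr// ltr1n.
exists (limn u) => e e0; move/cvgrPdist_le : cu => /(_ e%:C).
rewrite ltcR => /(_ e0)[N _ hN]; exists N => n Nn; apply/le_nrP.
by rewrite distrC; exact: hN.
Qed.

(** * Powers of the absolute value on a Hilbert space *)

Section hilbert.
Variables (R : realType) (H : hilbertSpace R).
Implicit Types (x y z : H).

Lemma hs_dot_ge0 x : 0 <= hs_dot x x.
Proof. by rewrite -hs_normE exprn_ge0. Qed.

Definition hs_inner : semiInner H := SemiInner (@hs_dot_linear R H) (@hs_dot_conj R H) hs_dot_ge0.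
Arguments hs_inner : simpl never.

Lemma sn_hs x : sn hs_inner x = nr x.
Proof.
apply/eqP; rewrite -(@eqrXn2 _ 2)// sn_sqr -[hs_inner x x]/(hs_dot x x) -hs_normE -nrE -rmorphXn//=.
Qed.

Lemma hs_definite : definite hs_inner.
Proof. by move=> x; rewrite sn_hs => /eqP; rewrite nr_eq0 => /eqP. Qed.

Lemma hs_complete : seq_complete hs_inner.
Proof.
move=> u uc; have [|x hx] := @complete_seq _ _ u.
  by move=> e /uc[N hN]; exists N => m n Nm Nn; rewrite -sn_hs hN.
by exists x => e /hx[N hN]; exists N => n Nn; rewrite sn_hs hN.
Qed.

Lemma hs_adjointE (T T' : H -> H) : adjoints hs_inner T T' -> hs_adjoint T = T'.
Proof.
move=> h; rewrite /hs_adjoint; case: xgetP => [S _ hS|/(_ T')]; last by case.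
apply/funext => x; apply/eqP; rewrite -subr_eq0; apply/eqP/hs_definite/sn_null => y.
rewrite sipBr; have := hS y x; rewrite -[hs_dot (T y) x]/(hs_inner (T y) x) h.
by move=> ->; rewrite subrr.
Qed.

(** [fun_calculus] is a choice, and the bound that accompanies the chosen operator need not be M;
    hence the existential M'. *)
Lemma fun_calculusP (f : R -> R) (P : H -> H) (M : R) : linear P ->
  adjoints hs_inner P P -> (forall x, 0 <= complex.Re (hs_inner x (P x))) ->
  bounded_by hs_inner P M -> 0 < M -> quadratic_modulus f M ->
  exists M', [/\ 0 <= M', bounded_by hs_inner P M' &
    calculus hs_inner P M' f (fun_calculus f P)].
Proof.
move=> Pl Psa P0 PM M0 fM.
have op_polyE q x : op_poly q P x = polyop P (map_poly (real_complex R) q) x.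
  by rewrite /op_poly /polyop size_map_poly; apply: eq_bigr => i _; rewrite coef_map.
have [q qf] := Weierstrass M0 fM.
have [B hB] := calculus_exists Pl Psa P0 PM (ltW M0) hs_complete qf.
have : is_fun_calculus f P (fun_calculus f P).
  rewrite /fun_calculus; case: xgetP => // /(_ B) []; exists M, q; split => //.
    by move=> x; rewrite -!nrE -rmorphM lecR -!sn_hs.
  move=> e /hB; apply: filterS => n h x.
  by rewrite -!nrE -rmorphM lecR -!sn_hs op_polyE.
move=> [M' [r [PM' rf rB]]].
have bM' : bounded_by hs_inner P M'.
  by move=> x; rewrite !sn_hs -lecR rmorphM/= !nrE.
have hr e : 0 < e -> exists q, (forall t, 0 <= t <= M' -> `|q.[t] - f t| <= e) /\
    forall x, sn hs_inner (polyop P (map_poly (real_complex R) q) x - fun_calculus f P x)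
      <= e * sn hs_inner x.
  move=> e0; near \oo => n; exists (r n); split.
    by near: n; exact: rf.
  move=> x; rewrite !sn_hs -lecR rmorphM/= !nrE -op_polyE; move: x.
  by near: n; exact: rB.
have [M'0|M'0] := leP 0 M'; first by exists M'; split.
(* A negative bound M' is possible only on the trivial space, where 0 serves as well. *)
have triv x : sn hs_inner x = 0.
  apply/eqP; rewrite eq_le sn_ge0 andbT -(@ler_nM2l _ M')// mulr0.
  by apply: le_trans (bM' x); exact: sn_ge0.
exists 0; split => // [x|e e0]; first by rewrite !triv mulr0.
exists (f 0)%:P; split => [t|x]; last by rewrite !triv mulr0.
by rewrite -eq_le => /eqP <-; rewrite hornerC subrr normr0 ltW.
Unshelve. all: by end_near. Qed.

Variables (T T' : H -> H) (C p : R).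
Hypothesis TT' : adjoints hs_inner T T'.
Hypothesis TC : bounded_by hs_inner T C.
Hypothesis p1 : 1 <= p.
Let A := T' \o T.

Lemma adjoint_comp_sa : adjoints hs_inner A A.
Proof. by move=> x y; exact: etrans (adjoints_sym TT' (T x) y) (TT' x (T y)). Qed.

Lemma dot_adjoint_comp x : complex.Re (hs_inner x (A x)) = sn hs_inner (T x) ^+ 2.
Proof. by rewrite sn_sqr TT'. Qed.

Let B := op_abs_powR T p.

(** All that is used about |T|^p. The last clause comes from the scalar fact that on a bounded
    interval each of t^2 and t^p is at most e plus a multiple of the other. *)
Lemma op_abs_powR_spec : [/\ adjoints hs_inner B B,
  exists2 K, 0 <= K & bounded_by hs_inner B K,
  forall x, 0 <= complex.Re (hs_inner x (B x)),
  forall (l : R) x, 0 <= l -> A x = (l ^+ 2)%:C *: x -> B x = (l `^ p)%:C *: x &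
  forall e, 0 < e -> exists2 D, 0 <= D & forall x,
    sn hs_inner (T x) ^+ 2 <= e * sn hs_inner x ^+ 2 + D * complex.Re (hs_inner x (B x)) /\
    complex.Re (hs_inner x (B x)) <= e * sn hs_inner x ^+ 2 + D * sn hs_inner (T x) ^+ 2].
Proof.
pose K := `|C| + 1; have K0 : 0 < K by rewrite ltr_wpDl.
have TK : bounded_by hs_inner T K.
  move=> x; apply: le_trans (TC x) _; rewrite ler_wpM2r// /K.
  by have := ler_norm C; lra.
have Al : linear A by exact: (adjoints_linear hs_definite adjoint_comp_sa).
have A0 x : 0 <= complex.Re (hs_inner x (A x)) by rewrite dot_adjoint_comp exprn_ge0.
have AK : bounded_by hs_inner A (K * K).
  have T'K := adjoints_bounded (ltW K0) TT' TK; move=> x; rewrite -mulrA.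
  by apply: le_trans (T'K _) _; rewrite ler_wpM2l// ltW.
have [||M1 [M10 AM1 cA]] := @fun_calculusP Num.sqrt A (K * K) Al adjoint_comp_sa A0 AK.
- exact: mulr_gt0.
- exact: sqrt_modulus.
pose D := op_abs T.
have DE : D = fun_calculus Num.sqrt A by rewrite /D /op_abs (hs_adjointE TT').
rewrite -DE in cA.
have Dsa := calculus_adjoints adjoint_comp_sa cA.
have Dl : linear D := adjoints_linear hs_definite Dsa.
have D0 x : 0 <= complex.Re (hs_inner x (D x)).
  have := @calculus_poly_le _ _ _ _ _ Al adjoint_comp_sa A0 AM1 M10 _ _ cA 0 1.
  move=> /(_ _ x); rewrite rmorph0 polyop0 sip0r mul1r; apply => t _.
  by rewrite horner0 mul1r sqrtr_ge0.
have [KD KD0 hKD] := calculus_bounded AM1 M10 cA.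
(* If q approximates the square root, then q^2 approximates the identity, so |q(A) x|^2 is close
   both to |D x|^2 and to <x, A x> = |T x|^2. *)
have DT x : sn hs_inner (D x) = sn hs_inner (T x).
  apply/eqP; rewrite -(@eqrXn2 _ 2)// -subr_eq0 -normr_le0; apply/ler_addgt0Pr => d d0.
  rewrite add0r; set y := sn hs_inner x.
  pose r := Num.sqrt M1; have r0 : 0 <= r by exact: sqrtr_ge0.
  pose G := (4 * r + 4) * y ^+ 2 + 1.
  have y0 : 0 <= y by exact: sn_ge0.
  have G0 : 0 < G by rewrite ltr_wpDl// mulr_ge0 ?exprn_ge0// addr_ge0// mulr_ge0.
  pose e := Num.min 1 (d / G).
  have e0 : 0 < e by rewrite lt_min ltr01 divr_gt0.
  have e1 : e <= 1 by rewrite /e ge_min lexx.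
  have eG : e * G <= d by rewrite -ler_pdivlMr// /e ge_min lexx orbT.
  have [q [qf qD]] := cA e e0.
  have tr t : 0 <= t <= M1 -> 0 <= Num.sqrt t <= r.
    by move=> /andP[t0 tM]; rewrite sqrtr_ge0 ler_wsqrtr.
  have qt t : 0 <= t <= M1 -> `|q.[t]| <= r + 1.
    move=> tM; have := qf t tM; have /andP[h1 h2] := tr t tM.
    by rewrite !ler_norml; lra.
  have qq t : 0 <= t <= M1 -> `|q.[t] ^+ 2 - t| <= e * (2 * r + 1).
    move=> tM; have /andP[h1 h2] := tr t tM.
    have -> : q.[t] ^+ 2 - t = (q.[t] - Num.sqrt t) * (q.[t] + Num.sqrt t).
      by rewrite -subr_sqr sqr_sqrtr//; case/andP: tM.
    rewrite normrM ler_pM ?normr_ge0 ?qf// (le_trans (ler_normD _ _))//.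
    by rewrite (ger0_norm h1); have := qt t tM; lra.
  pose a := sn hs_inner (polyop A (map_poly (real_complex R) q) x).
  have a0 : 0 <= a by exact: sn_ge0.
  have ay : a <= (r + 1) * y.
    by have := rpoly_bounded Al adjoint_comp_sa A0 AM1 M10 qt x.
  have aE : complex.Re (hs_inner x (polyop A (map_poly (real_complex R) (q ^+ 2)) x)) = a ^+ 2.
    have -> : map_poly (real_complex R) (q ^+ 2) =
        map_poly (real_complex R) q * map_poly (real_complex R) q by rewrite expr2 rmorphM.
    rewrite polyopM// sn_sqr; congr complex.Re.
    exact/esym/(rpoly_adjoints adjoint_comp_sa).
  have XE : complex.Re (hs_inner x (polyop A (map_poly (real_complex R) 'X) x)) =
      sn hs_inner (T x) ^+ 2 by rewrite map_polyX polyopX//; exact: dot_adjoint_comp.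
  have h1 := @rpoly_ge _ _ _ _ _ Al adjoint_comp_sa A0 AM1 M10 (q ^+ 2 - 'X) (- (e * (2 * r + 1))).
  have h2 := @rpoly_ge _ _ _ _ _ Al adjoint_comp_sa A0 AM1 M10 ('X - q ^+ 2) (- (e * (2 * r + 1))).
  have {}h1 : - (e * (2 * r + 1)) * y ^+ 2 <= a ^+ 2 - sn hs_inner (T x) ^+ 2.
    have := h1 _ x; rewrite rmorphB polyopB sipBr raddfB/= aE XE; apply => t /qq.
    by rewrite hornerD hornerN horner_exp hornerX ler_norml => /andP[].
  have {}h2 : - (e * (2 * r + 1)) * y ^+ 2 <= sn hs_inner (T x) ^+ 2 - a ^+ 2.
    have := h2 _ x; rewrite rmorphB polyopB sipBr raddfB/= aE XE; apply => t /qq.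
    by rewrite hornerD hornerN horner_exp hornerX ler_norml; lra.
  pose b := sn hs_inner (D x); have b0 : 0 <= b by exact: sn_ge0.
  have ab : `|b - a| <= e * y.
    have k1 := ler_sn_dist hs_inner (D x) (polyop A (map_poly (real_complex R) q) x).
    have k2 := ler_sn_dist hs_inner (polyop A (map_poly (real_complex R) q) x) (D x).
    rewrite snBC in k1; have := qD x; rewrite -/y ler_norml; move: k1 k2; rewrite -/a -/b; lra.
  have ab2 : `|b ^+ 2 - a ^+ 2| <= e * ((2 * r + 3) * y ^+ 2).
    rewrite subr_sqr normrM; apply: le_trans (ler_pM _ _ ab (_ : _ <= (2 * r + 3) * y)) _ => //.
      rewrite ger0_norm ?addr_ge0//.
      have : e * y <= 1 * y by rewrite ler_wpM2r.
      by move: ab; rewrite ler_norml mul1r; move: ay; lra.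
    by rewrite expr2; lra.
  apply: le_trans eG; rewrite -/b /G.
  have : e * ((4 * r + 4) * y ^+ 2 + 1) = e * ((2 * r + 3) * y ^+ 2) + e * (2 * r + 1) * y ^+ 2 + e.
    by ring.
  by move=> ->; move: ab2; rewrite !ler_norml; lra.
have DKD : bounded_by hs_inner D (KD + 1).
  by move=> x; apply: le_trans (hKD x) _; rewrite ler_wpM2r// lerDl.
have [||M2 [M20 DM2 cB]] := @fun_calculusP (fun t => t `^ p) D (KD + 1) Dl Dsa D0 DKD.
- by rewrite ltr_wpDl.
- exact: powR_modulus.
rewrite -/(op_abs_powR T p) -/B in cB.
have poly2 q0 q2 x : polyop D (map_poly (real_complex R) (q0%:P + q2 *: 'X^2)) x =
    q0%:C *: x + q2%:C *: D (D x).
  rewrite rmorphD/= polyopD map_polyC/= polyopC map_polyZ polyopZ map_polyXn.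
  by rewrite expr2 polyop_mulX// polyopX.
have dot2 q0 q2 x : complex.Re (hs_inner x (q0%:C *: x + q2%:C *: D (D x))) =
    q0 * sn hs_inner x ^+ 2 + q2 * sn hs_inner (T x) ^+ 2.
  by rewrite sipDr !sipZr ReD !Re_realM -sn_sqr -Dsa -sn_sqr DT.
split.
- exact: (calculus_adjoints Dsa cB).
- exact: (calculus_bounded DM2 M20 cB).
- move=> x; have := @calculus_poly_le _ _ _ _ _ Dl Dsa D0 DM2 M20 _ _ cB 0 1.
  move=> /(_ _ x); rewrite rmorph0 polyop0 sip0r mul1r; apply => t _.
  by rewrite horner0 mul1r powR_ge0.
- move=> l x l0 hA.
  have [->|x0] := eqVneq x 0.
    have Bl := adjoints_linear hs_definite (calculus_adjoints Dsa cB).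
    by rewrite scaler0 (lin0 Bl).
  have sx0 : 0 < sn hs_inner x by rewrite sn_hs lt0r nr_eq0 x0 nr_ge0.
  have hD : D x = l%:C *: x.
    apply/eqP; rewrite -subr_eq0; apply/eqP/hs_definite.
    rewrite -[l]ger0_norm// -sqrtr_sqr; apply: (calculus_eigen Al cA _ hA).
    rewrite exprn_ge0//= -(ler_pM2r sx0); have := AM1 x; rewrite hA snZ nr_real.
    by rewrite ger0_norm ?exprn_ge0.
  apply/eqP; rewrite -subr_eq0; apply/eqP/hs_definite.
  apply: (calculus_eigen Dl cB _ hD).
  rewrite l0 /= -(ler_pM2r sx0); have := DM2 x; rewrite hD snZ nr_real.
  by rewrite ger0_norm.
(* Up to m both t^2 and t^p are at most e; between m and the bound M2 each is at most G times the
   other. *)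
- move=> e e0; pose m := Num.min (Num.sqrt e) (e `^ p^-1).
  have p0 : 0 < p by exact: lt_le_trans p1.
  have m0 : 0 < m by rewrite lt_min sqrtr_gt0 e0 powR_gt0.
  have small t : 0 <= t -> t <= m -> t ^+ 2 <= e /\ t `^ p <= e.
    move=> t0 tm; split.
      rewrite -[leRHS](sqr_sqrtr (ltW e0)) lerXn2r ?nnegrE ?sqrtr_ge0//.
      by rewrite (le_trans tm)// /m ge_min lexx.
    have -> : e = (e `^ p^-1) `^ p by rewrite -powRrM mulVf ?gt_eqF// powRr1// ltW.
    apply: ge0_ler_powR; rewrite ?nnegrE ?powR_ge0 ?(ltW p0)//.
    by rewrite (le_trans tm)// /m ge_min lexx orbT.
  pose G := M2 ^+ 2 / m `^ p + M2 `^ p / m ^+ 2.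
  have G1 : 0 <= M2 ^+ 2 / m `^ p by rewrite divr_ge0 ?exprn_ge0 ?powR_ge0.
  have G2 : 0 <= M2 `^ p / m ^+ 2 by rewrite divr_ge0 ?powR_ge0 ?exprn_ge0// ltW.
  have G0 : 0 <= G by exact: addr_ge0.
  have big t : 0 <= t <= M2 -> m < t -> t ^+ 2 <= G * t `^ p /\ t `^ p <= G * t ^+ 2.
    move=> /andP[t0 tM] mt.
    have mp0 : 0 < m `^ p by exact: powR_gt0.
    have m20 : 0 < m ^+ 2 by exact: exprn_gt0.
    have mtp : m `^ p <= t `^ p by rewrite ge0_ler_powR ?nnegrE ?(ltW p0) ?(ltW m0) ?(ltW mt).
    have mt2 : m ^+ 2 <= t ^+ 2 by rewrite lerXn2r ?nnegrE ?(ltW m0) ?(ltW mt).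
    split.
      apply: (@le_trans _ _ (M2 ^+ 2 / m `^ p * t `^ p)); last first.
        by rewrite ler_wpM2r ?powR_ge0// /G lerDl.
      rewrite mulrAC ler_pdivlMr// ler_pM ?exprn_ge0 ?powR_ge0//.
      by rewrite lerXn2r ?nnegrE.
    apply: (@le_trans _ _ (M2 `^ p / m ^+ 2 * t ^+ 2)); last first.
      by rewrite ler_wpM2r ?exprn_ge0// /G lerDr.
    rewrite mulrAC ler_pdivlMr// ler_pM ?exprn_ge0 ?powR_ge0 ?(ltW m0)//.
    by rewrite ge0_ler_powR ?nnegrE ?(ltW p0).
  have both t : 0 <= t <= M2 -> t ^+ 2 <= e + G * t `^ p /\ t `^ p <= e + G * t ^+ 2.
    move=> tM; have /andP[t0 _] := tM.
    have g1 : 0 <= G * t `^ p by rewrite mulr_ge0 ?powR_ge0.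
    have g2 : 0 <= G * t ^+ 2 by rewrite mulr_ge0 ?exprn_ge0.
    have [tm|mt] := leP t m; first by have [] := small t t0 tm; split; lra.
    by have [] := big t tM mt; split; lra.
  exists G => // x; split.
    have := @calculus_poly_le _ _ _ _ _ Dl Dsa D0 DM2 M20 _ _ cB ((- e)%:P + 1 *: 'X^2) G.
    move=> /(_ _ x); rewrite poly2 dot2 => h.
    have : - e * sn hs_inner x ^+ 2 + 1 * sn hs_inner (T x) ^+ 2 <= G * complex.Re (hs_inner x (B x)).
      apply: h => t /both[h1 _]; rewrite hornerD hornerC hornerZ hornerXn.
      lra.
    lra.
  have := @calculus_poly_le _ _ _ _ _ Dl Dsa D0 DM2 M20 _ _ cB ((- e)%:P + (- G) *: 'X^2) (-1).
  move=> /(_ _ x); rewrite poly2 dot2 => h.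
  have : - e * sn hs_inner x ^+ 2 + - G * sn hs_inner (T x) ^+ 2 <= -1 * complex.Re (hs_inner x (B x)).
    apply: h => t /both[_ h1]; rewrite hornerD hornerC hornerZ hornerXn.
    lra.
  lra.
Qed.

End hilbert.

(** * Singular value decomposition of compact operators *)

Lemma ultrafilter_limit (R : realType) (T : Type) (U : set_system T) (g : T -> R) (a : R) :
  UltraFilter U -> U [set x | `|g x| <= a] ->
  exists r : R, forall d, 0 < d -> U [set x | `|g x - r| < d].
Proof.
move=> UU Ua; have PU : ProperFilter U by exact: ultra_proper.
have gU : ProperFilter (g @ U) by apply: fmap_proper_filter.
have [r [_ rcl]] : `[- a, a] `&` cluster (g @ U) !=set0.
  apply: segment_compact; rewrite /nbhs /=; apply: filterS Ua => x /=.
  by rewrite in_itv /= -ler_norml.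
exists r => d d0; have [//|Uc] := in_ultra_setVsetC [set x | `|g x - r| < d] UU.
have [|_ [[x hx <-]]] := rcl (g @` (~` [set x | `|g x - r| < d])) (ball r d) _ (nbhsx_ballx _ _ d0).
  by rewrite /nbhs /=; apply: filterS Uc => x /= hx; exists x.
by rewrite -ball_normE /= distrC => /hx.
Qed.

Lemma sub_swap (Z : zmodType) (a b p q : Z) : p - q = (a - b) - ((a - p) - (b - q)).
Proof.
by rewrite (opprD b) opprK addrACA (opprD (a - b)) addrA subrr add0r opprD opprK.
Qed.

Section compact_svd.
Variables (R : realType) (V : lmodType R[i]) (s : semiInner V).
Variables (T T' : V -> V) (C : R).
Implicit Types (x y z : V) (b : seq V).
Hypothesis sd : definite s.
Hypothesis TT' : adjoints s T T'.
Hypothesis C0 : 0 <= C.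
Hypothesis TC : bounded_by s T C.

Let Tl : linear T := adjoints_linear sd TT'.
Let T'l : linear T' := adjoints_linear sd (adjoints_sym TT').

Lemma dot_TT x y : s (T x) (T y) = s (T' (T x)) y.
Proof. by rewrite (adjoints_sym TT'). Qed.

Lemma dot_A_sym x y : s (T' (T x)) y = s x (T' (T y)).
Proof. by rewrite -dot_TT TT'. Qed.

Hypothesis Tc : compact_op s T.

Lemma compact_ultrafilter (U : set_system V) : UltraFilter U ->
  U [set x | sn s x <= 1] -> forall e, 0 < e ->
  exists2 S, U S & forall x y, S x -> S y -> sn s (T x - T y) <= e.
Proof.
move=> UU U1 e e0; have PU : ProperFilter U by exact: ultra_proper.
have [|k [b bk hb]] := Tc (e := e / 4); first by rewrite divr_gt0.
have [f [fo _ fb]] := Gram_Schmidt b sd.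
set n := size b in fb.
(* Each of the n coordinates will vary by at most 4 d, so under T they contribute at most 4 d C n <=
   e / 2 together. *)
pose d := e / (8 * (C * n%:R + 1)).
have D0 : 0 < C * n%:R + 1 by rewrite ltr_wpDl// mulr_ge0.
have d0 : 0 < d by rewrite divr_gt0// mulr_gt0.
have ball1 i x : sn s x <= 1 -> nr (s (f i) x) <= 1.
  move=> x1; rewrite (le_trans (CauchySchwarz _ _ _))// -[leRHS]mulr1.
  by rewrite ler_pM// (onf_le1 fo).
have le_ReIm (w : R[i]) : nr w <= `|complex.Re w| + `|complex.Im w|.
  rewrite -lecR nrE {1}[w]complexE (le_trans (ler_normD _ _))// rmorphD/= lerD//.
    by rewrite -nrE nr_real.
  rewrite normrM -!nrE nr_real -rmorphM lecR.
  by rewrite [nr 'i]/nr normc_def /= !expr0n expr1n /= add0r sqrtr1 mul1r.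
have coord i : exists2 S, U S & forall x y, S x -> S y -> nr (s (f i) (x - y)) <= 4 * d.
  have [|r1 hr1] := @ultrafilter_limit _ _ U (fun x => complex.Re (s (f i) x)) 1 UU.
  - by apply: filterS U1 => x /= /(ball1 i); exact: (le_trans (norm_Re_le_nr _)).
  have [|r2 hr2] := @ultrafilter_limit _ _ U (fun x => complex.Im (s (f i) x)) 1 UU.
  - by apply: filterS U1 => x /= /(ball1 i); exact: (le_trans (norm_Im_le_nr _)).
  exists ([set x | `|complex.Re (s (f i) x) - r1| < d] `&`
          [set x | `|complex.Im (s (f i) x) - r2| < d]).
    by apply: filterI; [exact: hr1|exact: hr2].
  move=> x y [/= x1 x2] [/= y1 y2]; apply: le_trans (le_ReIm _) _.
  rewrite sipBr !raddfB/=; move: x1 x2 y1 y2; rewrite !ltr_norml => x1 x2 y1 y2.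
  have a1 : `|complex.Re (s (f i) x) - complex.Re (s (f i) y)| <= 2 * d.
    by rewrite ler_norml; lra.
  have a2 : `|complex.Im (s (f i) x) - complex.Im (s (f i) y)| <= 2 * d.
    by rewrite ler_norml; lra.
  lra.
have [F hF] : exists F : nat -> set V, forall i, U (F i) /\
    forall x y, F i x -> F i y -> nr (s (f i) (x - y)) <= 4 * d.
  suff /choice[F hF] : forall i, exists S, U S /\
      forall x y, S x -> S y -> nr (s (f i) (x - y)) <= 4 * d by exists F.
  by move=> i; have [S] := coord i; exists S.
exists ([set x | sn s x <= 1] `&` [set x | forall i, (i < n)%N -> F i x]).
  apply: filterI => //; elim: (n) => [|m IH].
    by apply: filterS U1 => x _ i.
  apply: filterS (filterI IH (hF m).1) => x /= [h1 h2] i.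
  by rewrite ltnS leq_eqVlt => /predU1P[->//|]; exact: h1.
move=> x y [/= x1 xF] [/= y1 yF]; rewrite -linB//.
set z := x - y; have z2 : sn s z <= 2.
  by rewrite (le_trans (ler_snB _ _ _))//; lra.
rewrite -(subrK (proj s f n z) z) linD//.
apply: le_trans (ler_snD _ _ _) _.
have h1 : sn s (T (z - proj s f n z)) <= e / 2.
  apply: le_trans (hb _ _) _.
    move=> w /fb ->; apply: dot_sub_projl => // j jn; exact: dot_sub_proj.
  have := sn_sub_proj_le fo n z.
  rewrite -(ler_pM2l (_ : 0 < e / 4)) ?divr_gt0// => h; apply: le_trans h _.
  have -> : e / 2 = e / 4 * 2 by field.
  by rewrite ler_wpM2l// ltW// divr_gt0.
have h2 : sn s (T (proj s f n z)) <= e / 2.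
  apply: le_trans (TC _) _; apply: le_trans (ler_wpM2l C0 (sn_sum _ _ _ _)) _.
  apply: (@le_trans _ _ (C * \sum_(i < n) 4 * d)).
    apply: ler_wpM2l => //; apply: ler_sum => i _; rewrite snZ.
    apply: (@le_trans _ _ (4 * d * 1)); last by rewrite mulr1.
    apply: ler_pM => //; last exact: (onf_le1 fo).
    by apply: (hF i).2; [apply: xF|apply: yF] => /=.
  rewrite sumr_const card_ord -mulr_natr.
  have -> : e / 2 = 4 * d * (C * n%:R + 1) by rewrite /d; field; rewrite gt_eqF.
  by have := mulr_gt0 (ltr0n _ 4) d0; nra.
lra.
Qed.

Definition eigenlist b := forall y, y \in b -> exists l, T' (T y) = l *: y.

(** The alternative e = 0 serves the case that T vanishes on the complement of b. *)
Definition maximal_in b e := [/\ orthogonal_to s b e, e = 0 \/ sn s e = 1,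
  T' (T e) = (sn s (T e) ^+ 2)%:C *: e &
  forall x, orthogonal_to s b x -> sn s (T x) <= sn s (T e) * sn s x].

Hypothesis sc : seq_complete s.

(** The complement of eigenvectors is invariant under T^* T. Almost maximising vectors x in it
    almost satisfy T^* T x = L^2 x, and their images under T are Cauchy along an ultrafilter; since
    L > 0, the vectors themselves are recovered as a Cauchy sequence. *)
Lemma exists_maximal b : eigenlist b -> exists e, maximal_in b e.
Proof.
move=> eb; have hA x : orthogonal_to s b x -> orthogonal_to s b (T' (T x)).
  move=> hx y yb; have [l Ay] := eb y yb.
  by rewrite -dot_A_sym Ay sipZl hx// mulr0.
pose W := [set r | exists x, [/\ orthogonal_to s b x, sn s x <= 1 & r = sn s (T x)]].
have W0 : W 0 by exists 0; split; rewrite ?sn0// ?lin0 ?sn0// => y _; exact: sip0r.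
have supW : has_sup W.
  split; first by exists 0.
  exists C => _ [x [_ x1 ->]]; apply: le_trans (TC x) _.
  by rewrite -[leRHS]mulr1 ler_wpM2l.
pose L := sup W; have L0 : 0 <= L by apply: ub_le_sup => //; exact: supW.2.
have LP x : orthogonal_to s b x -> sn s (T x) <= L * sn s x.
  move=> hx; have [x0|x0] := eqVneq (sn s x) 0.
    by have := TC x; rewrite x0 !mulr0.
  have xp : 0 < sn s x by rewrite lt0r x0 sn_ge0.
  rewrite -ler_pdivrMr//; apply: ub_le_sup; first exact: supW.2.
  exists (((sn s x)^-1)%:C *: x); split.
  - by move=> y yb; rewrite sipZr hx// mulr0.
  - by rewrite snZ nr_real ger0_norm ?invr_ge0// mulVf.
  - by rewrite linZ// snZ nr_real ger0_norm ?invr_ge0// mulrC.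
have [L00|Ln0] := eqVneq L 0.
  exists 0; split; first by move=> y _; exact: sip0r.
  - by left.
  - by rewrite (lin0 Tl) (lin0 T'l) scaler0.
  - by move=> x /LP; rewrite L00 (lin0 Tl) sn0.
have Lp : 0 < L by rewrite lt0r Ln0.
pose N (e : R) := [set x | [/\ orthogonal_to s b x, sn s x <= 1 & L - e < sn s (T x)]].
have N0 e : 0 < e -> N e !=set0.
  move=> e0; have [_ [x [x1 x2 ->]] hx] := sup_adherent e0 supW.
  by exists x; split.
pose F := [set S : set V | exists2 e, 0 < e & N e `<=` S].
have NN e e' : e <= e' -> N e `<=` N e'.
  by move=> ee x [h1 h2 h3]; split => //; apply: le_lt_trans h3; rewrite lerD2l lerN2.
have FF : ProperFilter F.
  apply: Build_ProperFilter_ex.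
    by move=> S [e e0 h]; have [x /h] := N0 e e0; exists x.
  split.
  - by exists 1.
  - move=> P Q [e e0 hP] [d d0 hQ]; exists (Num.min e d); first by rewrite lt_min e0.
    by move=> x hx; split; [apply: hP|apply: hQ]; apply: NN hx; rewrite ge_min lexx ?orbT.
  - by move=> P Q PQ [e e0 hP]; exists e => // x /hP /PQ.
have [U [UU FU]] := ultraFilterLemma FF.
have UN e : 0 < e -> U (N e) by move=> e0; apply: FU; exists e.
have PU : ProperFilter U by exact: ultra_proper.
have U1 : U [set x | sn s x <= 1] by apply: filterS (UN _ ltr01) => x [].
pose inv n : R := n.+1%:R^-1.
have inv0 n : 0 < inv n by rewrite invr_gt0.
have [S hS] : exists S : nat -> set V, forall n, U (S n) /\
    forall x y, S n x -> S n y -> sn s (T x - T y) <= inv n.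
  suff /choice[S hS] : forall n, exists Q, U Q /\
      forall x y, Q x -> Q y -> sn s (T x - T y) <= inv n by exists S.
  by move=> n; have [Q] := compact_ultrafilter UU U1 (inv0 n); exists Q.
(* Membership in all earlier sets makes T x_n Cauchy: x_i and x_j both lie in S_n as soon as n <= i
   and n <= j. *)
have Sx n : exists x, N (inv n) x /\ forall i, (i <= n)%N -> S i x.
  suff US : U [set x | forall i, (i <= n)%N -> S i x].
    by have [x [h1 h2]] := filter_ex (filterI (UN _ (inv0 n)) US); exists x.
  elim: n => [|m IH].
    by apply: filterS (hS 0%N).1 => x hx i; rewrite leqn0 => /eqP ->.
  apply: filterS (filterI IH (hS m.+1).1) => x /= [h1 h2] i.
  by rewrite leq_eqVlt => /predU1P[->//|]; rewrite ltnS; exact: h1.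
have [x hx] := choice Sx.
pose A := T' \o T.
have near_eigen z : orthogonal_to s b z -> sn s z <= 1 ->
    sn s (A z - (L ^+ 2)%:C *: z) ^+ 2 <= L ^+ 2 * (L ^+ 2 - sn s (T z) ^+ 2).
  move=> hz z1; rewrite sn_sqrB snZ nr_real ger0_norm ?exprn_ge0// sipZr Re_realM.
  have -> : complex.Re (s (A z) z) = sn s (T z) ^+ 2.
    by rewrite sn_sqr dot_TT.
  have h1 : sn s (A z) ^+ 2 <= (L * sn s (T z)) ^+ 2.
    rewrite lerXn2r ?nnegrE ?mulr_ge0//.
    have [->|A0] := eqVneq (sn s (A z)) 0; first exact: mulr_ge0.
    have : sn s (A z) ^+ 2 <= sn s (A z) * (L * sn s (T z)).
      rewrite sn_sqr [s (A z) (A z)](adjoints_sym TT').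
      rewrite (le_trans (Re_le_nr _))// (le_trans (CauchySchwarz _ _ _))//.
      by rewrite mulrA mulrC ler_wpM2r// mulrC LP//; exact: hA.
    by rewrite expr2 ler_pM2l// lt0r A0 sn_ge0.
  have h2 : (L ^+ 2 * sn s z) ^+ 2 <= L ^+ 2 * L ^+ 2.
    rewrite exprMn -expr2 -[leRHS]mulr1 ler_wpM2l ?exprn_ge0//.
    by rewrite expr_le1.
  by move: h1; rewrite exprMn => h1; rewrite mulrBr; lra.
have Tx n : L ^+ 2 - sn s (T (x n)) ^+ 2 <= 2 * L * inv n.
  have [[h1 h2 h3] _] := hx n; have h4 := LP _ h1.
  have h5 : sn s (T (x n)) <= L by apply: le_trans h4 _; rewrite -[leRHS]mulr1 ler_wpM2l.
  rewrite subr_sqr.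
  have : 0 <= (L - sn s (T (x n))) * (2 * L - (L + sn s (T (x n)))).
    by apply: mulr_ge0; lra.
  have : 0 <= (inv n - (L - sn s (T (x n)))) * (2 * L).
    by apply: mulr_ge0; lra.
  lra.
have [e he] : exists e, forall d, 0 < d -> exists n, forall m, (n <= m)%N -> sn s (x m - e) <= d.
  apply: sc => d d0.
  (* Two eigenvector errors and the distance of the images, each at most d1, add up to L^2 d. *)
  pose d1 := L ^+ 2 * d / 3; have d10 : 0 < d1 by rewrite divr_gt0// mulr_gt0// exprn_gt0.
  have [n1 hn1] := natSinv_small (e := d1 / (C + 1)) ltac:(by rewrite divr_gt0// ltr_wpDl).
  have [n2 hn2] := natSinv_small (e := d1 ^+ 2 / (2 * L ^+ 3)) ltac:(by rewrite divr_gt0 ?exprn_gt0// mulr_gt0 ?exprn_gt0).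
  exists (maxn n1 n2) => i j; rewrite !geq_max => /andP[i1 i2] /andP[j1 j2].
  have hAe m : (n2 <= m)%N -> sn s (A (x m) - (L ^+ 2)%:C *: x m) <= d1.
    move=> m2; rewrite -(@ler_pXn2r _ 2) ?nnegrE// ?(ltW d10)//.
    have [[h1 h2 h3] _] := hx m; apply: le_trans (near_eigen _ h1 h2) _.
    apply: le_trans (ler_wpM2l (exprn_ge0 _ L0) (Tx m)) _.
    have -> : L ^+ 2 * (2 * L * inv m) = inv m * (2 * L ^+ 3) by ring.
    by rewrite -ler_pdivlMr ?mulr_gt0 ?exprn_gt0// hn2.
  have hAA : sn s (A (x i) - A (x j)) <= d1.
    have -> : A (x i) - A (x j) = T' (T (x i) - T (x j)) by rewrite linB.
    apply: le_trans (adjoints_bounded C0 TT' TC _) _.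
    have : sn s (T (x i) - T (x j)) <= d1 / (C + 1).
      apply: (le_trans _ (hn1 n1 (leqnn n1))); apply: (hS n1).2; [exact: (hx i).2|exact: (hx j).2].
    rewrite ler_pdivlMr ?ltr_wpDl// => h; apply: le_trans h.
    by rewrite mulrC ler_wpM2l// lerDl.
  have -> : x i - x j = ((L ^+ 2)^-1)%:C *: ((L ^+ 2)%:C *: (x i - x j)).
    by rewrite scalerA -rmorphM mulVf ?scale1r// expf_neq0.
  rewrite snZ nr_real ger0_norm ?invr_ge0 ?exprn_ge0//.
  rewrite ler_pdivrMl ?exprn_gt0// scalerBr.
  have -> : (L ^+ 2)%:C *: x i - (L ^+ 2)%:C *: x j =
      (A (x i) - A (x j)) - ((A (x i) - (L ^+ 2)%:C *: x i) - (A (x j) - (L ^+ 2)%:C *: x j)).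
    exact: sub_swap.
  apply: le_trans (ler_snB _ _ _) _; apply: le_trans (lerD hAA (ler_snB _ _ _)) _.
  apply: le_trans (lerD (lexx _) (lerD (hAe _ i2) (hAe _ j2))) _.
  by rewrite /d1; lra.
have eo : orthogonal_to s b e.
  move=> y yb; apply/eqP; rewrite -nr_eq0 eq_le nr_ge0 andbT; apply/ler_addgt0Pr => d d0.
  have y1 : 0 < sn s y + 1 by rewrite ltr_wpDl.
  have [n hn] := he (d / (sn s y + 1)) ltac:(by rewrite divr_gt0).
  have -> : s y e = - s y (x n - e) by have [[h _ _] _] := hx n; rewrite sipBr h// sub0r opprK.
  rewrite nrN add0r (le_trans (CauchySchwarz _ _ _))//.
  have := hn n (leqnn _); rewrite ler_pdivlMr// => h; apply: le_trans h.
  by rewrite mulrC ler_wpM2l// lerDl.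
have e1 : sn s e <= 1.
  apply/ler_addgt0Pr => d d0; have [n hn] := he d d0.
  apply: le_trans (ler_sn_dist s e (x n)) _; rewrite snBC.
  by have [[_ h _] _] := hx n; apply: lerD h (hn n _).
have Le : L <= sn s (T e).
  apply/ler_addgt0Pr => d d0.
  have C1 : 0 < C + 1 by rewrite ltr_wpDl.
  have [n1 hn1] := natSinv_small (e := d / 2) ltac:(by rewrite divr_gt0).
  have [n2 hn2] := he (d / 2 / (C + 1)) ltac:(by rewrite !divr_gt0).
  pose n := maxn n1 n2; have [[_ _ h3] _] := hx n.
  have h1 : inv n <= d / 2 := hn1 n (leq_maxl _ _); have h2 := hn2 n (leq_maxr _ _).
  have h4 := ler_sn_dist s (T (x n)) (T e).
  have h5 : sn s (T (x n) - T e) <= d / 2.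
    rewrite -linB//; apply: le_trans (TC _) _.
    move: h2; rewrite ler_pdivlMr// => h2; apply: le_trans h2.
    by rewrite mulrC ler_wpM2l// lerDl.
  lra.
have TeL : sn s (T e) = L.
  apply/eqP; rewrite eq_le Le andbT; apply: le_trans (LP _ eo) _.
  by rewrite -[leRHS]mulr1 ler_wpM2l.
exists e; split => //.
- right; apply/eqP; rewrite eq_le e1 /= -(ler_pM2l Lp) mulr1.
  by rewrite -{1}TeL LP.
- apply/eqP; rewrite TeL -subr_eq0; apply/eqP/sd/eqP.
  rewrite -sqrf_eq0 eq_le exprn_ge0// andbT.
  by apply: le_trans (near_eigen _ eo e1) _; rewrite TeL subrr mulr0.
- by move=> z hz; rewrite TeL LP.
Qed.

(** No expansion of T is asserted; the third clause, which bounds T off the first n vectors by the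
    n-th singular value, takes its place. *)
Definition svd (e : nat -> V) := [/\ onf s e,
  forall i, T' (T (e i)) = (sn s (T (e i)) ^+ 2)%:C *: e i &
  forall n x, (forall i, (i < n)%N -> s (e i) x = 0) -> sn s (T x) <= sn s (T (e n)) * sn s x].

Lemma exists_svd : exists e, svd e.
Proof.
have [pick hpick] : exists pick : seq V -> V, forall b, eigenlist b -> maximal_in b (pick b).
  suff /choice[pick h] : forall b, exists e, eigenlist b -> maximal_in b e by exists pick.
  move=> b; have [/exists_maximal[e he]|nb] := pselect (eigenlist b); first by exists e.
  by exists 0.
pose pre := fix pre n := if n is m.+1 then rcons (pre m) (pick (pre m)) else [::].
have preS n : pre n.+1 = rcons (pre n) (pick (pre n)) by [].
have eig n : eigenlist (pre n).
  elim: n => [|n IH]; first by move=> y.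
  move=> y; rewrite preS mem_rcons inE => /predU1P[->|]; last exact: IH.
  by have [_ _ h _] := hpick _ IH; eexists; exact: h.
pose e n := pick (pre n); have he n : maximal_in (pre n) (e n) by exact: hpick.
have mem_pre n y : y \in pre n <-> exists2 i, (i < n)%N & y = e i.
  elim: n => [|n IH]; first by split => // -[].
  rewrite preS mem_rcons inE; split.
    move=> /predU1P[->|]; first by exists n.
    by move=> /IH[i ni ->]; exists i => //; exact: ltnW.
  case=> k; rewrite ltnS leq_eqVlt => /predU1P[->|nk] yE; first by rewrite yE eqxx.
  by apply/orP; right; apply/IH; exists k.
have lt_orth i j : (i < j)%N -> s (e i) (e j) = 0.
  by move=> ij; have [h _ _ _] := he j; apply: h; apply/mem_pre; exists i.
exists e; split.
- split => [i j|i]; last by have [] := he i.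
  rewrite neq_ltn => /orP[/lt_orth//|/lt_orth h]; exact: sip_eq0_sym.
- by move=> i; have [] := he i.
- move=> n x hx; have [_ _ _ h] := he n; apply: h => y /mem_pre[i ni ->]; exact: hx.
Qed.

End compact_svd.

Section svd_theory.
Variables (R : realType) (V : lmodType R[i]) (s : semiInner V).
Variables (T T' : V -> V) (C : R) (e : nat -> V).
Implicit Types (x y z : V) (b : seq V).
Hypothesis sd : definite s.
Hypothesis TT' : adjoints s T T'.
Hypothesis C0 : 0 <= C.
Hypothesis TC : bounded_by s T C.
Hypothesis Te : svd s T T' e.

Let Tl : linear T := adjoints_linear sd TT'.
Let T'l : linear T' := adjoints_linear sd (adjoints_sym TT').
Let eo : onf s e. Proof. by case: Te. Qed.
Local Notation sg n := (sn s (T (e n))).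

Lemma svd_le_anti m n : (m <= n)%N -> sg n <= sg m.
Proof.
have [_ _ h] := Te.
move=> mn; apply: le_trans (h m _ _) _.
  by move=> i im; apply: eo.1; rewrite neq_ltn (leq_trans im mn).
by rewrite -[leRHS]mulr1 ler_wpM2l// (onf_le1 eo).
Qed.

Lemma svd_null_or i : (e i = 0 /\ sg i = 0) \/ sn s (e i) = 1.
Proof. by have [ei|] := eo.2 i; [left; rewrite ei (lin0 Tl) sn0|right]. Qed.

Lemma svd_sqrM i : sg i ^+ 2 * sn s (e i) ^+ 2 = sg i ^+ 2.
Proof. by have [[-> ->]|->] := svd_null_or i; rewrite ?expr0n ?mul0r// expr1n mulr1. Qed.

Lemma svd_comb n (c : nat -> R[i]) :
  sn s (T (\sum_(i < n) c i *: e i)) ^+ 2 = \sum_(i < n) nr (c i) ^+ 2 * sg i ^+ 2.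
Proof.
have [_ eig _] := Te.
have TTE : T' (T (\sum_(i < n) c i *: e i)) = \sum_(i < n) (c i * (sg i ^+ 2)%:C) *: e i.
  rewrite (linear_comb _ _ _ _ Tl) (linear_comb _ _ _ _ T'l).
  by apply: eq_bigr => i _; rewrite eig scalerA.
rewrite sn_sqr (dot_TT TT') TTE sip_suml Re_sum; apply: eq_bigr => i _.
rewrite sipZl (@onf_dot_sum _ _ s _ eo n i c)//.
rewrite rmorphM/= conj_real mulrACA nr_conjM sip_sqr -!rmorphM/=.
by rewrite svd_sqrM.
Qed.

Lemma svd_sub_proj n x : sn s (T x) ^+ 2 =
  \sum_(i < n) nr (s (e i) x) ^+ 2 * sg i ^+ 2 + sn s (T (x - proj s e n x)) ^+ 2.
Proof.
have [_ eig _] := Te.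
rewrite -(svd_comb n (fun i => s (e i) x)) -/(proj s e n x) -Pythagoras.
  by rewrite -linD// addrC subrK.
rewrite (linear_comb _ _ _ _ Tl) sip_suml big1// => i _.
by rewrite sipZl (dot_TT TT') eig sipZl dot_sub_proj// !mulr0.
Qed.

Lemma svd_gelfand_le k : gelfand_le s T k (sg k).
Proof.
have [_ _ h] := Te.
exists [seq e i | i <- iota 0 k]; first by rewrite size_map size_iota.
by move=> x hx; apply: h => i ik; apply: hx; rewrite map_f// mem_iota.
Qed.

(** Some combination of e_0, ..., e_k with unit coefficient vector is orthogonal to the k given
    vectors, and its image has norm at least sg k. *)
Lemma svd_gelfand_ge k c : 0 <= c -> gelfand_le s T k c -> sg k <= c.
Proof.
move=> c0 [b bk hb]; have [a [a1 /hb ax]] := kernel_comb s e bk.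
set x := \sum_(i < k.+1) a i *: e i in ax.
have x1 : sn s x <= 1.
  rewrite -(@expr_le1 _ 2)// (onf_sum_sqr eo) -a1; apply: ler_sum => i _.
  by rewrite ler_piMr ?exprn_ge0// exprn_ile1// (onf_le1 eo).
have : sg k ^+ 2 <= sn s (T x) ^+ 2.
  rewrite svd_comb -[leLHS]mul1r -a1 mulr_suml; apply: ler_sum => i _.
  rewrite ler_wpM2l ?exprn_ge0// lerXn2r ?nnegrE// svd_le_anti//.
  by rewrite -ltnS.
rewrite ler_pXn2r ?nnegrE// => h; apply: le_trans h _; apply: le_trans ax _.
by rewrite -[leRHS]mulr1 ler_wpM2l.
Qed.

Lemma svd_gelfand k : gelfand s T k = sg k.
Proof.
apply/eqP; rewrite eq_le gelfand_min//=; last exact: svd_gelfand_le.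
apply: gelfand_ge => [|d d0 hd]; last exact: svd_gelfand_ge.
by exists (sg k); split => //; exact: svd_gelfand_le.
Qed.

(** Ky Fan's principle with Bessel's inequality in place of orthonormality, as lifted vectors are
    only almost orthonormal. After sg m^2 has been split off, the weights sg i^2 - sg m^2 are
    non-negative and Bessel bounds the coefficient of each by 1. *)
Lemma svd_KyFan m (x : nat -> V) :
  (forall z, \sum_(j < m) nr (s (x j) z) ^+ 2 <= sn s z ^+ 2) ->
  \sum_(j < m) sn s (T (x j)) ^+ 2 <= \sum_(i < m) sg i ^+ 2.
Proof.
move=> Bx; have [_ _ hT] := Te.
have x1 j : (j < m)%N -> sn s (x j) ^+ 2 <= 1.
  move=> jm; have [->|xj0] := eqVneq (sn s (x j) ^+ 2) 0; first exact: ler01.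
  have xj : 0 < sn s (x j) ^+ 2 by rewrite lt0r xj0 exprn_ge0.
  have := Bx (x j); rewrite (bigD1 (Ordinal jm))//= sip_sqr nr_real.
  rewrite ger0_norm ?exprn_ge0// => h.
  rewrite -(ler_pM2l xj) mulr1 -expr2; apply: le_trans h; rewrite lerDl.
  by apply: sumr_ge0 => i _; rewrite exprn_ge0.
have key j : (j < m)%N -> sn s (T (x j)) ^+ 2 <=
    \sum_(i < m) (sg i ^+ 2 - sg m ^+ 2) * nr (s (x j) (e i)) ^+ 2 + sg m ^+ 2.
  move=> jm; rewrite (svd_sub_proj m).
  set r := x j - _.
  have h1 : sn s (T r) ^+ 2 <= sg m ^+ 2 * sn s r ^+ 2.
    rewrite -exprMn lerXn2r ?nnegrE ?mulr_ge0//; apply: hT => i im.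
    exact: dot_sub_proj.
  have h2 := sn_sub_proj eo m (x j); rewrite -/r in h2.
  have h3 : sg m ^+ 2 * sn s r ^+ 2 <= sg m ^+ 2 * (1 - \sum_(i < m) nr (s (e i) (x j)) ^+ 2).
    by rewrite ler_wpM2l ?exprn_ge0//; have := x1 j jm; lra.
  have -> : \sum_(i < m) (sg i ^+ 2 - sg m ^+ 2) * nr (s (x j) (e i)) ^+ 2 =
      \sum_(i < m) nr (s (e i) (x j)) ^+ 2 * sg i ^+ 2 -
      sg m ^+ 2 * \sum_(i < m) nr (s (e i) (x j)) ^+ 2.
    rewrite mulr_sumr -sumrB; apply: eq_bigr => i _.
    by rewrite -(sip_conj s (x j)) nr_conj; ring.
  lra.
apply: (@le_trans _ _ (\sum_(j < m) (\sum_(i < m) (sg i ^+ 2 - sg m ^+ 2) *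
    nr (s (x j) (e i)) ^+ 2 + sg m ^+ 2))).
  by apply: ler_sum => j _; exact: key.
rewrite big_split/= exchange_big/=.
apply: (@le_trans _ _ (\sum_(i < m) ((sg i ^+ 2 - sg m ^+ 2) + sg m ^+ 2))); last first.
  by apply: ler_sum => i _; rewrite subrK.
rewrite [leRHS]big_split/= lerD2r; apply: ler_sum => i _.
rewrite -mulr_sumr -[leRHS]mulr1 ler_wpM2l//.
  by rewrite subr_ge0 lerXn2r ?nnegrE// svd_le_anti// ltnW.
by apply: le_trans (Bx (e i)) _; rewrite exprn_ile1// (onf_le1 eo).
Qed.

(** Both sides are the squared Hilbert-Schmidt norm of T, computed from the e_j and from an
    orthonormal system spanning the w_i. The right-hand side is polynomial in inner products, so a
    character can be pulled out of it. *)
Lemma svd_finite_rank n (v w : nat -> V) :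
  (forall x, T x = \sum_(i < n) s (w i) x *: v i) ->
  \sum_(j < n) sg j ^+ 2 = complex.Re (\sum_(i < n) \sum_(l < n) s (w l) (w i) * s (v i) (v l)).
Proof.
move=> TE; have [_ eig hT] := Te.
pose b := [seq w i | i <- iota 0 n]; have bn : size b = n by rewrite size_map size_iota.
have wb i : (i < n)%N -> w i \in b by move=> ni; rewrite map_f// mem_iota.
have Tb x : orthogonal_to s b x -> T x = 0.
  by move=> h; rewrite TE big1// => i _; rewrite h ?scale0r// wb.
have sn0' : sg n = 0.
  apply/eqP; rewrite eq_le sn_ge0 andbT; apply: svd_gelfand_ge => //.
  by exists b => [|x /Tb ->]; rewrite ?bn// sn0 mul0r.
have TxE x : sn s (T x) ^+ 2 = \sum_(j < n) nr (s (e j) x) ^+ 2 * sg j ^+ 2.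
  rewrite (svd_sub_proj n); set r := x - _.
  suff -> : sn s (T r) = 0 by rewrite expr0n addr0.
  apply/eqP; rewrite eq_le sn_ge0 andbT -[leRHS](mul0r (sn s r)) -sn0'.
  by apply: hT => i im; exact: dot_sub_proj.
have [f [fo _ fb]] := Gram_Schmidt b sd; rewrite bn in fb.
have wE i : (i < n)%N -> w i = proj s f n (w i) by move=> ni; exact: fb (wb _ ni).
have sumE : \sum_(l < n) sn s (T (f l)) ^+ 2 = \sum_(j < n) sg j ^+ 2.
  under eq_bigr => l _ do rewrite TxE.
  rewrite exchange_big/=; apply: eq_bigr => j _; rewrite -mulr_suml.
  have [->|sj] := eqVneq (sg j) 0; first by rewrite expr0n mulr0.
  rewrite -[RHS]mul1r; congr (_ * _).
  under eq_bigr => l _ do rewrite -(sip_conj s (f l)) nr_conj.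
  (* A singular vector with sg j != 0 is orthogonal to the kernel of T, which contains r; hence it
     lies in the span of f. *)
  pose r := e j - proj s f n (e j).
  have rf l : (l < n)%N -> s (f l) r = 0 by exact: dot_sub_proj.
  have Tr : T r = 0.
    by apply: Tb => y /fb ->; apply: dot_sub_projl.
  have rj : s r (e j) = 0.
    have : s (T r) (T (e j)) = 0 by rewrite Tr sip0l.
    rewrite TT' eig sipZr => /eqP; rewrite mulf_eq0 => /orP[|/eqP//].
    by rewrite (inj_eq (@complexI R) _ 0) sqrf_eq0 (negPf sj).
  have r0 : sn s r = 0.
    apply/eqP; rewrite -sqrf_eq0 sn_sqr {2}/r sipBr rj sub0r.
    by rewrite [s r _]sip_eq0_sym ?oppr0//; exact: dot_sub_projl.
  have := sn_sub_proj fo n (e j); rewrite -/r r0 expr0n addr0 => <-.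
  by have [[_ h]|->] := svd_null_or j; [rewrite h eqxx in sj|rewrite expr1n].
rewrite -sumE; apply/complexI; rewrite rmorph_sum/=.
transitivity (\sum_(l < n) \sum_(i < n) \sum_(k < n) (s (w i) (f l))^* * s (w k) (f l) * s (v i) (v k)).
  apply: eq_bigr => l _; rewrite -sip_sqr !TE sip_suml; apply: eq_bigr => i _.
  rewrite sip_sumr; apply: eq_bigr => k _.
  by rewrite sipZl sipZr mulrA.
have -> : \sum_(l < n) \sum_(i < n) \sum_(k < n) (s (w i) (f l))^* * s (w k) (f l) * s (v i) (v k)
   = \sum_(i < n) \sum_(l < n) s (w l) (w i) * s (v i) (v l).
  rewrite exchange_big/=; apply: eq_bigr => i _; rewrite exchange_big/=.
  apply: eq_bigr => k _; rewrite -mulr_suml; congr (_ * _).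
  rewrite [in RHS](wE i)// /proj sip_sumr; apply: eq_bigr => l _.
  by rewrite sipZr; congr (_ * _); exact: sip_conj.
rewrite RRe_real//; apply/CrealP; rewrite rmorph_sum exchange_big/=.
apply: eq_bigr => i _; rewrite rmorph_sum; apply: eq_bigr => l _.
by rewrite rmorphM; congr (_ * _); exact: sip_conj.
Qed.

Section power.
Variables (B : V -> V) (mu : nat -> R).
Hypothesis Bsa : adjoints s B B.
Hypothesis B0 : forall x, 0 <= complex.Re (s x (B x)).
Hypothesis Bmu : forall k, B (e k) = (mu k)%:C *: e k.
Hypothesis mu0 : forall k, 0 <= mu k.
Hypothesis BT : forall d, 0 < d -> exists2 D, 0 <= D & forall x,
  complex.Re (s x (B x)) <= d * sn s x ^+ 2 + D * sn s (T x) ^+ 2.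
Hypothesis sg0 : forall d, 0 < d -> exists n, sg n <= d.

Lemma power_sub_proj n x : complex.Re (s x (B x)) =
  \sum_(i < n) mu i * nr (s (e i) x) ^+ 2 +
  complex.Re (s (x - proj s e n x) (B (x - proj s e n x))).
Proof.
have Bl : linear B := adjoints_linear sd Bsa.
set r := x - _; have xE : x = proj s e n x + r by rewrite /r addrC subrK.
have BpE : B (proj s e n x) = \sum_(i < n) (s (e i) x * (mu i)%:C) *: e i.
  by rewrite (linear_comb _ _ _ _ Bl); apply: eq_bigr => i _; rewrite Bmu scalerA.
have rp : s r (B (proj s e n x)) = 0.
  apply: sip_eq0_sym; rewrite BpE sip_suml big1// => i _.
  by rewrite sipZl dot_sub_proj// mulr0.
rewrite [in LHS]xE (linD _ _ Bl) sipDl !sipDr rp.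
rewrite -[s (proj _ _ _ _) (B r)]Bsa (sip_eq0_sym rp) addr0 add0r ReD; congr (_ + _).
rewrite BpE sip_suml Re_sum; apply: eq_bigr => i _.
rewrite sipZl (@onf_dot_sum _ _ s _ eo n i (fun i => s (e i) x * (mu i)%:C))//.
rewrite mulrAC [_ * s (e i) (e i)]mulrC (onf_dotK eo) mulrA nr_conjM.
by rewrite -rmorphM/= mulrC.
Qed.

(** In the application B is |T|^p. The remainder r is orthogonal to the first n singular vectors, so
    |T r| <= sg n |r|, and [BT] turns this into smallness of <r, B r>. *)
Lemma power_series x : ((complex.Re (s x (B x)))%:E =
  \sum_(k <oo) (mu k * nr (s (e k) x) ^+ 2)%:E)%E.
Proof.
have [_ _ hT] := Te.
apply/esym/cvg_lim => //.
have -> : (fun n => \sum_(0 <= k < n) (mu k * nr (s (e k) x) ^+ 2)%:E)%E =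
    EFin \o (fun n => \sum_(i < n) mu i * nr (s (e i) x) ^+ 2).
  by apply/funext => n /=; rewrite sumEFin big_mkord.
apply: cvg_EFin; first by near=> n.
rewrite /= ; apply/cvgrPdist_le => d d0.
pose y := sn s x ^+ 2; have y0 : 0 <= y by rewrite exprn_ge0.
have [|D D0 hD] := BT (d := d / 2 / (y + 1)); first by rewrite !divr_gt0// ltr_wpDl.
have [|N hN] := sg0 (d := Num.min 1 (d / 2 / (D * y + 1))).
  by rewrite lt_min ltr01 !divr_gt0// ltr_wpDl// mulr_ge0.
exists N => // n /= Nn; rewrite (power_sub_proj n x) addrAC subrr add0r.
set r := x - _; have ry : sn s r ^+ 2 <= y.
  by rewrite lerXn2r ?nnegrE//; exact: sn_sub_proj_le.
rewrite ger0_norm; last exact: B0.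
apply: le_trans (hD r) _; rewrite [leRHS]splitr lerD//.
  rewrite mulrAC ler_pdivrMr ?ltr_wpDl//.
  apply: ler_wpM2l; first by rewrite divr_ge0 ?(ltW d0).
  by apply: le_trans ry _; rewrite lerDl.
have h1 : sn s (T r) <= sg n * sn s r by apply: hT => i ni; exact: dot_sub_proj.
have h2 : sg n <= Num.min 1 (d / 2 / (D * y + 1)) by apply: le_trans hN; exact: svd_le_anti.
have h3 : sg n ^+ 2 <= d / 2 / (D * y + 1).
  move: h2; rewrite le_min => /andP[a1 a2]; apply: le_trans a2.
  by rewrite expr2 ler_piMl.
have h4 : sn s (T r) ^+ 2 <= d / 2 / (D * y + 1) * y.
  apply: (@le_trans _ _ ((sg n * sn s r) ^+ 2)); first by rewrite lerXn2r ?nnegrE ?mulr_ge0.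
  by rewrite exprMn ler_pM ?exprn_ge0.
apply: le_trans (ler_wpM2l D0 h4) _.
rewrite mulrCA mulrAC ler_pdivrMr; last by rewrite ltr_wpDl// mulr_ge0.
by rewrite ler_wpM2l ?divr_ge0 ?(ltW d0)// lerDl.
Unshelve. all: by end_near. Qed.

End power.
End svd_theory.

(** * Traces *)

Section esum_facts.
Variable R : realType.

Lemma esum_exchange (I J : choiceType) (X : set I) (Y : set J) (a : I -> J -> \bar R) :
  (forall i j, (0 <= a i j)%E) ->
  (\esum_(i in X) \esum_(j in Y) a i j = \esum_(j in Y) \esum_(i in X) a i j)%E.
Proof.
move=> a0; rewrite !esum_esum//.
rewrite [LHS](@reindex_esum _ _ _ (Y `*`` fun=> X) _ (fun k => (k.2, k.1)))//.
split=> [[i j] [/= ? ?]|[i j] [i' j'] _ _ [-> ->]|[i j] [/= Xi Yj]] //.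
by exists (j, i).
Qed.

Lemma esum_le_list (I : choiceType) (X : set I) (f : I -> R) (M : R) :
  (forall r : seq I, uniq r -> (forall y, y \in r -> X y) -> \sum_(y <- r) f y <= M) ->
  (\esum_(y in X) (f y)%:E <= M%:E)%E.
Proof.
move=> h; apply: ge_ereal_sup => _ [/= F [finF FX] <-].
rewrite fsbig_finite// sumEFin lee_fin; apply: h; first exact: finmap.fset_uniq.
by move=> y; rewrite in_fset_set// inE => /FX.
Qed.

Lemma esum_ge_list (I : choiceType) (X : set I) (f : I -> R) (r : seq I) :
  uniq r -> (forall y, y \in r -> X y) ->
  ((\sum_(y <- r) f y)%:E <= \esum_(y in X) (f y)%:E)%E.
Proof.
move=> ur rX; apply: esum_ge; exists [set` r]; first by split.
by rewrite -fsbig_seq// sumEFin.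
Qed.

Lemma esum_adherent (I : choiceType) (X : set I) (f : I -> R) (t e : R) : 0 < e ->
  (\esum_(y in X) (f y)%:E = t%:E)%E ->
  exists r : seq I, [/\ uniq r, forall y, y \in r -> X y & t - e < \sum_(y <- r) f y].
Proof.
move=> e0 h.
have : ereal_sup [set (\sum_(y \in F) (f y)%:E)%E | F in fsets X] \is a fin_num.
  by rewrite -/(esum _ _) h.
move=> /(ub_ereal_sup_adherent e0)[_ [F [finF FX] <-]].
rewrite -/(esum _ _) h fsbig_finite// sumEFin -EFinB lte_fin => hF.
exists (finmap.enum_fset (fset_set F)); split => //.
by move=> y; rewrite in_fset_set// inE => /FX.
Qed.

Lemma esum_scale (I : choiceType) (X : set I) (f : I -> R) (c t : R) : 0 <= c ->
  (forall i, 0 <= f i) -> (\esum_(y in X) (f y)%:E = t%:E)%E ->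
  (\esum_(y in X) (c * f y)%:E = (c * t)%:E)%E.
Proof.
move=> c0 f0 h; apply/eqP; rewrite eq_le; apply/andP; split.
  apply: esum_le_list => r ur rX; rewrite -mulr_sumr ler_wpM2l//.
  by rewrite -lee_fin -h; exact: esum_ge_list.
apply/lee_addgt0Pr => d d0.
have c1 : 0 < c + 1 by rewrite ltr_wpDl.
have [r [ur rX hr]] := esum_adherent (divr_gt0 d0 c1) h.
apply: (@le_trans _ _ ((\sum_(y <- r) c * f y)%:E + d%:E)%E); last first.
  by apply: leeD2r; exact: (esum_ge_list (fun y => c * f y)).
rewrite -EFinD lee_fin -mulr_sumr -lerBlDl -mulrBr.
apply: (@le_trans _ _ (c * (d / (c + 1)))); first by rewrite ler_wpM2l//; lra.
by rewrite mulrCA ler_piMr ?(ltW d0)// ler_pdivrMr// mul1r lerDl.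
Qed.

Lemma sum_CauchySchwarz (I : Type) (r : seq I) (a b : I -> R) :
  (forall i, 0 <= a i) -> (forall i, 0 <= b i) ->
  (\sum_(i <- r) a i * b i) ^+ 2 <= (\sum_(i <- r) a i ^+ 2) * \sum_(i <- r) b i ^+ 2.
Proof.
move=> a0 b0; elim: r => [|i r IH]; first by rewrite !big_nil expr0n mul0r.
rewrite !big_cons; set S := \sum_(j <- r) _ in IH *; set P := \sum_(j <- r) _ in IH *.
set Q := \sum_(j <- r) _ in IH *.
have S0 : 0 <= S by apply: sumr_ge0 => j _; exact: mulr_ge0.
have P0 : 0 <= P by apply: sumr_ge0 => j _; exact: exprn_ge0.
have Q0 : 0 <= Q by apply: sumr_ge0 => j _; exact: exprn_ge0.
have ab : 0 <= a i * b i by exact: mulr_ge0.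
have key : 2 * (S * (a i * b i)) <= P * b i ^+ 2 + Q * a i ^+ 2.
  have PQ : 0 <= P * b i ^+ 2 + Q * a i ^+ 2.
    by rewrite addr_ge0// mulr_ge0// exprn_ge0.
  rewrite -(@ler_pXn2r _ 2) ?nnegrE// ?mulr_ge0//.
  have : (S * (a i * b i)) ^+ 2 <= P * Q * (a i * b i) ^+ 2.
    by rewrite exprMn ler_wpM2r ?exprn_ge0.
  rewrite (_ : (2 * (S * (a i * b i))) ^+ 2 = 4 * (S * (a i * b i)) ^+ 2); last by ring.
  rewrite (_ : (P * b i ^+ 2 + Q * a i ^+ 2) ^+ 2 =
    (P * b i ^+ 2 - Q * a i ^+ 2) ^+ 2 + 4 * (P * Q * (a i * b i) ^+ 2)); last by ring.
  move=> h; apply: (@le_trans _ _ (4 * (P * Q * (a i * b i) ^+ 2))).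
    by rewrite ler_pM2l.
  by rewrite lerDr sqr_ge0.
rewrite (_ : (a i * b i + S) ^+ 2 = (a i * b i) ^+ 2 + 2 * (S * (a i * b i)) + S ^+ 2); last by ring.
rewrite (_ : (a i ^+ 2 + P) * _ = (a i * b i) ^+ 2 + (P * b i ^+ 2 + Q * a i ^+ 2) + P * Q); last by ring.
have := lerD IH key; lra.
Qed.

End esum_facts.

Section orthonormal_bases.
Variables (R : realType) (H : hilbertSpace R).
Implicit Types (x y z : H) (X : set H) (r : seq H).
Local Notation s := (hs_inner H).

Definition orthonormal X := forall y z, X y -> X z -> s y z = (y == z)%:R.

Lemma exists_orthonormal_basis : exists X, orthonormal_basis (H := H) X.
Proof.
have [|X [Xo Xmax]] := @Zorn_bigcup H orthonormal.
  move=> F Fo Ft y z [A FA Ay] [B FB Bz].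
  have [AB|BA] := Ft A B FA FB; first by apply: (Fo B) => //; exact: AB.
  by apply: (Fo A) => //; exact: BA.
exists X; split => // x hx; apply: contrapT => /eqP x0.
have sx : sn s x != 0 by rewrite sn_hs nr_eq0.
pose y := ((sn s x)^-1)%:C *: x.
have sy : s y y = 1.
  rewrite sip_sqr snZ nr_real ger0_norm ?invr_ge0// mulVf// expr1n.
  by [].
have Xy z : X z -> s z y = 0.
  by move=> Xz; rewrite sipZr; have -> : s z x = 0 := hx z Xz; rewrite mulr0.
have nXy : ~ X y.
  by move=> /Xy; rewrite sy => /eqP; rewrite oner_eq0.
apply: (Xmax (y |` X)).
  split => [z Xz|]; first by right.
  by move=> /(_ y) h; apply: nXy; apply: h; left.
move=> a b [->|Xa] [->|Xb].
- by rewrite sy eqxx.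
- rewrite (sip_eq0_sym (Xy _ Xb)); case: eqP => // yb; by rewrite yb in nXy.
- rewrite Xy//; case: eqP => // yb; by rewrite -yb in nXy.
- exact: Xo.
Qed.

Variable X : set H.
Hypothesis Xo : orthonormal_basis X.

Lemma basis_orthonormal : orthonormal X.
Proof. exact: Xo.1. Qed.

Lemma basis_norm y : X y -> sn s y = 1.
Proof.
move=> Xy; apply/eqP; rewrite -(@eqrXn2 _ 2)// expr1n sn_sqr.
by rewrite basis_orthonormal// eqxx.
Qed.

Lemma onf_list r : uniq r -> (forall y, y \in r -> X y) -> onf s (nth 0 r).
Proof.
move=> ur rX; split => [i j ij|i]; last first.
  have [ri|ri] := leqP (size r) i; first by left; rewrite nth_default.
  by right; apply: basis_norm; apply: rX; rewrite mem_nth.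
have [ri|ri] := leqP (size r) i; first by rewrite nth_default// sip0l.
have [rj|rj] := leqP (size r) j; first by rewrite [nth _ _ j]nth_default// sip0r.
rewrite basis_orthonormal ?nth_uniq ?(negPf ij)//; apply: rX; exact: mem_nth.
Qed.

Definition lproj r x := \sum_(y <- r) s y x *: y.

Lemma lprojE r x : lproj r x = proj s (nth 0 r) (size r) x.
Proof. by rewrite /lproj /proj (big_nth 0) big_mkord. Qed.

Lemma lsum_sqrE r x : \sum_(y <- r) nr (s y x) ^+ 2 =
  \sum_(i < size r) nr (s (nth 0 r i) x) ^+ 2.
Proof. by rewrite (big_nth 0) big_mkord. Qed.

Lemma dot_sub_lproj r x y : uniq r -> (forall y, y \in r -> X y) -> y \in r ->
  s y (x - lproj r x) = 0.
Proof.
move=> ur rX yr; rewrite lprojE -(nth_index 0 yr).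
by apply: dot_sub_proj; [exact: onf_list|rewrite index_mem].
Qed.

Lemma sn_sub_lproj r x : uniq r -> (forall y, y \in r -> X y) ->
  sn s x ^+ 2 = \sum_(y <- r) nr (s y x) ^+ 2 + sn s (x - lproj r x) ^+ 2.
Proof. by move=> ur rX; rewrite lsum_sqrE lprojE; apply: sn_sub_proj; exact: onf_list. Qed.

Lemma lproj_extend r q x : uniq r -> uniq q -> (forall y, y \in q -> X y) ->
  {subset r <= q} -> sn s (x - lproj r x) ^+ 2 =
    sn s (x - lproj q x) ^+ 2 + sn s (lproj q x - lproj r x) ^+ 2.
Proof.
move=> ur uq qX rq; rewrite -Pythagoras; first by rewrite addrA subrK.
apply: sip_eq0_sym; rewrite sipBl.
have h t : {subset t <= q} -> s (lproj t x) (x - lproj q x) = 0.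
  move=> tq; rewrite sip_suml big_seq big1// => y /tq yq.
  by rewrite sipZl dot_sub_lproj// mulr0.
by rewrite !h// subrr.
Qed.

(** Totality of X says only that no non-zero vector is orthogonal to it. Enlarging a list that
    almost minimises the distance to x hardly moves the projection, so such projections are Cauchy,
    and x minus their limit is orthogonal to X. *)
Lemma basis_approx x (d : R) : 0 < d -> exists r,
  [/\ uniq r, forall y, y \in r -> X y & sn s (x - lproj r x) <= d].
Proof.
move=> d0.
pose W := [set t | exists r, [/\ uniq r, forall y, y \in r -> X y & t = sn s (x - lproj r x) ^+ 2]].
have Wlb : lbound W 0 by move=> _ [r [_ _ ->]]; exact: exprn_ge0.
have W0 : W !=set0 by exists (sn s (x - lproj [::] x) ^+ 2), [::].
have infW : has_inf W by split => //; exists 0.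
pose m := inf W.
have mW t : W t -> m <= t by move=> Wt; apply: ge_inf => //; exists 0.
pose inv n : R := n.+1%:R^-1.
have inv0 n : 0 < inv n by rewrite invr_gt0.
have ex n : exists r, [/\ uniq r, forall y, y \in r -> X y &
    sn s (x - lproj r x) ^+ 2 < m + inv n].
  by have [_ [r [ur rX ->]] h] := inf_adherent (inv0 n) infW; exists r.
have [F hF] := choice ex.
have Kdist n q : uniq q -> (forall y, y \in q -> X y) -> {subset F n <= q} ->
    sn s (lproj q x - lproj (F n) x) ^+ 2 <= inv n.
  move=> uq qX Fq; have [uF FX hn] := hF n.
  have := lproj_extend x uF uq qX Fq.
  have : m <= sn s (x - lproj q x) ^+ 2 by apply: mW; exists q.
  lra.
have undX a b y : (forall y, y \in a -> X y) -> (forall y, y \in b -> X y) ->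
    y \in undup (a ++ b) -> X y.
  by move=> ha hb; rewrite mem_undup mem_cat => /orP[/ha|/hb].
have undl a b : {subset a <= undup (a ++ b)}.
  by move=> y ya; rewrite mem_undup mem_cat ya.
have undr a b : {subset b <= undup (a ++ b)}.
  by move=> y yb; rewrite mem_undup mem_cat yb orbT.
have [z hz] : exists z, forall e : R, 0 < e ->
    exists N, forall n, (N <= n)%N -> sn s (lproj (F n) x - z) <= e.
  apply: hs_complete => e e0.
  have [N hN] := natSinv_small (e := (e / 2) ^+ 2) ltac:(by rewrite exprn_gt0// divr_gt0).
  exists N => i j Ni Nj; pose q := undup (F i ++ F j).
  have [ui Xi _] := hF i; have [uj Xj _] := hF j.
  have hi : sn s (lproj q x - lproj (F i) x) <= e / 2.
    rewrite -(@ler_pXn2r _ 2) ?nnegrE ?divr_ge0 ?(ltW e0)//; apply: le_trans (hN _ Ni).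
    by apply: Kdist => //; [exact: undup_uniq|move=> y; exact: undX|exact: undl].
  have hj : sn s (lproj q x - lproj (F j) x) <= e / 2.
    rewrite -(@ler_pXn2r _ 2) ?nnegrE ?divr_ge0 ?(ltW e0)//; apply: le_trans (hN _ Nj).
    by apply: Kdist => //; [exact: undup_uniq|move=> y; exact: undX|exact: undr].
  rewrite -(subrK (lproj q x) (lproj (F i) x)) -addrA (le_trans (ler_snD _ _ _))//.
  by rewrite snBC [leRHS]splitr lerD.
have xz : x - z = 0.
  apply: Xo.2 => y Xy; change (s y (x - z) = 0).
  apply/eqP; rewrite -nr_eq0 eq_le nr_ge0 andbT; apply/ler_addgt0Pr => e e0; rewrite add0r.
  have [N1 hN1] := natSinv_small (e := (e / 2) ^+ 2) ltac:(by rewrite exprn_gt0// divr_gt0).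
  have [N2 hN2] := hz (e / 2) ltac:(by rewrite divr_gt0).
  pose n := maxn N1 N2; pose q := undup (F n ++ [:: y]).
  have [un Xn _] := hF n.
  have qX t : t \in q -> X t.
    by apply: undX => // w; rewrite inE => /eqP ->.
  have -> : s y (x - z) = s y (lproj q x - lproj (F n) x) + s y (lproj (F n) x - z).
    rewrite -sipDr addrA subrK; have := @dot_sub_lproj q x y (undup_uniq _) qX.
    rewrite undr ?inE// => /(_ isT) h.
    have -> : x - z = (x - lproj q x) + (lproj q x - z) by rewrite addrA subrK.
    by rewrite sipDr h add0r.
  rewrite (le_trans (ler_nrD _ _))// [leRHS]splitr lerD//.
    rewrite (le_trans (CauchySchwarz _ _ _))// basis_norm// mul1r.
    rewrite -(@ler_pXn2r _ 2) ?nnegrE ?divr_ge0 ?(ltW e0)//.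
    apply: (le_trans _ (hN1 n (leq_maxl _ _))).
    by apply: Kdist => //; [exact: undup_uniq|exact: undl].
  rewrite (le_trans (CauchySchwarz _ _ _))// basis_norm// mul1r.
  exact: hN2 (leq_maxr _ _).
have [N hN] := hz d d0; have [uN XN _] := hF N.
have xz' : x = z by apply/eqP; rewrite -subr_eq0; apply/eqP.
by exists (F N); split => //; rewrite {1}xz' snBC; exact: hN.
Qed.

Lemma Parseval x : (\esum_(y in X) (nr (s y x) ^+ 2)%:E = (sn s x ^+ 2)%:E)%E.
Proof.
apply/eqP; rewrite eq_le; apply/andP; split.
  apply: esum_le_list => r ur rX; rewrite (sn_sub_lproj x ur rX) lerDl exprn_ge0//.
apply/lee_addgt0Pr => d d0.
have [r [ur rX hr]] := @basis_approx x (Num.sqrt d) ltac:(by rewrite sqrtr_gt0).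
have := esum_ge_list (fun y => nr (s y x) ^+ 2) ur rX => h.
apply: (@le_trans _ _ ((\sum_(y <- r) nr (s y x) ^+ 2)%:E + d%:E)%E); last exact: leeD2r.
rewrite -EFinD lee_fin (sn_sub_lproj x ur rX) lerD2l.
by rewrite -[leRHS](sqr_sqrtr (ltW d0)) lerXn2r ?nnegrE ?sqrtr_ge0.
Qed.

End orthonormal_bases.

Section traces.
Variables (R : realType) (H : hilbertSpace R).
Implicit Types (x y z : H) (r : seq H).
Local Notation s := (hs_inner H).

Let X : set H := xget set0 (@orthonormal_basis R H).

Let Xo : orthonormal_basis X.
Proof. by have [Y hY] := exists_orthonormal_basis H; exact: (xgetPex set0 (ex_intro _ Y hY)). Qed.

Section positive.
Variable B : H -> H.
Hypothesis Bsa : adjoints s B B.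
Hypothesis B0 : forall x, 0 <= complex.Re (s x (B x)).

Let Bl : linear B := adjoints_linear (@hs_definite R H) Bsa.

Lemma positive_dot_linear x (a : R[i]) y z :
  s x (B (a *: y + z)) = a * s x (B y) + s x (B z).
Proof. by rewrite Bl sip_linear. Qed.

Lemma positive_dot_conj x y : (s x (B y))^* = s y (B x).
Proof. by rewrite -Bsa; exact: sip_conj. Qed.

Lemma positive_dot_ge0 x : 0 <= s x (B x).
Proof. by rewrite (selfadjoint_real Bsa) ler0c. Qed.

(** The seminorm of this form replaces the norm of the square root of B applied to a vector. *)
Definition positive_inner : semiInner H :=
  SemiInner positive_dot_linear positive_dot_conj positive_dot_ge0.

Lemma sn_positive x : sn positive_inner x ^+ 2 = complex.Re (s x (B x)).
Proof. exact: sn_sqr. Qed.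

(** Let r carry all but d of the trace, and let |x|_B be the seminorm of <x, B x>. For x orthogonal
    to r, expansion over the remaining basis vectors and Cauchy-Schwarz give |x|_B <= sqrt d |x|. *)
Lemma trace_tail (K t d : R) : 0 <= K -> bounded_by s B K -> trace B = t%:E -> 0 < d ->
  exists r, forall x, orthogonal_to s r x -> complex.Re (s x (B x)) <= d * sn s x ^+ 2.
Proof.
move=> K0 BK Bt d0; have [r [ur rX hr]] := esum_adherent d0 Bt.
exists r => x hx; rewrite -sn_positive.
have qK z : sn positive_inner z ^+ 2 <= K * sn s z ^+ 2.
  rewrite sn_positive (le_trans (Re_le_nr _))// (le_trans (CauchySchwarz _ _ _))//.
  by rewrite expr2 mulrCA ler_wpM2l.
have tailr q : uniq q -> (forall y, y \in q -> X y) -> (forall y, y \in q -> y \notin r) ->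
    \sum_(y <- q) sn positive_inner y ^+ 2 <= d.
  move=> uq qX qr.
  have urq : uniq (r ++ q).
    by rewrite cat_uniq ur uq andbT /=; apply/hasPn => y /qr.
  have rqX y : y \in r ++ q -> X y by rewrite mem_cat => /orP[/rX|/qX].
  have := esum_ge_list (fun y => complex.Re (hs_dot y (B y))) urq rqX.
  rewrite -/(trace B) Bt lee_fin big_cat /= => h.
  under eq_bigr do rewrite sn_positive.
  by move: h hr; set a := \sum_(_ <- _) _; set b := \sum_(_ <- _) _; lra.
have [x0|x0] := eqVneq (sn s x) 0.
  by have := qK x; rewrite x0 expr0n !mulr0.
have key (e : R) : 0 < e -> sn positive_inner x <= Num.sqrt d * sn s x + Num.sqrt K * e.
  move=> e0; have [q [uq qX hq]] := basis_approx Xo x e0.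
  have sqK z : sn positive_inner z <= Num.sqrt K * sn s z.
    rewrite -(@ler_pXn2r _ 2) ?nnegrE ?mulr_ge0 ?sqrtr_ge0//.
    by rewrite exprMn sqr_sqrtr// qK.
  apply: le_trans (ler_sn_dist _ x (lproj q x)) _; rewrite lerD//; last first.
    by apply: le_trans (sqK _) _; rewrite ler_wpM2l ?sqrtr_ge0.
  have -> : lproj q x = \sum_(y <- [seq y <- q | y \notin r]) s y x *: y.
    rewrite /lproj big_filter [RHS]big_mkcond /=; apply: eq_bigr => y _.
    by case: ifPn => // /negPn yr; have -> : hs_dot y x = 0 := hx y yr; rewrite scale0r.
  set q' := [seq y <- q | _].
  have uq' : uniq q' by exact: filter_uniq.
  have q'X y : y \in q' -> X y by rewrite mem_filter => /andP[_ /qX].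
  have q'r y : y \in q' -> y \notin r by rewrite mem_filter => /andP[].
  apply: le_trans (sn_sum _ _ _ _) _.
  under eq_bigr do rewrite snZ.
  rewrite -(@ler_pXn2r _ 2) ?nnegrE ?mulr_ge0 ?sqrtr_ge0//; last first.
    by apply: sumr_ge0 => y _; exact: mulr_ge0.
  apply: le_trans (sum_CauchySchwarz _ _ _) _ => //.
  rewrite exprMn sqr_sqrtr ?(ltW d0)// mulrC ler_pM//.
  - by apply: sumr_ge0 => y _; exact: exprn_ge0.
  - by apply: sumr_ge0 => y _; exact: exprn_ge0.
  - exact: tailr.
  - by rewrite (sn_sub_lproj Xo x uq' q'X) lerDl exprn_ge0.
have hd : sn positive_inner x <= Num.sqrt d * sn s x.
  apply/ler_addgt0Pr => e e0.
  have K1 : 0 < Num.sqrt K + 1 by rewrite ltr_wpDl ?sqrtr_ge0.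
  apply: le_trans (key (e / (Num.sqrt K + 1)) _) _; first by rewrite divr_gt0.
  by rewrite lerD2l mulrCA ler_piMr ?(ltW e0)// ler_pdivrMr// mul1r lerDl.
apply: (@le_trans _ _ ((Num.sqrt d * sn s x) ^+ 2)).
  by rewrite lerXn2r ?nnegrE ?mulr_ge0 ?sqrtr_ge0.
by rewrite exprMn sqr_sqrtr ?(ltW d0).
Qed.

End positive.

Variables (T T' : H -> H) (C p : R).
Hypothesis TT' : adjoints s T T'.
Hypothesis C0 : 0 <= C.
Hypothesis TC : bounded_by s T C.
Hypothesis p1 : 1 <= p.

Lemma trace_finite_compact (t : R) : trace (op_abs_powR T p) = t%:E -> compact_op s T.
Proof.
move=> Bt e e0; have [Bsa [K K0 BK] B0 _ hD] := op_abs_powR_spec TT' TC p1.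
have e20 : 0 < e ^+ 2 / 2 by rewrite divr_gt0// exprn_gt0.
have [D D0 {}hD] := hD _ e20.
have [|r hr] := trace_tail Bsa B0 K0 BK Bt (d := e ^+ 2 / 2 / (D + 1)).
  by rewrite divr_gt0// ltr_wpDl.
exists (size r), r => // x /hr hx.
rewrite -(@ler_pXn2r _ 2) ?nnegrE ?mulr_ge0 ?(ltW e0)// exprMn.
apply: le_trans (hD x).1 _.
have -> : e ^+ 2 * sn s x ^+ 2 = e ^+ 2 / 2 * sn s x ^+ 2 + e ^+ 2 / 2 * sn s x ^+ 2 by field.
rewrite lerD2l; apply: le_trans (ler_wpM2l D0 hx) _.
rewrite mulrA ler_wpM2r ?exprn_ge0// mulrC mulrAC ler_pdivrMr ?ltr_wpDl//.
by rewrite ler_wpM2l ?(ltW e20)// lerDl.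
Qed.

(** Expanding <y, |T|^p y> along the singular vectors gives a double sum of non-negative terms.
    Exchanging it leaves a Parseval sum for every singular vector, so the basis chosen in [trace]
    does not matter. *)
Lemma trace_gelfand : compact_op s T ->
  trace (op_abs_powR T p) = (\sum_(k <oo) (gelfand s T k `^ p)%:E)%E.
Proof.
move=> Tc; have [Bsa [K K0 BK] B0 Beig hD] := op_abs_powR_spec TT' TC p1.
set B := op_abs_powR T p in Bsa BK B0 Beig hD *.
have [e Te] := exists_svd (@hs_definite R H) TT' C0 TC Tc (@hs_complete R H).
have [eo eig _] := Te.
pose mu k := gelfand s T k `^ p.
have gE k : gelfand s T k = sn s (T (e k)) := svd_gelfand (@hs_definite R H) TT' Te k.
have p0 : p != 0 by rewrite gt_eqF// (lt_le_trans ltr01).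
have Bmu k : B (e k) = (mu k)%:C *: e k by rewrite /mu gE; apply: Beig => //; exact: eig.
have mu0 k : 0 <= mu k by exact: powR_ge0.
have BT d : 0 < d -> exists2 D, 0 <= D & forall x,
    complex.Re (s x (B x)) <= d * sn s x ^+ 2 + D * sn s (T x) ^+ 2.
  by move=> /hD[D D0 h]; exists D => // x; have [] := h x.
have sg0 d : 0 < d -> exists n, sn s (T (e n)) <= d.
  move=> d0; have [k hk] := Tc d d0; exists k.
  exact: (svd_gelfand_ge (@hs_definite R H) TT' Te (ltW d0) hk).
rewrite /trace -/X.
have tE y : ((complex.Re (hs_dot y (B y)))%:E =
    \esum_(k in [set: nat]) (mu k * nr (s (e k) y) ^+ 2)%:E)%E.
  rewrite -nneseries_esumT; last by move=> k; rewrite lee_fin mulr_ge0// exprn_ge0.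
  exact: (power_series (@hs_definite R H) Te Bsa B0 Bmu BT sg0).
rewrite (eq_esum (fun y _ => tE y)) esum_exchange; last first.
  by move=> i j; rewrite lee_fin mulr_ge0// exprn_ge0.
rewrite nneseries_esumT; last by move=> k; rewrite lee_fin powR_ge0.
apply: eq_esum => k _.
have muE : mu k * sn s (e k) ^+ 2 = mu k.
  have [[_ h]|->] := svd_null_or (@hs_definite R H) TT' Te k; last by rewrite expr1n mulr1.
  by rewrite /mu gE h powR0// mul0r.
rewrite -[gelfand s T k `^ p]/(mu k) -[in RHS]muE; apply: esum_scale => //.
  by move=> y; rewrite exprn_ge0.
rewrite -(Parseval Xo (e k)); apply: eq_esum => y _.
by rewrite -(sip_conj s y) nr_conj.
Qed.

End traces.

(** * Characters of commutative C*-algebras *)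

Lemma exp_small (R : realType) (r e : R) : 0 <= r -> r < 1 -> 0 < e ->
  exists N, forall n, (N <= n)%N -> r ^+ n <= e.
Proof.
move=> r0 r1 e0; have : r ^+ n @[n --> \oo] --> (0 : R) by apply: cvg_expr; rewrite ger0_norm.
move=> /cvgrPdist_le/(_ e e0)[N _ hN]; exists N => n Nn.
by have := hN n Nn; rewrite sub0r normrN ger0_norm// exprn_ge0.
Qed.

Section Gelfand_Mazur.
Variable R : realType.
Implicit Types (q r : {poly R[i]}) (z : R[i]).
Variable nu : {poly R[i]} -> R.
Hypothesis nu_ge0 : forall q, 0 <= nu q.
Hypothesis nuM : forall q r, nu (q * r) = nu q * nu r.
Hypothesis nuD : forall q r, nu (q + r) <= nu q + nu r.
Hypothesis nuC : forall z, nu z%:P = nr z.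
Hypothesis nu_Re : forall z, nu ('X - (complex.Re z)%:C%:P) <= nu ('X - z%:P).

Let nuN q : nu (- q) = nu q.
Proof. by rewrite -mulN1r nuM -polyCN nuC nrN nr1 mul1r. Qed.

Let g (a : R) := nu ('X - a%:C%:P).

Let g_lip a b : g a <= g b + `|a - b|.
Proof.
rewrite -nr_real -nuC /g.
have -> : 'X - a%:C%:P = ('X - b%:C%:P) + - ((a - b)%:C)%:P.
  by rewrite rmorphB polyCB; ring.
by rewrite (le_trans (nuD _ _))// nuN.
Qed.

Let g_ge a : `|a| - nu 'X <= g a.
Proof.
rewrite lerBlDl -nr_real -nuC.
have -> : (a%:C)%:P = 'X + - ('X - a%:C%:P) :> {poly R[i]} by ring.
by rewrite (le_trans (nuD _ _))// nuN.
Qed.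

(** A form of Gelfand-Mazur without holomorphic functions: if g had a positive minimum m, it would
    be attained again at distance m / 2 to the right, and so on to infinity, where g is unbounded.
    By [nu_Re] the minimum over the real line bounds all complex shifts too. *)
Lemma multiplicative_seminorm_root : exists a : R, nu ('X - a%:C%:P) = 0.
Proof.
have gc : continuous g.
  move=> a; apply/cvgrPdist_le => e e0; near=> b.
  have ab : `|a - b| <= e by near: b; move/cvgrPdist_le : (@cvg_id _ (nbhs a)); apply.
  have := g_lip a b; have := g_lip b a; rewrite (distrC b a) ler_norml; lra.
(* Beyond K the lower bound |a| - nu X exceeds g 0 = nu X, so a minimum on [-K, K] is global. *)
pose K := 2 * nu 'X + 1; have K0 : 0 <= K by rewrite addr_ge0 ?mulr_ge0.
have KK : - K <= K by rewrite (le_trans _ K0)// oppr_le0.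
have [c cK cmin] := @EVT_min R g (- K) K KK (continuous_subspaceT gc).
set m := g c.
have mmin a : m <= g a.
  have [aK|aK] := leP `|a| K; first by apply: cmin; rewrite in_itv /= -ler_norml.
  have h0 : m <= g 0 by apply: cmin; rewrite in_itv /= oppr_le0 K0.
  have := g_ge a; have : g 0 = nu 'X by rewrite /g rmorph0 subr0.
  by have := nu_ge0 'X; move: aK; rewrite /K; lra.
have m0 : 0 <= m by exact: nu_ge0.
exists c; rewrite -/(g c) -/m; apply: contrapT => /eqP mn0.
have mp : 0 < m by rewrite lt0r mn0.
have step b : g b = m -> g (b + m / 2) = m.
  move=> gb; apply/eqP; rewrite eq_le mmin andbT.
  pose y : {poly R[i]} := 'X - b%:C%:P.
  have ym z : m <= nu (y - z%:P).
    have -> : y - z%:P = 'X - (b%:C + z)%:P by rewrite /y polyCD; ring.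
    exact: le_trans (mmin _) (nu_Re _).
  (* Repeated square roots split the polynomial into 2^k factors y - w, each of size at least m. *)
  have ypow k z : m ^+ (2 ^ k) <= nu (y ^+ (2 ^ k) - z%:P).
    elim: k z => [|k IH] z; first by rewrite expn0 !expr1.
    have -> : y ^+ (2 ^ k.+1) - z%:P =
        (y ^+ (2 ^ k) - (sqrtC z)%:P) * (y ^+ (2 ^ k) - (- sqrtC z)%:P).
      by rewrite expnS mulnC exprM -{1}(sqrtCK z) polyC_exp subr_sqr polyCN opprK.
    by rewrite nuM expnS mulnC exprM expr2 ler_pM ?exprn_ge0.
  pose t : R := m / 2; have t0 : 0 <= t by rewrite divr_ge0.
  (* The factor y - t is kept, and the other 2^k - 1 factors are bounded below by m. With the upper
     bound m^(2^k) + t^(2^k) and t < m this forces nu (y - t) <= m in the limit. *)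
  have ytp k : nu (y - t%:C%:P) * m ^+ (2 ^ k).-1 <= nu (y ^+ (2 ^ k) - ((t ^+ (2 ^ k))%:C)%:P).
    elim: k => [|k IH]; first by rewrite expn0 !expr1 expr0 mulr1.
    have -> : y ^+ (2 ^ k.+1) - ((t ^+ (2 ^ k.+1))%:C)%:P =
        (y ^+ (2 ^ k) - ((t ^+ (2 ^ k))%:C)%:P) * (y ^+ (2 ^ k) - (- (t ^+ (2 ^ k))%:C)%:P).
      by rewrite expnS mulnC !exprM [(_ ^+ 2)%:C]rmorphXn polyC_exp subr_sqr polyCN opprK.
    have -> : (2 ^ k.+1).-1 = ((2 ^ k).-1 + 2 ^ k)%N.
      by rewrite expnS mul2n -addnn -subn1 -subn1 addnBAC// expn_gt0.
    by rewrite nuM exprD mulrA ler_pM ?mulr_ge0 ?exprn_ge0.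
  have yup k : nu (y ^+ (2 ^ k) - ((t ^+ (2 ^ k))%:C)%:P) <= m ^+ (2 ^ k) + t ^+ (2 ^ k).
    apply: le_trans (nuD _ _) _; rewrite nuN nuC nr_real ger0_norm ?exprn_ge0// lerD2r.
    elim: (2 ^ k)%N => [|n IH]; first by rewrite !expr0 nuC nr1.
    by rewrite !exprS nuM ler_pM// -gb.
  rewrite /g rmorphD polyCD opprD addrA -/y -/t.
  apply/ler_addgt0Pr => e e0.
  have [N hN] := @exp_small R 2^-1 (e / m) ltac:(by []) ltac:(by rewrite invf_lt1// ltr1n) ltac:(by rewrite divr_gt0).
  have := le_trans (ytp N) (yup N).
  have -> : t ^+ (2 ^ N) = m ^+ (2 ^ N) * 2^-1 ^+ (2 ^ N) by rewrite -exprMn.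
  have -> : m ^+ (2 ^ N) = m * m ^+ (2 ^ N).-1 by rewrite -exprS prednK// expn_gt0.
  have mN : 0 < m ^+ (2 ^ N).-1 by exact: exprn_gt0.
  have -> : m * m ^+ (2 ^ N).-1 + m * m ^+ (2 ^ N).-1 * 2^-1 ^+ (2 ^ N) =
    (m + m * 2^-1 ^+ (2 ^ N)) * m ^+ (2 ^ N).-1 by ring.
  rewrite ler_pM2r// => h; apply: le_trans h _; rewrite lerD2l -ler_pdivlMl// mulrC.
  by apply: hN; rewrite ltnW// ltn_expl.
have all_m n : g (c + n%:R * (m / 2)) = m.
  elim: n => [|n IH]; first by rewrite mul0r addr0.
  by rewrite -natr1 mulrDl mul1r addrA step.
pose B := (m + nu 'X + `|c|) / (m / 2).
have m2 : 0 < m / 2 by rewrite divr_gt0.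
have [n Bn] : exists n : nat, B < n%:R.
  by have [n _ hn] := nbhs_infty_gtr B; exists n; apply: hn => /=.
have := g_ge (c + n%:R * (m / 2)); rewrite all_m.
move: Bn; rewrite /B ltr_pdivrMr// => Bn.
have := ler_norm (c + n%:R * (m / 2)); have := ler_norm (- c); rewrite normrN.
lra.
Unshelve. all: by end_near. Qed.

End Gelfand_Mazur.

(** * C*-seminorms and their infima *)

Section directed_infimum.
Variables (R : realType) (I : Type) (i0 : I).
Implicit Types (u v w : I -> R).

(** Serves two constructions: the limit of the decreasing power ratios and the lower bound of a
    chain of seminorms. *)
Definition infi u := inf (range u).

Lemma infi_le u : (forall i, 0 <= u i) -> forall i, infi u <= u i.
Proof. by move=> u0 i; apply: ge_inf; [exists 0 => _ [j _ <-]|exists i]. Qed.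

Lemma infi_ge u c : (forall i, c <= u i) -> c <= infi u.
Proof. by move=> h; apply: lb_le_inf => [|_ [i _ <-]]; [exists (u i0), i0|exact: h]. Qed.

Lemma infi_ge0 u : (forall i, 0 <= u i) -> 0 <= infi u.
Proof. exact: infi_ge. Qed.

Lemma infi_adherent u e : (forall i, 0 <= u i) -> 0 < e -> exists i, u i < infi u + e.
Proof.
move=> u0 e0; have [_ [i _ <-] h] : exists2 t, range u t & t < infi u + e.
  apply: inf_adherent => //; split; first by exists (u i0), i0.
  by exists 0 => _ [j _ <-].
by exists i.
Qed.

Lemma infi_scale u v c : 0 <= c -> (forall i, 0 <= u i) -> (forall i, 0 <= v i) ->
  (forall i, exists j, v j <= c * u i) -> (forall i, exists j, c * u j <= v i) ->
  infi v = c * infi u.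
Proof.
move=> c0 u0 v0 vu uv; apply/eqP; rewrite eq_le; apply/andP; split; last first.
  apply: infi_ge => i; have [j] := uv i; apply: le_trans.
  by rewrite ler_wpM2l// infi_le.
apply/ler_addgt0Pr => e e0.
have c1 : 0 < c + 1 by rewrite ltr_wpDl.
have [i hi] := infi_adherent u0 (divr_gt0 e0 c1).
have [j hj] := vu i; apply: le_trans (infi_le v0 j) _; apply: le_trans hj _.
apply: le_trans (ler_wpM2l c0 (ltW hi)) _; rewrite mulrDr lerD2l.
by rewrite mulrCA ler_piMr ?(ltW e0)// ler_pdivrMr// mul1r lerDl.
Qed.


End directed_infimum.

Section Cstar_seminorms.
Variables (R : realType) (A : commCstarAlgebra R).
Implicit Types (a b c f x y : A) (z : R[i]) (p q : A -> R).
Local Notation mul := (@ca_mul R A).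
Local Notation star := (@ca_star R A).

Lemma mul_linear a : linear (mul a).
Proof. by move=> z b c; exact: ca_mul_linear. Qed.

Lemma ca_mulDr a b c : mul a (b + c) = mul a b + mul a c.
Proof. by have := ca_mul_linear a 1 b c; rewrite !scale1r. Qed.

Lemma ca_mulr0 a : mul a 0 = 0.
Proof. by apply: (addrI (mul a 0)); rewrite -ca_mulDr !addr0. Qed.

Lemma ca_mulZr a z b : mul a (z *: b) = z *: mul a b.
Proof. by have := ca_mul_linear a z b 0; rewrite ca_mulr0 !addr0. Qed.

Lemma ca_mulBr a b c : mul a (b - c) = mul a b - mul a c.
Proof. by rewrite -scaleN1r ca_mulDr ca_mulZr scaleN1r. Qed.

Lemma ca_mulCA a b c : mul a (mul b c) = mul b (mul a c).
Proof. by rewrite !ca_mulA (ca_mulC a b). Qed.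

Lemma ca_starD a b : star (a + b) = star a + star b.
Proof. by have := ca_star_linear 1 a b; rewrite !scale1r rmorph1 scale1r. Qed.

Lemma ca_star0 : star 0 = 0.
Proof. by apply: (addrI (star 0)); rewrite -ca_starD !addr0. Qed.

Lemma ca_starZ z a : star (z *: a) = z^* *: star a.
Proof. by have := ca_star_linear z a 0; rewrite ca_star0 !addr0. Qed.

Lemma ca_starB a b : star (a - b) = star a - star b.
Proof. by rewrite -scaleN1r ca_starD ca_starZ rmorphN rmorph1 scaleN1r. Qed.

Lemma ca_starMC a b : star (mul a b) = mul (star a) (star b).
Proof. by rewrite ca_starM ca_mulC. Qed.

Definition Cstar_seminorm p := [/\ forall a b, p (a + b) <= p a + p b,
  forall z a, p (z *: a) = nr z * p a, forall a b, p (mul a b) <= p a * p b,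
  forall a, p (mul (star a) a) = p a ^+ 2 & forall a, p a <= nr a].

Lemma Cstar_seminorm_nr : Cstar_seminorm (@nr R A).
Proof.
split => //.
- exact: ler_nrD.
- exact: nrZ.
- by move=> a b; rewrite -lecR rmorphM/= !nrE ca_normM.
- by move=> a; apply: complexI; rewrite rmorphXn/= !nrE ca_norm_starM.
Qed.

Section one_seminorm.
Variable p : A -> R.
Hypothesis pC : Cstar_seminorm p.

Lemma seminorm0 : p 0 = 0.
Proof. by have [_ h _ _ _] := pC; rewrite -(scale0r 0) h nr0 mul0r. Qed.

Lemma seminormN a : p (- a) = p a.
Proof. by have [_ h _ _ _] := pC; rewrite -scaleN1r h nrN nr1 mul1r. Qed.

Lemma seminorm_ge0 a : 0 <= p a.
Proof.
have [h _ _ _ _] := pC; have := h a (- a).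
by rewrite subrr seminorm0 seminormN; lra.
Qed.

Lemma seminorm_star a : p (star a) = p a.
Proof.
have [_ _ hM hS _] := pC.
have le b : p b <= p (star b).
  have [->|b0] := eqVneq (p b) 0; first exact: seminorm_ge0.
  have := hM (star b) b; rewrite hS expr2 ler_pM2r// lt0r b0.
  exact: seminorm_ge0.
by apply/eqP; rewrite eq_le le andbT; have := le (star a); rewrite ca_starK.
Qed.

Lemma seminorm_sqr f : star f = f -> p (mul f f) = p f ^+ 2.
Proof. by have [_ _ _ h _] := pC; move=> ff; rewrite -h ff. Qed.

Lemma iter_mul_mul f n a b : iter n (mul f) (mul a b) = mul a (iter n (mul f) b).
Proof. by elim: n => //= n ->; rewrite ca_mulCA. Qed.

Lemma iter_mul_mull f n a b : iter n (mul f) (mul a b) = mul (iter n (mul f) a) b.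
Proof. by rewrite ca_mulC iter_mul_mul ca_mulC. Qed.

Lemma star_iter f n a : star f = f -> star (iter n (mul f) a) = iter n (mul f) (star a).
Proof. by move=> ff; elim: n => //= n IH; rewrite ca_starMC ff IH. Qed.

Lemma seminorm_iter_le f n a : p (iter n (mul f) a) <= p f ^+ n * p a.
Proof.
have [_ _ hM _ _] := pC.
elim: n => [|n IH] /=; first by rewrite mul1r.
apply: le_trans (hM _ _) _; rewrite exprS -mulrA ler_wpM2l//.
exact: seminorm_ge0.
Qed.

(** The C*-identity gives exponents that are powers of 2; submultiplicativity then leaves no room
    for a loss at smaller exponents. The iterate is f^(n + 1), written without a unit. *)
Lemma seminorm_pow f n : star f = f -> p (iter n (mul f) f) = p f ^+ n.+1.
Proof.
move=> ff; apply/eqP; rewrite eq_le exprSr seminorm_iter_le /=.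
have [->|f0] := eqVneq (p f) 0.
  by rewrite mulr0 seminorm_ge0.
have fp : 0 < p f by rewrite lt0r f0 seminorm_ge0.
have two k : p (iter (2 ^ k).-1 (mul f) f) = p f ^+ (2 ^ k).
  elim: k => [|k IH]; first by rewrite expr1.
  rewrite expnS mulnC exprM -IH -seminorm_sqr; last by rewrite star_iter// ff.
  rewrite -iter_mul_mul -iter_mul_mull -iterD; congr (p _).
  have -> : mul f f = iter 1 (mul f) f by [].
  rewrite -iterD; congr (iter _ _ _).
  have : (0 < 2 ^ k)%N by rewrite expn_gt0.
  by case: (2 ^ k)%N => // m _; rewrite muln2 doubleS /= -addnn addn1.
have n2 : (n < 2 ^ n)%N by exact: ltn_expl.
have [k kE] : exists k, (2 ^ n)%N = (k + n.+1)%N by exists (2 ^ n - n.+1)%N; rewrite subnK.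
have := two n; rewrite kE addnS /= iterD => h.
have := seminorm_iter_le f k (iter n (mul f) f); rewrite h.
by rewrite -addnS exprD ler_pM2l ?exprn_gt0// exprSr.
Qed.

End one_seminorm.

(** The members need not be C*-seminorms themselves: products and the C*-identity may be estimated
    at another index, as happens for power ratios. *)
Lemma Cstar_infi (I : Type) (i0 : I) (u : I -> A -> R) :
  (forall i x, 0 <= u i x) -> (forall i x, u i x <= nr x) ->
  (forall i z x, u i (z *: x) = nr z * u i x) ->
  (forall i j, exists k, forall x, u k x <= u i x /\ u k x <= u j x) ->
  (forall i x y, u i (x + y) <= u i x + u i y) ->
  (forall i x y, exists j, u j (mul x y) <= u i x * u i y) ->
  (forall i x, exists j, u j (mul (star x) x) <= u i x ^+ 2) ->
  (forall i x, exists j, u j x ^+ 2 <= u i (mul (star x) x)) ->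
  Cstar_seminorm (fun x => infi (u ^~ x)).
Proof.
move=> u0 u1 uZ ud uD uM uS uS'.
have near2 x y e : 0 < e -> exists i, u i x < infi (u ^~ x) + e /\ u i y < infi (u ^~ y) + e.
  move=> e0; have [i hi] := infi_adherent i0 (fun i => u0 i x) e0.
  have [j hj] := infi_adherent i0 (fun i => u0 i y) e0.
  have [k hk] := ud i j; exists k; split.
    by apply: le_lt_trans hi; have [] := hk x.
  by apply: le_lt_trans hj; have [] := hk y.
have P0 x : 0 <= infi (u ^~ x) by apply: infi_ge0.
split.
- move=> x y; apply/ler_addgt0Pr => e e0.
  have [i [hx hy]] := near2 x y (e / 2) ltac:(by rewrite divr_gt0).
  apply: le_trans (infi_le _ i) _ => //; apply: le_trans (uD _ _ _) _; lra.
- move=> z x; apply: infi_scale => // i; exists i; by rewrite uZ.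
- move=> x y; apply/ler_addgt0Pr => d d0.
  set a := infi _; set b := infi (u ^~ x); set c := infi (u ^~ y).
  pose B := b + c + 1; have B0 : 0 < B by rewrite ltr_wpDl// addr_ge0// P0.
  pose e := Num.min 1 (d / B); have e0 : 0 < e by rewrite lt_min ltr01 divr_gt0.
  have e1 : e <= 1 by rewrite /e ge_min lexx.
  have eB : e * B <= d by rewrite -ler_pdivlMr// /e ge_min lexx orbT.
  have [i [hx hy]] := near2 x y e e0; have [j hj] := uM i x y.
  apply: le_trans (infi_le _ j) _ => //; apply: le_trans hj _.
  apply: (@le_trans _ _ ((b + e) * (c + e))); first by rewrite ler_pM// ltW.
  have : e * e <= e * 1 by rewrite ler_pM2l.
  by rewrite /B in eB; have := P0 x; have := P0 y; nra.
- move=> x; apply/eqP; rewrite eq_le; apply/andP; split; last first.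
    apply: infi_ge => // i; have [j hj] := uS' i x; apply: le_trans hj.
    by rewrite lerXn2r ?nnegrE ?P0// infi_le.
  apply/ler_addgt0Pr => d d0; set b := infi (u ^~ x).
  have b0 : 0 <= b by exact: P0.
  pose B := 2 * b + 1; have B0 : 0 < B by rewrite ltr_wpDl// mulr_ge0.
  pose e := Num.min 1 (d / B); have e0 : 0 < e by rewrite lt_min ltr01 divr_gt0.
  have e1 : e <= 1 by rewrite /e ge_min lexx.
  have eB : e * B <= d by rewrite -ler_pdivlMr// /e ge_min lexx orbT.
  have [i hx] := infi_adherent i0 (fun i => u0 i x) e0; have [j hj] := uS i x.
  apply: le_trans (infi_le _ j) _ => //; apply: le_trans hj _.
  apply: (@le_trans _ _ ((b + e) ^+ 2)).
    by rewrite lerXn2r ?nnegrE ?(ltW hx) ?addr_ge0 ?(ltW e0).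
  have : e * e <= e * 1 by rewrite ler_pM2l.
  by rewrite /B in eB; rewrite sqrrD -mulr_natr; nra.
- by move=> x; apply: le_trans (infi_le _ i0) _.
Qed.

End Cstar_seminorms.

Section character_existence.
Variables (R : realType) (A : commCstarAlgebra R).
Implicit Types (a b c f x y : A) (z : R[i]) (p q : A -> R).
Local Notation mul := (@ca_mul R A).
Local Notation star := (@ca_star R A).

(** Decreasing in n by submultiplicativity; in the limit, multiplication by f becomes exact scaling
    by p f. *)
Definition power_ratio p f n x := p (iter n (mul f) x) / p f ^+ n.

Section powers.
Variables (p : A -> R) (f : A).
Hypothesis pC : Cstar_seminorm p.
Hypothesis ff : star f = f.
Hypothesis f0 : p f != 0.

Let fp : 0 < p f. Proof. by rewrite lt0r f0 (seminorm_ge0 pC). Qed.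
Local Notation u := (power_ratio p f).

Lemma power_ratio_ge0 n x : 0 <= u n x.
Proof. by rewrite divr_ge0 ?(seminorm_ge0 pC)// exprn_ge0// ltW. Qed.

Lemma power_ratio_antiS n x : u n.+1 x <= u n x.
Proof.
have [_ _ hM _ _] := pC.
rewrite /power_ratio exprS invfM mulrA ler_pM2r ?invr_gt0 ?exprn_gt0//.
by rewrite ler_pdivrMr// mulrC; exact: hM.
Qed.

Lemma power_ratio_anti m n x : (m <= n)%N -> u n x <= u m x.
Proof.
move=> /subnK <-; elim: (n - m)%N => // k IH.
by rewrite addSn (le_trans (power_ratio_antiS _ _)).
Qed.

Lemma power_ratioM n x y : u (n + n) (mul x y) <= u n x * u n y.
Proof.
have [_ _ hM _ _] := pC.
rewrite /power_ratio iterD iter_mul_mull iter_mul_mul exprD invfM mulrACA.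
by rewrite ler_wpM2r ?mulr_ge0 ?invr_ge0 ?exprn_ge0 ?(ltW fp)// hM.
Qed.

Lemma power_ratio_star n x : u (n + n) (mul (star x) x) = u n x ^+ 2.
Proof.
have [_ _ _ hS _] := pC.
rewrite /power_ratio iterD iter_mul_mull iter_mul_mul -star_iter// hS.
by rewrite exprD invfM expr_div_n [in RHS]expr2 expr2 invfM.
Qed.

Definition power_seminorm x := infi (u ^~ x).

Lemma Cstar_power : Cstar_seminorm power_seminorm.
Proof.
have [hD hZ hM hS h1] := pC.
apply: (Cstar_infi 0%N).
- exact: power_ratio_ge0.
- move=> n x; apply: le_trans (power_ratio_anti x (leq0n n)) _.
  by rewrite /power_ratio expr0 divr1 h1.
- by move=> n z x; rewrite /power_ratio (linZ _ _ (iter_linear (@mul_linear R A f) n)) hZ mulrA.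
- move=> i j; exists (maxn i j) => x.
  by split; apply: power_ratio_anti; rewrite ?leq_maxl ?leq_maxr.
- move=> n x y; rewrite /power_ratio (linD _ _ (iter_linear (@mul_linear R A f) n)) -mulrDl.
  by rewrite ler_wpM2r ?invr_ge0 ?exprn_ge0 ?(ltW fp).
- by move=> n x y; exists (n + n)%N; exact: power_ratioM.
- by move=> n x; exists (n + n)%N; rewrite power_ratio_star.
- by move=> n x; exists n; rewrite -power_ratio_star power_ratio_anti// leq_addr.
Qed.

Lemma power_seminorm_le x : power_seminorm x <= p x.
Proof.
apply: le_trans (infi_le (fun n => power_ratio_ge0 n x) 0%N) _.
by rewrite /power_ratio expr0 divr1.
Qed.

Lemma power_seminorm_mul x : power_seminorm (mul f x) = p f * power_seminorm x.
Proof.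
have E n : u n (mul f x) = p f * u n.+1 x.
  by rewrite /power_ratio -iterSr exprS invfM [RHS]mulrCA mulVKf.
apply: (infi_scale 0%N); [exact: ltW|move=> n; exact: power_ratio_ge0..| |].
- by move=> n; exists n; rewrite E ler_pM2l// power_ratio_antiS.
- by move=> n; exists n.+1; rewrite E.
Qed.

Lemma power_seminorm_scale b (r : R) : 0 <= r -> (forall x, p (mul b x) = r * p x) ->
  forall x, power_seminorm (mul b x) = r * power_seminorm x.
Proof.
move=> r0 h x; have E n : u n (mul b x) = r * u n x.
  by rewrite /power_ratio iter_mul_mul h mulrA.
by apply: (infi_scale 0%N) => // n; rewrite ?power_ratio_ge0//; exists n; rewrite E.
Qed.

Lemma power_seminorm_cst x (r : R) : (forall n, p (iter n (mul f) x) = r * p f ^+ n) ->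
  power_seminorm x = r.
Proof.
move=> h; have E n : u n x = r by rewrite /power_ratio h mulfK// expf_neq0.
apply/eqP; rewrite eq_le -{1}(E 0%N) infi_le/=; last by move=> n; exact: power_ratio_ge0.
by apply: (infi_ge 0%N) => n; rewrite E.
Qed.

End powers.

Variable v : A.
Hypothesis vv : star v = v.
Hypothesis v0 : v != 0.

Let nv : 0 < nr v. Proof. by rewrite lt0r nr_eq0 v0 nr_ge0. Qed.

(** The third clause keeps the value at v when p is replaced by its power seminorm along f, since it
    evaluates p (f^n v). *)
Definition peaked p := [/\ Cstar_seminorm p, p v = nr v & forall x, p (mul v x) = nr v * p x].

Lemma exists_peaked : exists p, peaked p.
Proof.
have nC := Cstar_seminorm_nr A.
have nv0 : nr v != 0 by rewrite gt_eqF.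
exists (power_seminorm (@nr R A) v); split.
- exact: Cstar_power.
- by apply: power_seminorm_cst => // n; rewrite (seminorm_pow nC)// exprS.
- exact: power_seminorm_mul.
Qed.

Lemma exists_minimal_peaked : exists p, peaked p /\
  forall q, peaked q -> (forall x, q x <= p x) -> q = p.
Proof.
pose T := {p | peaked p}.
(* The order is reversed, so that Zorn's maximal element is a minimal seminorm. *)
pose le (p q : T) := `[< forall x, sval q x <= sval p x >].
have [p0 hp0] := exists_peaked.
have [||||[p hp] pmin] := @Zorn T le.
- by move=> p; apply/asboolP.
- move=> p q r /asboolP h1 /asboolP h2; apply/asboolP => x; exact: le_trans (h2 x) (h1 x).
- move=> [p hp] [q hq] /asboolP/= h1 /asboolP/= h2; apply: eq_exist => /=.
  by apply/funext => x; apply/eqP; rewrite eq_le h1 h2.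
- move=> C Ct; have [[c0 Cc0]|C0] := pselect (exists t : T, C t); last first.
    by exists (exist _ p0 hp0) => s Cs; exfalso; apply: C0; exists s.
  pose I := {c : T | C c}; pose i0 : I := exist _ c0 Cc0.
  pose u (i : I) := sval (sval i).
  have uP i : peaked (u i) by exact: svalP (sval i).
  have u0 i x : 0 <= u i x by have [h _ _] := uP i; exact: seminorm_ge0.
  have mP : peaked (fun x => infi (u ^~ x)).
    split.
    + apply: (Cstar_infi i0) => //.
      * by move=> i; have [[]] := uP i.
      * by move=> i; have [[]] := uP i.
      * move=> i j; have [/asboolP h|/asboolP h] := Ct _ _ (svalP i) (svalP j).
          by exists j => x; split => //; exact: h.
        by exists i => x; split => //; exact: h.
      * by move=> i; have [[]] := uP i.
      * by move=> i x y; exists i; have [[_ _ h _ _] _ _] := uP i.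
      * by move=> i x; exists i; have [[_ _ _ h _] _ _] := uP i; rewrite h.
      * by move=> i x; exists i; have [[_ _ _ h _] _ _] := uP i; rewrite h.
    + apply/eqP; rewrite eq_le; have [_ h _] := uP i0; rewrite -{1}h infi_le//=.
      by apply: (infi_ge i0) => i; have [_ -> _] := uP i.
    + by move=> x; apply: (infi_scale i0) => // i; exists i; have [_ _ ->] := uP i.
  exists (exist _ _ mP) => s Cs; apply/asboolP => x /=.
  exact: (infi_le (fun i : I => u0 i x) (exist _ s Cs)).
- exists p; split => // q hq qp.
  by have := pmin (exist _ q hq) (introT (asboolP _) qp) => /(congr1 sval).
Qed.

(* A minimal seminorm p is multiplicative: for f self-adjoint the seminorm
   lim p(f^n x) / p(f)^n lies below p, hence equals p, and it satisfies
   q(f x) = p(f) q(x). *)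
Lemma minimal_peaked_multiplicative p : peaked p ->
  (forall q, peaked q -> (forall x, q x <= p x) -> q = p) ->
  forall x y, p (mul x y) = p x * p y.
Proof.
move=> hp pmin; have [pC pv pvx] := hp; have [_ _ hM hS _] := pC.
have sa f x : star f = f -> p (mul f x) = p f * p x.
  move=> ff; have [f0|f0] := eqVneq (p f) 0.
    by apply/eqP; rewrite f0 mul0r eq_le (seminorm_ge0 pC) andbT -(mul0r (p x)) -f0 hM.
  have <- : power_seminorm p f = p.
    apply: pmin; last by move=> y; exact: power_seminorm_le.
    split; first exact: Cstar_power.
    - apply: power_seminorm_cst => // n; case: n => [|n].
        by rewrite expr0 mulr1.
      by rewrite iterSr ca_mulC iter_mul_mul pvx (seminorm_pow pC).
    - apply: power_seminorm_scale => //; exact: ltW.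
  rewrite power_seminorm_mul//; congr (_ * _).
  by apply/esym/(power_seminorm_cst pC f0) => n; rewrite (seminorm_pow pC)// exprS.
(* By the C*-identity p (x y)^2 = p (x^* x y^* y), and x^* x is self-adjoint. *)
move=> x y; apply/eqP; rewrite -(@eqrXn2 _ 2)//; last 2 first.
- exact: seminorm_ge0.
- by rewrite mulr_ge0// seminorm_ge0.
rewrite -hS ca_starMC exprMn -!hS -sa; last by rewrite ca_starMC ca_starK ca_mulC.
by apply/eqP; congr p; rewrite -!ca_mulA; congr (mul _ _); rewrite ca_mulCA.
Qed.

Section character_of_seminorm.
Variable p : A -> R.
Hypothesis hp : peaked p.
Hypothesis pM : forall x y, p (mul x y) = p x * p y.

Let pC : Cstar_seminorm p. Proof. by case: hp. Qed.
Let pv : 0 < p v. Proof. by case: hp => _ ->. Qed.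

Lemma polyop_mul (q : {poly R[i]}) x y : forall a,
  mul (polyop (mul x) q a) y = polyop (mul x) q (mul a y).
Proof.
move=> a; rewrite ca_mulC /polyop (big_morph (mul y) (@ca_mulDr _ _ y) (ca_mulr0 y)).
apply: eq_bigr => i _; rewrite ca_mulZr; congr (_ *: _).
by rewrite ca_mulC iter_mul_mull.
Qed.

(** Modulo the kernel of p, x acts on v as a scalar. This is [multiplicative_seminorm_root] for nu q
    = p (q(h) v) / p v, applied to the real and imaginary parts h of x; v stands in for a unit. *)
Lemma exists_value x : exists l : R[i], p (mul x v - l *: v) = 0.
Proof.
have [pD pZ _ _ _] := pC.
have sa h : star h = h -> exists l : R, p (mul h v - l%:C *: v) = 0.
  move=> hh; pose nu (q : {poly R[i]}) := p (polyop (mul h) q v) / p v.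
  have hl := @mul_linear R A h.
  have nuX (l : R[i]) : nu ('X - l%:P) = p (mul h v - l *: v) / p v.
    by rewrite /nu polyopB polyopX// polyopC.
  have [|||||l] := @multiplicative_seminorm_root R nu.
  - by move=> q; rewrite divr_ge0 ?seminorm_ge0.
  - move=> q r; rewrite /nu.
    have : p (polyop (mul h) (q * r) v) * p v = p (polyop (mul h) q v) * p (polyop (mul h) r v).
      rewrite -!pM; congr p; rewrite !polyop_mul polyopM//; congr polyop.
      by rewrite ca_mulC polyop_mul.
    move=> E; rewrite mulrACA -E; field; by rewrite gt_eqF.
  - by move=> q r; rewrite /nu polyopD -mulrDl ler_wpM2r ?invr_ge0 ?(ltW pv).
  - by move=> l; rewrite /nu polyopC pZ mulfK// gt_eqF.
  - move=> l; rewrite !nuX ler_wpM2r ?invr_ge0 ?(ltW pv)//.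
    set w := mul h v - l *: v.
    (* Replacing l by its real part takes the self-adjoint part of w, which does not increase p. *)
    have wE : mul h v - (complex.Re l)%:C *: v = (2^-1 : R[i]) *: (w + star w).
      rewrite /w ca_starB ca_starMC hh vv ca_starZ vv addrACA -opprD -scalerDl.
      rewrite (_ : l + l^* = 2 * (complex.Re l)%:C); last exact: addcJ.
      rewrite scalerBr scalerA mulKf//; congr (_ - _).
      by rewrite scalerDr -scalerDl -[2^-1]mul1r -splitr scale1r.
    rewrite wE pZ; have := pD w (star w); rewrite (seminorm_star pC) => h1.
    have -> : nr (2^-1 : R[i]) = 2^-1.
      have n2 : nr (2 : R[i]) = 2.
        have -> : (2 : R[i]) = (2 : R)%:C by rewrite rmorph_nat.
        by rewrite nr_real ger0_norm.
      have two0 : (2 : R) != 0 by [].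
      by apply: (mulIf two0); rewrite -{1}n2 -nrM !mulVf// nr1.
    by rewrite mulrC ler_pdivrMr// mulr_natr mulr2n.
  - rewrite nuX => /eqP; rewrite mulf_eq0 invr_eq0 (gt_eqF pv) orbF => /eqP; by exists l.
pose h := (2^-1 : R[i]) *: (x + star x).
pose k := ('i%C / 2) *: (star x - x).
have [a ha] : exists a : R, p (mul h v - a%:C *: v) = 0.
  apply: sa; rewrite /h ca_starZ ca_starD ca_starK fmorphV rmorph_nat; congr (_ *: _).
  exact: addrC.
have [b hb] : exists b : R, p (mul k v - b%:C *: v) = 0.
  apply: sa; rewrite /k ca_starZ ca_starB ca_starK rmorphM/= fmorphV/= rmorph_nat.
  have iE : ('i%C : R[i])^* = - 'i%C by rewrite complexiE; exact: conjCi.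
  rewrite iE.
  by rewrite mulNr scaleNr -scalerN opprB.
have xE : x = h + 'i%C *: k.
  rewrite /h /k scalerA mulrA -expr2 sqr_i mulN1r scaleNr -scalerBr opprB addrACA subrr addr0.
  by rewrite scalerDr -scalerDl -[2^-1]mul1r -splitr scale1r.
clearbody h k.
exists (a%:C + 'i%C * b%:C); apply/eqP; rewrite eq_le (seminorm_ge0 pC) andbT.
have -> : mul x v - (a%:C + 'i%C * b%:C) *: v =
    (mul h v - a%:C *: v) + 'i%C *: (mul k v - b%:C *: v).
  rewrite {1}xE ca_mulC ca_mulDr ca_mulZr !(ca_mulC v) scalerBr scalerA scalerDl.
  by rewrite opprD addrACA.
by apply: le_trans (pD _ _) _; rewrite pZ ha hb mulr0 addr0.
Qed.

(** Since p v > 0, the scalar L x is unique, so every law of a character follows once the expected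
    value is seen to qualify. *)
Lemma exists_character_of_seminorm : exists chi : character A, nr (chi v) = p v.
Proof.
have [pD pZ _ pS _] := pC.
have [L hL] := choice exists_value.
have p_eq0 a : p a <= 0 -> p a = 0.
  by move=> h; apply/eqP; rewrite eq_le h (seminorm_ge0 pC).
have zD a b : p a = 0 -> p b = 0 -> p (a + b) = 0.
  by move=> ha hb; apply: p_eq0; apply: le_trans (pD _ _) _; rewrite ha hb addr0.
have zZ z a : p a = 0 -> p (z *: a) = 0 by move=> ha; rewrite pZ ha mulr0.
have uniq x l : p (mul x v - l *: v) = 0 -> L x = l.
  move=> h; apply/eqP; rewrite -subr_eq0 -nr_eq0 -(mulIr_eq0 _ (mulIf (lt0r_neq0 pv))) -pZ.
  have -> : (L x - l) *: v = (mul x v - l *: v) + (-1) *: (mul x v - L x *: v).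
    by rewrite scaleN1r opprB [RHS]addrC addrA subrK scalerBl.
  by apply/eqP; apply: zD => //; exact: zZ.
have Llin z a b : L (z *: a + b) = z * L a + L b.
  apply: uniq.
  have -> : mul (z *: a + b) v - (z * L a + L b) *: v =
      z *: (mul a v - L a *: v) + (mul b v - L b *: v).
    rewrite ca_mulC ca_mul_linear !(ca_mulC v) scalerDl opprD addrACA scalerBr.
    by rewrite scalerA.
  by apply: zD => //; exact: zZ.
have LM a b : L (mul a b) = L a * L b.
  apply: uniq.
  have -> : mul (mul a b) v - (L a * L b) *: v =
      mul a (mul b v - L b *: v) + L b *: (mul a v - L a *: v).
    rewrite ca_mulBr ca_mulA ca_mulZr scalerBr addrA subrK scalerA.
    by rewrite [L a * L b]mulrC.
  by apply: zD; [rewrite pM hL mulr0|exact: zZ].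
have Lstar a : L (star a) = (L a)^*.
  apply: uniq; rewrite -(seminorm_star pC) ca_starB ca_starMC ca_starK vv ca_starZ vv.
  by rewrite conjCK hL.
have Lv : nr (L v) = p v.
  apply: (mulIf (lt0r_neq0 pv)); rewrite -pM -pZ; apply/eqP; rewrite eq_le; apply/andP; split.
    have -> : L v *: v = mul v v + (-1) *: (mul v v - L v *: v).
      by rewrite scaleN1r opprB addrCA subrr addr0.
    by apply: le_trans (pD _ _) _; rewrite pZ hL mulr0 addr0.
  rewrite -{1}(subrK (L v *: v) (mul v v)).
  by apply: le_trans (pD _ _) _; rewrite hL add0r.
have L0 : exists a, L a != 0.
  by exists v; rewrite -nr_eq0 Lv gt_eqF.
by exists (Character Llin LM Lstar L0).
Qed.

End character_of_seminorm.

Lemma exists_character : exists chi : character A, nr (chi v) = nr v.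
Proof.
have [p [hp pmin]] := exists_minimal_peaked.
have [_ <- _] := hp; apply: exists_character_of_seminorm => //.
exact: minimal_peaked_multiplicative.
Qed.

End character_existence.

Section character_norm.
Variables (R : realType) (A : commCstarAlgebra R).
Implicit Types (a b : A) (chi : character A).
Local Notation mul := (@ca_mul R A).

Lemma character0 chi : chi 0 = 0.
Proof.
have := character_linear chi 1 0 0; rewrite scale1r addr0 mul1r => h.
by apply: (addrI (chi 0)); rewrite addr0 -h.
Qed.

Lemma characterZ chi z a : chi (z *: a) = z * chi a.
Proof. by have := character_linear chi z a 0; rewrite character0 !addr0. Qed.

Lemma characterD chi a b : chi (a + b) = chi a + chi b.
Proof. by have := character_linear chi 1 a b; rewrite scale1r mul1r. Qed.

Lemma character_sum chi (I : Type) (r : seq I) (P : pred I) (F : I -> A) :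
  chi (\sum_(i <- r | P i) F i) = \sum_(i <- r | P i) chi (F i).
Proof. exact: (big_morph chi (characterD chi) (character0 chi)). Qed.

(* If |chi(b)| = 1 > |b|, the Neumann series c = b + b c gives 1 + chi(c) = chi(c). *)
Lemma character_le_nr chi a : nr (chi a) <= nr a.
Proof.
rewrite leNgt; apply/negP => lt_a.
have chi0 : chi a != 0 by rewrite -nr_eq0 gt_eqF// (le_lt_trans _ lt_a).
pose b := (chi a)^-1 *: a.
have chib : chi b = 1 by rewrite characterZ mulVf.
pose r := nr b; have r0 : 0 <= r by exact: nr_ge0.
have r1 : r < 1.
  have cp : 0 < nr (chi a) by exact: le_lt_trans lt_a.
  by rewrite /r nrZ -(ltr_pM2l cp) mulrA -nrM mulfV// nr1 mul1r mulr1.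
have nM x y : nr (mul x y) <= nr x * nr y by have [_ _ h _ _] := Cstar_seminorm_nr A; exact: h.
pose S n := iter n (fun x => b + mul b x) 0.
have SS n : S n.+1 = b + mul b (S n) by [].
have Sd n k : nr (S (n + k)%N - S n) <= r ^+ n * nr (S k).
  elim: n => [|n IH]; first by rewrite subr0 expr0 mul1r.
  rewrite addSn !SS opprD addrACA subrr add0r -ca_mulBr.
  by apply: le_trans (nM _ _) _; rewrite exprS -mulrA ler_wpM2l.
have Sb k : nr (S k) <= (1 - r)^-1.
  elim: k => [|k IH]; first by rewrite nr0 invr_ge0 subr_ge0 ltW.
  rewrite SS (le_trans (ler_nrD _ _))//; apply: (@le_trans _ _ (r + r * (1 - r)^-1)).
    by rewrite lerD2l (le_trans (nM _ _))// ler_wpM2l.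
  have h : 1 - r != 0 by rewrite subr_eq0 gt_eqF.
  have -> : r + r * (1 - r)^-1 = (1 - r)^-1 - (1 - r) by field.
  by rewrite gerBl subr_ge0 ltW.
have r1' : 0 < 1 - r by rewrite subr_gt0.
have [|c hc] := @complete_seq R A S.
  move=> e e0; have [|N hN] := exp_small r0 r1 (e := e * (1 - r) / 2).
    by rewrite divr_gt0// mulr_gt0.
  have half n : (N <= n)%N -> nr (S n - S N) <= e / 2.
    move=> /subnKC <-; apply: le_trans (Sd _ _) _.
    apply: le_trans (ler_pM _ _ (hN N (leqnn _)) (Sb _)) _; rewrite ?exprn_ge0//.
    by rewrite mulrAC mulfK// gt_eqF.
  exists N => m n Nm Nn; rewrite -(subrK (S N) (S m)) -addrA.
  rewrite (le_trans (ler_nrD _ _))// [leRHS]splitr lerD// ?half//.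
  by rewrite nrBC half.
have cE : c = b + mul b c.
  apply/eqP; rewrite -subr_eq0 -nr_eq0 eq_le nr_ge0 andbT; apply/ler_addgt0Pr => e e0.
  rewrite add0r; have [|N hN] := hc (e / 2); first by rewrite divr_gt0.
  have -> : c - (b + mul b c) = - (S N.+1 - c) + mul b (S N - c).
    by rewrite SS ca_mulBr opprB !opprD !addrA subrK.
  rewrite (le_trans (ler_nrD _ _))// nrN [leRHS]splitr lerD//; first exact: hN.
  apply: le_trans (nM _ _) _; apply: (@le_trans _ _ (1 * nr (S N - c))).
    by rewrite ler_wpM2r// ltW.
  by rewrite mul1r hN.
have /eqP := congr1 chi cE; rewrite characterD characterM chib mul1r.
by rewrite -subr_eq0 opprD addrCA subrr addr0 oppr_eq0 oner_eq0.
Qed.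

Lemma nr_le_characters a (c : R) : ca_star a = a -> 0 <= c ->
  (forall chi, nr (chi a) <= c) -> nr a <= c.
Proof.
move=> aa c0 h; have [->|a0] := eqVneq a 0; first by rewrite nr0.
by have [chi <-] := exists_character aa a0.
Qed.

End character_norm.

(** * Hilbert modules and their localizations *)

(** Cauchy-Schwarz gives |P u|^(2^n) <= |u|^(2^n - 1) |P^(2^n) u|; on taking 2^n-th roots the factor
    M disappears. So M may come from a different norm. *)
Lemma selfadjoint_power_bound (R : realType) (V : lmodType R[i]) (s : semiInner V)
    (P : V -> V) (u : V) (K M : R) : adjoints s P P -> 0 <= K ->
  (forall n, sn s (iter n P u) <= K ^+ n * M) -> sn s (P u) <= K * sn s u.
Proof.
move=> Psa K0 hM; set N := sn s u; have N0 : 0 <= N by exact: sn_ge0.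
pose a n := sn s (iter (2 ^ n)%N P u).
have a0 n : 0 <= a n by exact: sn_ge0.
have aS n : a n ^+ 2 <= N * a n.+1.
  rewrite /a sn_sqr (iter_adjoints Psa) -iterD addnn -mul2n -expnS.
  by rewrite (le_trans (Re_le_nr _))// (le_trans (CauchySchwarz _ _ _)).
have aN n : a 0%N ^+ (2 ^ n) <= N ^+ (2 ^ n).-1 * a n.
  elim: n => [|n IH]; first by rewrite expn0 expr1 expr0 mul1r.
  rewrite expnS mulnC exprM.
  apply: (@le_trans _ _ ((N ^+ (2 ^ n).-1 * a n) ^+ 2)).
    by rewrite lerXn2r ?nnegrE ?mulr_ge0 ?exprn_ge0.
  have -> : (2 ^ n * 2).-1 = ((2 ^ n).-1 * 2).+1.
    have : (0 < 2 ^ n)%N by rewrite expn_gt0.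
    by case: (2 ^ n)%N => // k _; rewrite !muln2 doubleS.
  by rewrite exprMn -exprM [N ^+ _.+1]exprSr -mulrA ler_wpM2l ?exprn_ge0.
rewrite leNgt; apply/negP => lt_a.
have p0 : 0 < sn s (P u) by apply: le_lt_trans lt_a; exact: mulr_ge0.
have aE : a 0%N = sn s (P u) by [].
have Np : 0 < N.
  rewrite lt0r N0 andbT; apply/eqP => N00.
  by have := aS 0%N; rewrite N00 mul0r aE leNgt exprn_gt0.
have key n : N <= (K * N / a 0%N) ^+ (2 ^ n) * M.
  have h := le_trans (aN n) (ler_wpM2l (exprn_ge0 _ N0) (hM _)).
  rewrite expr_div_n mulrAC ler_pdivlMr ?exprn_gt0 ?aE// -aE.
  apply: le_trans (ler_wpM2l N0 h) _.
  by rewrite mulrA -exprS prednK ?expn_gt0// exprMn mulrA [_ ^+ _ * N ^+ _]mulrC.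
have M0 : 0 < M.
  rewrite ltNge; apply/negP => M0; have := key 0%N; rewrite leNgt (le_lt_trans _ Np)//.
  by rewrite mulr_ge0_le0// exprn_ge0// divr_ge0// mulr_ge0.
have [|||N1 hN1] := @exp_small R (K * N / a 0%N) (N / M / 2).
- by rewrite divr_ge0// mulr_ge0.
- by rewrite aE ltr_pdivrMr// mul1r.
- by rewrite !divr_gt0.
have := hN1 (2 ^ N1)%N (ltnW (ltn_expl _ (ltnSn 1))).
rewrite -(ler_pM2r M0) => /(le_trans (key N1)).
rewrite (_ : N / M / 2 * M = N / 2); last by field; rewrite gt_eqF.
lra.
Qed.

Section hilbert_modules.
Variables (R : realType) (A : commCstarAlgebra R) (E : hilbertModule A).
Implicit Types (u v w : E) (a b : A) (chi : character A) (S T : E -> E) (C : R).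
Local Notation inner := (@hm_inner R A E).
Local Notation "'||' u '||_' chi" := (sn (localized_form E chi) u)
  (at level 0, u at level 99, chi at level 0).

Lemma hm_innerDr u v w : inner u (v + w) = inner u v + inner u w.
Proof. by have := hm_inner_linear u 1 v w; rewrite !scale1r. Qed.

Lemma hm_inner0r u : inner u 0 = 0.
Proof. by apply: (addrI (inner u 0)); rewrite -hm_innerDr !addr0. Qed.

Lemma hm_innerZr u (z : R[i]) v : inner u (z *: v) = z *: inner u v.
Proof. by have := hm_inner_linear u z v 0; rewrite hm_inner0r !addr0. Qed.

Lemma hm_innerBr u v w : inner u (v - w) = inner u v - inner u w.
Proof. by rewrite -scaleN1r hm_innerDr hm_innerZr scaleN1r. Qed.

Lemma inner_sa u : ca_star (inner u u) = inner u u.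
Proof. exact: hm_inner_star. Qed.

Lemma nr_inner u : nr (inner u u) = nr u ^+ 2.
Proof. by apply: complexI; rewrite rmorphXn/= !nrE hm_normE. Qed.

Lemma ns_sqr chi u : sn (localized_form E chi) u ^+ 2 = complex.Re (chi (inner u u)).
Proof. exact: sn_sqr. Qed.

Lemma ns_le chi u : sn (localized_form E chi) u <= nr u.
Proof.
rewrite -(@ler_pXn2r _ 2) ?nnegrE// ns_sqr -nr_inner.
exact: le_trans (Re_le_nr _) (character_le_nr _ _).
Qed.

Lemma le_ns u (c : R) : 0 <= c -> (forall chi, sn (localized_form E chi) u <= c) -> nr u <= c.
Proof.
move=> c0 h; rewrite -(@ler_pXn2r _ 2) ?nnegrE// -nr_inner.
apply: nr_le_characters; [exact: inner_sa|exact: exprn_ge0|move=> chi].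
have -> : chi (inner u u) = (sn (localized_form E chi) u ^+ 2)%:C by exact: (sip_sqr (localized_form E chi)).
by rewrite nr_real ger0_norm ?exprn_ge0// lerXn2r ?nnegrE.
Qed.

Lemma nr_inner_le u v : nr (inner u v) <= nr u * nr v.
Proof.
have [_ _ _ hS _] := Cstar_seminorm_nr A.
rewrite -(@ler_pXn2r _ 2) ?nnegrE ?mulr_ge0// -hS.
apply: nr_le_characters; [|exact: exprn_ge0 _ (mulr_ge0 _ _)|move=> chi].
  by rewrite ca_starMC ca_starK ca_mulC.
rewrite characterM character_star nr_conjM nr_real ger0_norm ?exprn_ge0//.
rewrite lerXn2r ?nnegrE ?mulr_ge0//.
apply: le_trans (CauchySchwarz (localized_form E chi) u v) _.
by rewrite ler_pM// ns_le.
Qed.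

Definition hm_adjoints T S := forall u v, inner (T u) v = inner u (S v).

Lemma hm_adjoints_sym T S : hm_adjoints T S -> hm_adjoints S T.
Proof. by move=> h u v; rewrite -hm_inner_star -h hm_inner_star. Qed.

Lemma hm_inner_inj u v : (forall w, inner w u = inner w v) -> u = v.
Proof.
move=> h; apply/eqP; rewrite -subr_eq0 -nr_eq0 -sqrf_eq0 -nr_inner hm_innerBr h subrr.
by rewrite nr0.
Qed.

Lemma hm_adjoints_linear T S : hm_adjoints T S -> linear T.
Proof.
move=> /hm_adjoints_sym h z u v; apply: hm_inner_inj => w.
by rewrite -h !hm_inner_linear !h.
Qed.

Lemma hm_adjoints_localized chi T S : hm_adjoints T S -> adjoints (localized_form E chi) T S.
Proof. by move=> h u v; congr (chi _); exact: h. Qed.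

Lemma adjoint_bound T S C : hm_adjoints T S -> 0 <= C ->
  (forall u, nr (T u) <= C * nr u) -> forall u, nr (S u) <= C * nr u.
Proof.
move=> h C0 TC u; have [->|Su0] := eqVneq (nr (S u)) 0; first exact: mulr_ge0.
have : nr (S u) ^+ 2 <= nr (S u) * (C * nr u).
  rewrite -nr_inner -h; apply: le_trans (nr_inner_le _ _) _.
  by rewrite mulrCA mulrA ler_wpM2r.
by rewrite expr2 ler_pM2l// lt0r Su0 nr_ge0.
Qed.

(* Gliding hump: otherwise there are y_n in the unit ball with |T y_n| >= n 3^n,
   and signed steps of length 3^-n along T y_n lead to some x with
   |S x| >= |<y_n, S x>| >= n / 2 for all n. *)
Lemma adjointable_bounded T S : hm_adjoints T S ->
  exists2 C, 0 <= C & forall u, nr (T u) <= C * nr u.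
Proof.
move=> TS; apply: contrapT => nC.
have Tl := hm_adjoints_linear TS.
have big (C : R) : 0 <= C -> exists y, nr y <= 1 /\ C <= nr (T y).
  move=> C0; have [u hu] : exists u, C * nr u < nr (T u).
    apply: contrapT => nu; apply: nC; exists C => // u.
    by rewrite leNgt; apply/negP => hu; apply: nu; exists u.
  have u0 : nr u != 0.
    apply: contraTneq hu => u0; move/eqP : (u0); rewrite nr_eq0 => /eqP ->.
    by rewrite (lin0 Tl) nr0 mulr0 ltxx.
  have up : 0 < nr u by rewrite lt0r u0 nr_ge0.
  exists (((nr u)^-1)%:C *: u).
  rewrite (linZ _ _ Tl) !nrZ nr_real ger0_norm ?invr_ge0// mulVf//; split => //.
  by rewrite mulrC ler_pdivlMr// ltW.
pose t n : R := 3^-1 ^+ n.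
have t0 n : 0 < t n by rewrite exprn_gt0.
have [y hy] : exists y : nat -> E, forall n, nr (y n) <= 1 /\ n%:R / t n <= nr (T (y n)).
  suff /choice[y hy] : forall n : nat, exists y, nr y <= 1 /\ n%:R / t n <= nr (T y) by exists y.
  by move=> n; apply: big; rewrite divr_ge0// ltW.
have [g hg] : exists g : nat * E -> E, forall q, nr (g q - q.2) <= t q.1 /\
    t q.1 * nr (T (y q.1)) <= nr (inner (T (y q.1)) (g q)).
  suff /choice[g hg] : forall q : nat * E, exists x, nr (x - q.2) <= t q.1 /\
    t q.1 * nr (T (y q.1)) <= nr (inner (T (y q.1)) x) by exists g.
  move=> [n x] /=; set w := T (y n).
  have [w0|w0] := eqVneq (nr w) 0.
    by exists x; rewrite subrr nr0 w0 mulr0; split => //; exact: ltW.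
  have wp : 0 < nr w by rewrite lt0r w0 nr_ge0.
  pose z := (t n / nr w)%:C *: w.
  have tw : 0 <= t n / nr w by rewrite divr_ge0// ltW.
  have nz : nr z = t n by rewrite nrZ nr_real ger0_norm// divfK.
  have iz : nr (inner w z) = t n * nr w.
    by rewrite hm_innerZr nrZ nr_real ger0_norm// nr_inner expr2 mulrA divfK.
  have : 2 * (t n * nr w) <= nr (inner w (x + z)) + nr (inner w (x - z)).
    rewrite -iz; have -> : 2 * nr (inner w z) = nr (inner w (x + z) - inner w (x - z)).
      rewrite hm_innerDr hm_innerBr opprB addrA addrAC [_ + inner w z + _]addrAC.
      rewrite subrr add0r -[in RHS](scale1r (inner w z)) -scalerDl nrZ; congr (_ * _).
      have -> : 1 + 1 = (1 + 1 : R)%:C by rewrite rmorphD.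
      by rewrite nr_real ger0_norm.
    by rewrite -[nr (inner w (x - z))]nrN ler_nrD.
  have [h|h] := leP (t n * nr w) (nr (inner w (x + z))).
    by move=> _; exists (x + z); rewrite addrAC subrr add0r nz.
  move=> h2; exists (x - z); rewrite addrAC subrr add0r nrN nz; split => //; lra.
pose x := fix x n := if n is k.+1 then g (k, x k) else 0.
have xS n : x n.+1 = g (n, x n) by [].
have xd n k : nr (x (n + k)%N - x n) <= 3 / 2 * t n * (1 - t k).
  elim: k => [|k IH]; first by rewrite addn0 subrr nr0 /t expr0 subrr mulr0.
  rewrite addnS xS -(subrK (x (n + k)%N) (g _)) -addrA.
  have [h _] := hg ((n + k)%N, x (n + k)%N).
  apply: le_trans (ler_nrD _ _) _; apply: le_trans (lerD h IH) _ => /=.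
  by rewrite /t exprD exprSr; lra.
have xd' m n : (n <= m)%N -> nr (x m - x n) <= 3 / 2 * t n.
  move=> /subnKC <-; apply: le_trans (xd _ _) _.
  rewrite -[leRHS]mulr1 ler_wpM2l ?mulr_ge0 ?(ltW (t0 _))//.
  by have := t0 (m - n)%N; lra.
have t_small (e : R) : 0 < e -> exists n, forall m, (n <= m)%N -> t m <= e.
  by move=> e0; apply: exp_small => //; rewrite invf_lt1// ltr1n.
have [|X hX] := @complete_seq R E x.
  move=> e e0; have [N hN] := t_small (e / 3) ltac:(by rewrite divr_gt0).
  exists N => m n Nm Nn; rewrite -(subrK (x N) (x m)) -addrA.
  apply: le_trans (ler_nrD _ _) _; rewrite [X in _ + X]nrBC.
  by have := xd' _ _ Nm; have := xd' _ _ Nn; have := hN N (leqnn _); lra.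
(* The later steps add up to half of the n-th one, so half of its gain survives in the limit; the
   ratio 3 is chosen for this. *)
have Xd n : nr (X - x n.+1) <= t n / 2.
  apply/ler_addgt0Pr => e e0; have [N hN] := hX e e0.
  pose m := maxn N n.+1; rewrite -(subrK (x m) X) -addrA.
  have h1 : nr (X - x m) <= e by rewrite nrBC; apply: hN; exact: leq_maxl.
  have h2 : nr (x m - x n.+1) <= t n / 2.
    by apply: le_trans (xd' _ _ (leq_maxr _ _)) _; rewrite /t exprSr; lra.
  by apply: le_trans (ler_nrD _ _) _; lra.
have lower n : n%:R / 2 <= nr (S X).
  have [y1 yn] := hy n; have [_ hgn] := hg (n, x n); rewrite -xS /= in hgn.
  set w := T (y n) in yn hgn.
  have h1 : nr (inner w (x n.+1)) <= nr (inner w X) + nr w * (t n / 2).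
    have -> : inner w (x n.+1) = inner w X - inner w (X - x n.+1).
      by rewrite hm_innerBr opprB addrC subrK.
    apply: le_trans (ler_nrD _ _) _; rewrite nrN lerD2l.
    by apply: le_trans (nr_inner_le _ _) _; rewrite ler_wpM2l.
  have h2 : nr (inner w X) <= nr (S X).
    rewrite /w TS; apply: le_trans (nr_inner_le _ _) _.
    by rewrite -[leRHS]mul1r ler_wpM2r.
  have h3 : n%:R <= nr w * t n by rewrite -ler_pdivrMr.
  lra.
have [n _ hn] := nbhs_infty_gtr (2 * nr (S X)).
have := hn n (leqnn _); rewrite /=; have := lower n; lra.
Qed.

(** In place of the operator inequality T^* T <= C^2, the growth of (S T)^n in the norm of E is fed
    into [selfadjoint_power_bound] for the seminorm of chi. *)
Lemma localized_bound chi T S C : hm_adjoints T S -> 0 <= C ->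
  (forall u, nr (T u) <= C * nr u) -> bounded_by (localized_form E chi) T C.
Proof.
move=> TS C0 TC u; set s := localized_form E chi.
have Sb := adjoint_bound TS C0 TC.
have TSs : adjoints s T S by exact: hm_adjoints_localized.
pose P := S \o T.
have Psa : adjoints s P P by move=> x y; exact: etrans (adjoints_sym TSs (T x) y) (TSs x (T y)).
have Pit n : nr (iter n P u) <= (C * C) ^+ n * nr u.
  elim: n => [|n IH] /=; first by rewrite mul1r.
  apply: le_trans (Sb _) _; rewrite exprS -!mulrA ler_wpM2l//.
  by apply: le_trans (TC _) _; rewrite ler_wpM2l// mulrA.
have := @selfadjoint_power_bound R E s P u (C * C) (nr u) Psa (mulr_ge0 C0 C0) => h.
have {}h : sn s (P u) <= C * C * sn s u.
  by apply: h => n; exact: le_trans (ns_le _ _) (Pit n).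
rewrite -(@ler_pXn2r _ 2) ?nnegrE ?mulr_ge0// sn_sqr TSs.
apply: le_trans (Re_le_nr _) _; apply: le_trans (CauchySchwarz _ _ _) _.
apply: le_trans (ler_wpM2l (sn_ge0 _ _) h) _.
by rewrite exprMn !expr2 mulrCA mulrA; lra.
Qed.

End hilbert_modules.

(** Duality: test vectors y close to q give |q|^2 <= c |q| up to a small error. *)
Lemma dense_sn_le (R : realType) (V : lmodType R[i]) (s : semiInner V) (q : V) (c : R) :
  0 <= c ->
  (forall e, 0 < e -> exists y, sn s (q - y) <= e /\ nr (s y q) <= c * sn s y) ->
  sn s q <= c.
Proof.
move=> c0 h; have [->//|Nn0] := eqVneq (sn s q) 0.
have Np : 0 < sn s q by rewrite lt0r Nn0 sn_ge0.
rewrite -(ler_pM2l Np); apply/ler_addgt0Pr => d d0.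
have D0 : 0 < sn s q + c + 1 by rewrite ltr_wpDl// addr_ge0.
have [y [hy ky]] := h _ (divr_gt0 d0 D0); move: hy; set e := d / _ => hy.
have eE : e * (sn s q + c + 1) = d by rewrite /e divfK// gt_eqF.
have e0 : 0 < e by exact: divr_gt0.
have h0 : sn s q ^+ 2 <= nr (s (q - y) q) + nr (s y q).
  rewrite sn_sqr; apply: le_trans (Re_le_nr _) _.
  have -> : s q q = s (q - y) q + s y q by rewrite sipBl subrK.
  exact: ler_nrD.
have h1 : nr (s (q - y) q) <= e * sn s q.
  by apply: le_trans (CauchySchwarz _ _ _) _; rewrite ler_wpM2r.
have h2 : sn s y <= sn s q + e.
  by apply: le_trans (ler_sn_dist _ _ q) _; rewrite lerD2l snBC.
have h3 : c * sn s y <= c * (sn s q + e) by rewrite ler_wpM2l.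
by move: h0; rewrite expr2; lra.
Qed.

(** * Localized operators and their singular values *)

Section localized_operators.
Variables (R : realType) (A : commCstarAlgebra R) (E : hilbertModule A) (chi : character A).
Implicit Types (u v w x y : E).
Local Notation s := (localized_form E chi).
Local Notation H := (localized_space E chi).
Local Notation emb := (embed s).
Implicit Types (p q : H).

Lemma dot_emb u v : hs_inner H (emb u) (emb v) = s u v.
Proof. exact: cdot_embed. Qed.

Lemma dot_embl u p : hs_inner H (emb u) p = (p : completion s) u.
Proof. exact: cdot_embedl. Qed.

Lemma sn_emb u : sn (hs_inner H) (emb u) = sn s u.
Proof. by apply/eqP; rewrite -(@eqrXn2 _ 2)// !sn_sqr dot_emb. Qed.

Lemma emb_dense p (e : R) : 0 < e -> exists u, sn (hs_inner H) (p - emb u) <= e.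
Proof.
move=> e0; have [|u hu] := @embed_dense R E s p e%:C; first by rewrite ltcR.
by exists u; rewrite sn_hs ltW//; apply/lt_nrP.
Qed.

Variables (T S : E -> E) (C : R).
Hypothesis TS : hm_adjoints T S.
Hypothesis C0 : 0 <= C.
Hypothesis TC : forall u, nr (T u) <= C * nr u.

Let TSs : adjoints s T S := hm_adjoints_localized chi TS.
Let TCs : bounded_by s T C := localized_bound chi TS C0 TC.
Let SC : forall u, nr (S u) <= C * nr u := adjoint_bound TS C0 TC.
Let SCs : bounded_by s S C := localized_bound chi (hm_adjoints_sym TS) C0 SC.
Let Tl : linear T := hm_adjoints_linear TS.

Lemma extension_represents (u : nat -> E) p : represents s u (p : completion s) ->
  represents s (T \o u) (fun y => (p : completion s) (S y)).
Proof.
move=> [cu hu]; split=> [e e0|y]; last first.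
  have -> : (fun n => s y ((T \o u) n)) = fun n => s (S y) (u n).
    by apply/funext => n; rewrite (adjoints_sym TSs).
  exact: hu.
have C1 : 0 < (C + 1)%:C by rewrite ltcR ltr_wpDl.
have [|N hN] := cu (e / (C + 1)%:C); first by rewrite divr_gt0.
exists N => m n Nm Nn; rewrite /= -(linB _ _ Tl).
have := hN _ _ Nm Nn; rewrite ltr_pdivlMr// -!snE => h; apply: le_lt_trans h.
rewrite -rmorphM lecR; apply: le_trans (TCs _) _.
by rewrite mulrC ler_wpM2l// lerDl.
Qed.

Lemma extension_subproof p : (fun y => (p : completion s) (S y)) \in completion_pred s.
Proof.
have [u hu] := completion_repr (p : completion s).
by apply/asboolP; eexists; exact: extension_represents hu.
Qed.

(** An element p of the completion is the functional y -> <y, p>, so T (x) 1 is composition with the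
    adjoint S. *)
Definition extension p : H := Completion (extension_subproof p).

Lemma extension_emb u : extension (emb u) = emb (T u).
Proof. by apply/val_inj/funext => y; exact: (adjoints_sym TSs). Qed.

Lemma extension_linear : linear extension.
Proof. by move=> z p q; apply/val_inj/funext => y. Qed.

Lemma extension_bounded : bounded_by (hs_inner H) extension C.
Proof.
move=> p; set q := extension p.
have key y : nr (hs_inner H (emb y) q) <= C * sn s y * sn (hs_inner H) p.
  rewrite dot_embl -[(q : completion s) y]/((p : completion s) (S y)) -dot_embl.
  by apply: le_trans (CauchySchwarz _ _ _) _; rewrite sn_emb ler_wpM2r// SCs.
apply: dense_sn_le; first by rewrite mulr_ge0.
move=> e e0; have [y hy] := emb_dense q e0; exists (emb y); split; first exact: hy.
rewrite sn_emb mulrAC.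
exact: key.
Qed.

(** [localized_op] is a choice among continuous linear extensions; density of E leaves only one. *)
Lemma localized_opE : localized_op (E := E) chi T = extension.
Proof.
have real_pos (e : R[i]) : 0 < e -> exists2 r : R, 0 < r & e = r%:C.
  by move=> e0; exists (complex.Re e); rewrite ?RRe_real ?gtr0_real// -ltcR RRe_real// gtr0_real.
have C1 : 0 < C + 1 by rewrite ltr_wpDl.
have ext_ok : [/\ linear extension, continuous extension &
    forall u z, extension (tensor chi u z) = tensor chi (T u) z].
  split; first exact: extension_linear.
  - move=> p; have FF : Filter (nbhs p) by exact: nbhs_filter.
    apply/(@cvgrPdist_lt R[i] H H (nbhs p) FF) => e /real_pos[r r0 ->].
    apply/nbhs_ballP; exists (r / (C + 1))%:C => /=; first by rewrite ltcR divr_gt0.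
    move=> q; rewrite -ball_normE /= => /lt_nrP hq.
    have {}hq : sn (hs_inner H) (p - q) < r / (C + 1) by rewrite sn_hs; exact: hq.
    have h : sn (hs_inner H) (extension p - extension q) < r.
      rewrite -(linB _ _ extension_linear); apply: le_lt_trans (extension_bounded _) _.
      apply: (@le_lt_trans _ _ ((C + 1) * sn (hs_inner H) (p - q))).
        by rewrite ler_wpM2r// lerDl.
      by rewrite mulrC -ltr_pdivlMr.
    by move: h; rewrite sn_hs => h; apply/lt_nrP; exact: h.
  - by move=> u z; rewrite /tensor (linZ _ _ extension_linear) extension_emb.
rewrite /localized_op; case: xgetP => [F _ [Fl Fc Ft]|/(_ extension)]; last by case.
apply/funext => p; apply/eqP; rewrite -subr_eq0 -nr_eq0 eq_le nr_ge0 andbT.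
apply/ler_addgt0Pr => e e0; rewrite add0r.
have e2 : 0 < e / 2 by rewrite divr_gt0.
have : \forall q \near p, `|F p - F q| < (e / 2)%:C.
  have FF : Filter (nbhs p) by exact: nbhs_filter.
  by move/(@cvgrPdist_lt R[i] H H (nbhs p) FF) : (Fc p); apply; rewrite ltcR.
move=> /nbhs_ballP[r /= r0 hr].
have [r' r'0 rE] := real_pos r r0; rewrite {r r0}rE in hr.
pose d := Num.min (r' / 2) (e / 2 / (C + 1)).
have d0 : 0 < d by rewrite lt_min !divr_gt0.
have [u hu] := emb_dense p d0.
have Fu : F (emb u) = extension (emb u).
  by have := Ft u 1; rewrite /tensor !scale1r extension_emb.
have h1 : nr (F p - F (emb u)) <= e / 2.
  have hu' : sn (hs_inner H) (p - emb u) < r'.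
    by apply: le_lt_trans hu _; rewrite /d gt_min ltr_pdivrMr// ltr_pMr// ltr1n.
  rewrite sn_hs in hu'; apply/ltW/lt_nrP; apply: hr; rewrite -ball_normE /=.
  by apply/lt_nrP; exact: hu'.
have h2 : nr (extension (emb u) - extension p) <= e / 2.
  rewrite -(linB _ _ extension_linear) -sn_hs; apply: le_trans (extension_bounded _) _.
  rewrite snBC; apply: (@le_trans _ _ ((C + 1) * (e / 2 / (C + 1)))).
    rewrite ler_pM// ?lerDl//; apply: le_trans hu _; by rewrite /d ge_min lexx orbT.
  by rewrite mulrC divfK// gt_eqF.
have -> : F p - extension p = (F p - F (emb u)) + (extension (emb u) - extension p).
  by rewrite Fu addrA subrK.
by apply: le_trans (ler_nrD _ _) _; rewrite [leRHS]splitr; exact: lerD h1 h2.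
Qed.

End localized_operators.

Section localized_adjoints.
Variables (R : realType) (A : commCstarAlgebra R) (E : hilbertModule A) (chi : character A).
Variables (T S : E -> E) (C : R).
Hypothesis TS : hm_adjoints T S.
Hypothesis C0 : 0 <= C.
Hypothesis TC : forall u, nr (T u) <= C * nr u.
Local Notation H := (localized_space E chi).

Lemma localized_op_bounded : bounded_by (hs_inner H) (localized_op chi T) C.
Proof. by rewrite (localized_opE chi TS C0 TC); exact: extension_bounded. Qed.

Lemma localized_op_emb u : localized_op chi T (embed (localized_form E chi) u) =
  embed (localized_form E chi) (T u).
Proof. by rewrite (localized_opE chi TS C0 TC) extension_emb. Qed.

Lemma localized_op_adjoints : adjoints (hs_inner H) (localized_op chi T) (localized_op chi S).
Proof.
have SC := adjoint_bound TS C0 TC; have ST := hm_adjoints_sym TS.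
rewrite (localized_opE chi TS C0 TC) (localized_opE chi ST C0 SC) => p q.
have [u hu] := completion_repr (p : completion (localized_form E chi)).
have [v hv] := completion_repr (q : completion (localized_form E chi)).
have h1 := cvg_cdot (extension_represents TS C0 TC hu :
  represents _ _ (extension TS C0 TC p)) hv.
have h2 := cvg_cdot hu (extension_represents ST C0 SC hv :
  represents _ _ (extension ST C0 SC q)).
apply: complex_cvg_unique h1 _.
have -> : (fun n => localized_form E chi ((T \o u) n) (v n)) =
    (fun n => localized_form E chi (u n) ((S \o v) n)).
  by apply/funext => n; exact: (hm_adjoints_localized chi TS).
exact: h2.
Qed.

End localized_adjoints.

Lemma character_near (R : realType) (A : commCstarAlgebra R) (chi0 : character A) (a : A) (e : R) :
  0 < e -> \forall chi \near chi0, nr ((chi : character A) a - chi0 a) <= e.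
Proof.
move=> e0; have : {for chi0, continuous (fun chi : character A => chi a)}.
  have c1 := @initial_continuous _ _ (@character_fun R A : character A -> prod_topology (fun _ : A => R[i])) chi0.
  have c2 := @proj_continuous A (fun _ : A => R[i]) a (@character_fun R A chi0).
  exact: (continuous_comp c1 c2).
move=> /cvgrPdist_le/(_ e%:C); rewrite ltcR => /(_ e0).
by apply: filterS => chi /le_nrP; rewrite nrBC.
Qed.

Section localized_algebra.
Variables (R : realType) (A : commCstarAlgebra R) (E : hilbertModule A) (chi : character A).
Local Notation s := (localized_form E chi).
Local Notation H := (localized_space E chi).
Local Notation emb := (embed s).
Local Notation loc := (@localized_op R A E chi).
Implicit Types (p q : H) (S T : E -> E).

Lemma emb_inj p q : (forall y, hs_inner H (emb y) p = hs_inner H (emb y) q) -> p = q.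
Proof.
move=> h; apply/val_inj/funext => y; have := h y.
by rewrite !dot_embl.
Qed.

Lemma embD (u v : E) : emb (u + v) = emb u + emb v.
Proof. by have := embed_lin s 1 u v; rewrite !scale1r. Qed.

Lemma emb0 : emb 0 = 0.
Proof. by apply: (addrI (emb 0)); rewrite -embD !addr0. Qed.

Lemma embZ (z : R[i]) (u : E) : emb (z *: u) = z *: emb u.
Proof. by have := embed_lin s z u 0; rewrite emb0 !addr0. Qed.

Lemma emb_sum (I : Type) (r : seq I) (P : pred I) (F : I -> E) :
  emb (\sum_(i <- r | P i) F i) = \sum_(i <- r | P i) emb (F i).
Proof. exact: (big_morph emb embD emb0). Qed.

Lemma dot_loc T T' y p : hm_adjoints T T' ->
  hs_inner H (emb y) (loc T p) = hs_inner H (emb (T' y)) p.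
Proof.
move=> TT; have [C C0 TC] := adjointable_bounded TT.
have T'C := adjoint_bound TT C0 TC.
have h := adjoints_sym (localized_op_adjoints TT C0 TC) (emb y) p.
rewrite (localized_op_emb chi (hm_adjoints_sym TT) C0 T'C) in h.
exact: esym h.
Qed.

Lemma locD S S' T T' p : hm_adjoints S S' -> hm_adjoints T T' ->
  loc (fun u => S u + T u) p = loc S p + loc T p.
Proof.
move=> SS TT; apply: emb_inj => y.
have ST : hm_adjoints (fun u => S u + T u) (fun u => S' u + T' u).
  move=> u v.
  by rewrite -hm_inner_star hm_innerDr ca_starD !hm_inner_star SS TT -hm_innerDr.
by rewrite (dot_loc _ _ ST) sipDr (dot_loc _ _ SS) (dot_loc _ _ TT) embD sipDl.
Qed.

Lemma locZ (z : R[i]) T T' p : hm_adjoints T T' ->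
  loc (fun u => z *: T u) p = z *: loc T p.
Proof.
move=> TT; apply: emb_inj => y.
have zT : hm_adjoints (fun u => z *: T u) (fun u => z^* *: T' u).
  move=> u v; rewrite -hm_inner_star !hm_innerZr ca_starZ hm_inner_star TT.
  by [].
by rewrite (dot_loc _ _ zT) sipZr (dot_loc _ _ TT) embZ sipZl conjCK.
Qed.

Lemma hm_adjoints_comp S S' T T' : hm_adjoints S S' -> hm_adjoints T T' ->
  hm_adjoints (S \o T) (T' \o S').
Proof. by move=> SS TT u v /=; rewrite SS TT. Qed.

Lemma loc_comp S S' T T' p : hm_adjoints S S' -> hm_adjoints T T' ->
  loc (S \o T) p = loc S (loc T p).
Proof.
move=> SS TT; apply: emb_inj => y.
by rewrite (dot_loc _ _ (hm_adjoints_comp SS TT)) (dot_loc _ _ SS) (dot_loc _ _ TT).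
Qed.

Lemma hm_adjointsD S S' T T' : hm_adjoints S S' -> hm_adjoints T T' ->
  hm_adjoints (fun u => S u + T u) (fun u => S' u + T' u).
Proof.
move=> SS TT u v.
by rewrite -hm_inner_star hm_innerDr ca_starD !hm_inner_star SS TT -hm_innerDr.
Qed.

Lemma hm_adjointsZ (z : R[i]) T T' : hm_adjoints T T' ->
  hm_adjoints (fun u => z *: T u) (fun u => z^* *: T' u).
Proof.
by move=> TT u v; rewrite -hm_inner_star !hm_innerZr ca_starZ hm_inner_star TT.
Qed.

Definition sv T k : R := gelfand (hs_inner H) (loc T) k.

Lemma sv_ge0 T k : 0 <= sv T k.
Proof. exact: gelfand_ge0. Qed.

Lemma sv_lt T T' k c : hm_adjoints T T' -> sv T k < c -> gelfand_le (hs_inner H) (loc T) k c.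
Proof.
move=> TT; have [C C0 TC] := adjointable_bounded TT.
exact: (gelfand_lt C0 (localized_op_bounded TT C0 TC)).
Qed.

Lemma sv_anti T T' k l : hm_adjoints T T' -> (k <= l)%N -> sv T l <= sv T k.
Proof.
move=> TT; have [C C0 TC] := adjointable_bounded TT.
exact: (gelfand_anti C0 (localized_op_bounded TT C0 TC)).
Qed.

Lemma ler_scale_adherent (a b C : R) : 0 <= C -> (forall c, a < c -> b <= C * c) -> b <= C * a.
Proof.
move=> C0 h; apply/ler_addgt0Pr => e e0.
have C1 : 0 < C + 1 by rewrite ltr_wpDl.
apply: le_trans (h (a + e / (C + 1)) _) _; first by rewrite ltrDl divr_gt0.
by rewrite mulrDr lerD2l mulrCA ler_piMr ?(ltW e0)// ler_pdivrMr// mul1r lerDl.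
Qed.

Lemma sv_comp S S' T T' C k : hm_adjoints S S' -> hm_adjoints T T' -> 0 <= C ->
  (forall u, nr (S u) <= C * nr u) -> sv (S \o T) k <= C * sv T k.
Proof.
move=> SS TT C0 SC; apply: ler_scale_adherent => // c hc.
have c0 : 0 <= c by rewrite ltW// (le_lt_trans _ hc)// sv_ge0.
apply: gelfand_min; first exact: mulr_ge0.
have -> : loc (S \o T) = loc S \o loc T by apply/funext => p; exact: loc_comp SS TT.
exact: (gelfand_le_comp C0 (localized_op_bounded SS C0 SC) (sv_lt TT hc)).
Qed.

Lemma sv_precomp S S' T T' C k : hm_adjoints S S' -> hm_adjoints T T' -> 0 <= C ->
  (forall u, nr (S u) <= C * nr u) -> sv (T \o S) k <= C * sv T k.
Proof.
move=> SS TT C0 SC; apply: ler_scale_adherent => // c hc.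
have c0 : 0 <= c by rewrite ltW// (le_lt_trans _ hc)// sv_ge0.
apply: gelfand_min; first exact: mulr_ge0.
have -> : loc (T \o S) = loc T \o loc S by apply/funext => p; exact: loc_comp TT SS.
rewrite mulrC; exact: (gelfand_le_precomp c0 (localized_op_adjoints SS C0 SC) (localized_op_bounded SS C0 SC) (sv_lt TT hc)).
Qed.

Lemma svD S S' T T' k l : hm_adjoints S S' -> hm_adjoints T T' ->
  sv (fun u => S u + T u) (k + l) <= sv S k + sv T l.
Proof.
move=> SS TT; apply/ler_addgt0Pr => e e0.
have e2 : 0 < e / 2 by rewrite divr_gt0.
have hS : sv S k < sv S k + e / 2 by rewrite ltrDl.
have hT : sv T l < sv T l + e / 2 by rewrite ltrDl.
have -> : sv S k + sv T l + e = (sv S k + e / 2) + (sv T l + e / 2) by rewrite addrACA -splitr.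
have S0 := sv_ge0 S k; have T0 := sv_ge0 T l.
apply: gelfand_min; first by rewrite (addr_ge0 (addr_ge0 S0 (ltW e2)) (addr_ge0 T0 (ltW e2))).
have -> : loc (fun u => S u + T u) = fun p => loc S p + loc T p.
  by apply/funext => p; exact: locD SS TT.
exact: (gelfand_leD (sv_lt SS hS) (sv_lt TT hT)).
Qed.

Lemma svZ (z : R[i]) T T' k : hm_adjoints T T' -> sv (fun u => z *: T u) k <= nr z * sv T k.
Proof.
move=> TT; apply: ler_scale_adherent => // c hc.
have c0 : 0 <= c by rewrite ltW// (le_lt_trans _ hc)// sv_ge0.
apply: gelfand_min; first exact: mulr_ge0.
have -> : loc (fun u => z *: T u) = fun p => z *: loc T p.
  by apply/funext => p; exact: locZ TT.
exact: (gelfand_leZ z (sv_lt TT hc)).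
Qed.

Lemma sv_le T T' C k : hm_adjoints T T' -> 0 <= C ->
  (forall u, nr (T u) <= C * nr u) -> sv T k <= C.
Proof.
move=> TT C0 TC; apply: gelfand_min => //; apply: gelfand_le_bounded.
exact: localized_op_bounded.
Qed.

Lemma sv_dist S S' T T' e k : hm_adjoints S S' -> hm_adjoints T T' -> 0 <= e ->
  (forall u, nr (S u - T u) <= e * nr u) -> sv S k <= sv T k + e.
Proof.
move=> SS TT e0 he.
have D := hm_adjointsD SS (hm_adjointsZ (-1) TT).
have SE : S = fun u => T u + (S u + (-1) *: T u).
  by apply/funext => u; rewrite scaleN1r addrC subrK.
rewrite {1}SE -{1}[k]addn0; apply: le_trans (svD _ _ TT D) _.
rewrite lerD2l; apply: sv_le D e0 _ => u; rewrite scaleN1r; exact: he.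
Qed.

End localized_algebra.

(** * Finite rank and compact operators of a Hilbert module *)

Section compact_ideal.
Variables (R : realType) (A : commCstarAlgebra R) (E : hilbertModule A).
Implicit Types (S T : E -> E) (l : seq (E * E)).

Definition finite_rank l (u : E) := \sum_(q <- l) rank_one q.1 q.2 u.

Lemma finite_rankE l u : finite_rank l u =
  \sum_(i < size l) rank_one (nth (0, 0) l i).1 (nth (0, 0) l i).2 u.
Proof. by rewrite /finite_rank (big_nth (0, 0)) big_mkord. Qed.

Lemma compact_operatorsP T : compact_operators E T <-> adjointable E T /\
  forall e : R, 0 < e -> exists l, forall u, nr (T u - finite_rank l u) <= e * nr u.
Proof.
split=> -[aT hT]; split => // e /hT.
- move=> [n [v [w h]]]; exists [seq (v i, w i) | i <- index_enum 'I_n] => u.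
  rewrite /finite_rank big_map; apply/le_nrP; rewrite rmorphM/= nrE; exact: h.
- move=> [l h]; exists (size l), (fun i => (nth (0, 0) l i).1), (fun i => (nth (0, 0) l i).2) => u.
  by rewrite -finite_rankE -[`|u|]nrE -rmorphM; apply/le_nrP; exact: h.
Qed.

Lemma adjointable_act T T' u a : hm_adjoints T T' -> T (hm_act u a) = hm_act (T u) a.
Proof.
move=> /hm_adjoints_sym TT; apply: hm_inner_inj => w.
by rewrite -TT !hm_inner_act TT.
Qed.

Lemma finite_rank_cat l l' u : finite_rank (l ++ l') u = finite_rank l u + finite_rank l' u.
Proof. by rewrite /finite_rank big_cat. Qed.

Lemma finite_rank_comp S S' l u : hm_adjoints S S' ->
  S (finite_rank l u) = finite_rank [seq (S q.1, q.2) | q <- l] u.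
Proof.
move=> SS; have Sl := hm_adjoints_linear SS.
rewrite /finite_rank big_map (big_morph S (fun x y => linD x y Sl) (lin0 Sl)).
by apply: eq_bigr => q _; rewrite /rank_one (adjointable_act _ _ SS).
Qed.

Lemma finite_rank_precomp S S' l u : hm_adjoints S S' ->
  finite_rank l (S u) = finite_rank [seq (q.1, S' q.2) | q <- l] u.
Proof.
move=> SS; rewrite /finite_rank big_map.
by apply: eq_bigr => q _; rewrite /rank_one (hm_adjoints_sym SS).
Qed.

Lemma hm_actZ (z : R[i]) (u : E) a : hm_act (z *: u) a = z *: hm_act u a.
Proof.
have act0 : hm_act (0 : E) a = 0.
  by have := hm_act_linearl a 1 (0 : E) 0; rewrite !scale1r addr0 => h; apply: (addrI (hm_act 0 a)); rewrite addr0 -h.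
by have := hm_act_linearl a z u 0; rewrite act0 !addr0.
Qed.

Lemma finite_rankZ (z : R[i]) l u :
  z *: finite_rank l u = finite_rank [seq (z *: q.1, q.2) | q <- l] u.
Proof.
rewrite /finite_rank big_map scaler_sumr; apply: eq_bigr => q _.
by rewrite /rank_one hm_actZ.
Qed.

Lemma finite_rank_adjoints l :
  hm_adjoints (finite_rank l) (finite_rank [seq (q.2, q.1) | q <- l]).
Proof.
elim: l => [|q l IH] u v.
  by rewrite /finite_rank !big_nil -hm_inner_star !hm_inner0r ca_star0.
have E1 : finite_rank (q :: l) u = rank_one q.1 q.2 u + finite_rank l u.
  by rewrite /finite_rank big_cons.
have E2 : finite_rank [seq (q.2, q.1) | q <- q :: l] v =
    rank_one q.2 q.1 v + finite_rank [seq (q.2, q.1) | q <- l] v.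
  by rewrite /finite_rank big_cons.
rewrite E1 E2 -hm_inner_star hm_innerDr ca_starD !hm_inner_star IH hm_innerDr.
congr (_ + _); rewrite /rank_one -hm_inner_star hm_inner_act ca_starM !hm_inner_star.
by rewrite hm_inner_act.
Qed.

Lemma compactD S T : compact_operators E S -> compact_operators E T ->
  compact_operators E (fun u => S u + T u).
Proof.
move=> /compact_operatorsP[[S' SS] hS] /compact_operatorsP[[T' TT] hT].
apply/compact_operatorsP; split.
  by exists (fun u => S' u + T' u); exact: hm_adjointsD SS TT.
move=> e e0; have e2 : 0 < e / 2 by rewrite divr_gt0.
have [l hl] := hS _ e2; have [l' hl'] := hT _ e2; exists (l ++ l') => u.
rewrite finite_rank_cat opprD addrACA (le_trans (ler_nrD _ _))//.
have -> : e * nr u = e / 2 * nr u + e / 2 * nr u by rewrite -mulrDl -splitr.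
by rewrite lerD.
Qed.

Lemma compact_comp S T : adjointable E S -> compact_operators E T ->
  compact_operators E (S \o T).
Proof.
move=> [S' SS] /compact_operatorsP[[T' TT] hT].
apply/compact_operatorsP; split; first by eexists; exact: hm_adjoints_comp SS TT.
have [C C0 SC] := adjointable_bounded SS.
move=> e e0; have [|l hl] := hT (e / (C + 1)); first by rewrite divr_gt0// ltr_wpDl.
exists [seq (S q.1, q.2) | q <- l] => u.
rewrite -(finite_rank_comp _ _ SS) /= -(linB _ _ (hm_adjoints_linear SS)).
apply: le_trans (SC _) _; apply: le_trans (ler_wpM2l C0 (hl u)) _.
rewrite mulrA ler_wpM2r// mulrCA ler_piMr ?(ltW e0)//.
by rewrite ler_pdivrMr ?ltr_wpDl// mul1r lerDl.
Qed.

Lemma compact_precomp S T : adjointable E S -> compact_operators E T ->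
  compact_operators E (T \o S).
Proof.
move=> [S' SS] /compact_operatorsP[[T' TT] hT].
apply/compact_operatorsP; split; first by eexists; exact: hm_adjoints_comp TT SS.
have [C C0 SC] := adjointable_bounded SS.
move=> e e0; have [|l hl] := hT (e / (C + 1)); first by rewrite divr_gt0// ltr_wpDl.
exists [seq (q.1, S' q.2) | q <- l] => u.
rewrite -(finite_rank_precomp _ _ SS) /=; apply: le_trans (hl _) _.
have d0 : 0 <= e / (C + 1) by rewrite divr_ge0 ?(ltW e0)// addr_ge0.
apply: le_trans (ler_wpM2l d0 (SC u)) _; rewrite mulrA ler_wpM2r//.
by rewrite mulrAC ler_pdivrMr ?ltr_wpDl// ler_wpM2l ?(ltW e0)// lerDl.
Qed.

Lemma compactZ (z : R[i]) T : compact_operators E T -> compact_operators E (fun u => z *: T u).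
Proof.
move=> /compact_operatorsP[[T' TT] hT].
apply/compact_operatorsP; split; first by eexists; exact: hm_adjointsZ TT.
move=> e e0; have z1 : 0 < nr z + 1 by rewrite ltr_wpDl.
have [|l hl] := hT (e / (nr z + 1)); first by rewrite divr_gt0.
exists [seq (z *: q.1, q.2) | q <- l] => u.
rewrite -finite_rankZ -scalerBr nrZ; apply: le_trans (ler_wpM2l (nr_ge0 _) (hl u)) _.
rewrite mulrA ler_wpM2r// mulrCA ler_piMr ?(ltW e0)//.
by rewrite ler_pdivrMr// mul1r lerDl.
Qed.

Lemma zero_compact : compact_operators E (fun=> 0).
Proof.
apply/compact_operatorsP; split.
  by exists (fun=> 0) => u v; rewrite -hm_inner_star !hm_inner0r ca_star0.
move=> e e0; exists [::] => u; rewrite /finite_rank big_nil subrr nr0.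
by rewrite mulr_ge0// ltW.
Qed.

Section localized_finite_rank.
Variables (chi : character A) (l : seq (E * E)).
Local Notation s := (localized_form E chi).
Local Notation H := (localized_space E chi).
Local Notation emb := (embed s).
Let v i := (nth (0, 0) l i).1.
Let w i := (nth (0, 0) l i).2.

Lemma emb_act (u : E) a : emb (hm_act u a) = chi a *: emb u.
Proof.
apply/val_inj/funext => y.
change (chi (hm_inner y (hm_act u a)) = chi a * chi (hm_inner y u)).
by rewrite hm_inner_act characterM mulrC.
Qed.

Lemma loc_finite_rank (p : H) : localized_op chi (finite_rank l) p =
  \sum_(i < size l) hs_inner H (emb (w i)) p *: emb (v i).
Proof.
apply: emb_inj => y; rewrite (dot_loc _ _ (finite_rank_adjoints l)).
rewrite finite_rankE size_map emb_sum sip_suml sip_sumr; apply: eq_bigr => i _.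
rewrite (nth_map (0, 0) (0, 0) (fun q => (q.2, q.1)) (ltn_ord i)) /rank_one.
change (hs_inner H (emb (hm_act (w i) (hm_inner (v i) y))) p =
  hs_inner H (emb y) (hs_inner H (emb (w i)) p *: emb (v i))).
rewrite emb_act sipZl sipZr mulrC; congr (_ * _).
rewrite dot_emb; exact: localized_dot_conj.
Qed.

Lemma finite_rank_gelfand e : 0 <= e ->
  gelfand_le (hs_inner H) (localized_op chi (finite_rank l)) (size l) e.
Proof.
move=> e0; exists [seq emb (w i) | i <- iota 0 (size l)]; first by rewrite size_map size_iota.
move=> p hp; rewrite loc_finite_rank big1 => [|i _]; first by rewrite sn0 mulr_ge0.
rewrite hp ?scale0r//; apply/mapP; exists (nat_of_ord i) => //.
by rewrite mem_iota add0n ltn_ord.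
Qed.

Lemma finite_rank_compact : compact_op (hs_inner H) (localized_op chi (finite_rank l)).
Proof. by move=> e /ltW e0; exists (size l); exact: finite_rank_gelfand. Qed.

Lemma finite_rank_sv k : (size l <= k)%N -> sv chi (finite_rank l) k = 0.
Proof.
move=> lk; apply/eqP; rewrite eq_le sv_ge0 andbT; apply: gelfand_min => //.
exact: gelfand_le_leq lk (finite_rank_gelfand _).
Qed.

(** The argument of chi on the right does not depend on chi, so the sum is continuous in chi. *)
Lemma finite_rank_sv_sum : \sum_(j < size l) sv chi (finite_rank l) j ^+ 2 =
  complex.Re (chi (\sum_(i < size l) \sum_(j < size l)
    ca_mul (hm_inner (w j) (w i)) (hm_inner (v i) (v j)))).
Proof.
have FF := finite_rank_adjoints l.
have [C C0 FC] := adjointable_bounded FF.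
have [e Fe] := exists_svd (@hs_definite R H) (localized_op_adjoints FF C0 FC) C0
  (localized_op_bounded FF C0 FC) finite_rank_compact (@hs_complete R H).
transitivity (\sum_(j < size l) sn (hs_inner H) (localized_op chi (finite_rank l) (e j)) ^+ 2).
  apply: eq_bigr => j _; congr (_ ^+ 2).
  exact: (svd_gelfand (@hs_definite R H) (localized_op_adjoints FF C0 FC) Fe).
rewrite (svd_finite_rank (@hs_definite R H) (localized_op_adjoints FF C0 FC) Fe
  (v := fun i => emb (v i)) (w := fun i => emb (w i)) (n := size l) loc_finite_rank).
congr complex.Re; rewrite character_sum; apply: eq_bigr => i _.
rewrite character_sum; apply: eq_bigr => j _.
by rewrite characterM !dot_emb.
Qed.

End localized_finite_rank.
End compact_ideal.

(** * Singular values as functions of the character *)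

Section Gram.
Variables (R : realType) (V : lmodType R[i]) (s : semiInner V).

(** For a Gram matrix within k of a diagonal one entrywise: the n^2 errors |c_i| |c_j| k are bounded
    by (|c_i|^2 + |c_j|^2) k / 2, whence the factor n. *)
Lemma Gram_dist (y : nat -> V) (D : nat -> R) (k : R) n (c : nat -> R[i]) :
  (forall i j, (i < n)%N -> (j < n)%N ->
    nr (s (y i) (y j) - (if i == j then D i else 0)%:C) <= k) ->
  `|sn s (\sum_(i < n) c i *: y i) ^+ 2 - \sum_(i < n) nr (c i) ^+ 2 * D i| <=
    k * n%:R * \sum_(i < n) nr (c i) ^+ 2.
Proof.
move=> hk; rewrite -nr_real.
have -> : (sn s (\sum_(i < n) c i *: y i) ^+ 2 - \sum_(i < n) nr (c i) ^+ 2 * D i)%:C =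
    \sum_(i < n) \sum_(j < n) (c i)^* * c j *
      (s (y i) (y j) - (if (i : nat) == j then D i else 0)%:C).
  rewrite rmorphB/= -sip_sqr sip_suml rmorph_sum/= -sumrB; apply: eq_bigr => i _.
  rewrite sip_sumr (bigD1 i)//= [RHS](bigD1 i)//= eqxx addrAC; congr (_ + _).
    by rewrite sipZl sipZr rmorphM/= -nr_conjM; ring.
  apply: eq_bigr => j ji; rewrite sipZl sipZr.
  have -> : (i : nat) == j = false by rewrite eq_sym; exact: negbTE.
  by rewrite subr0 mulrA.
have -> : k * n%:R * \sum_(i < n) nr (c i) ^+ 2 =
    \sum_(i < n) \sum_(j < n) (nr (c i) ^+ 2 + nr (c j) ^+ 2) / 2 * k.
  have -> : \sum_(i < n) \sum_(j < n) (nr (c i) ^+ 2 + nr (c j) ^+ 2) / 2 * k =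
      \sum_(i < n) (n%:R * nr (c i) ^+ 2 + \sum_(j < n) nr (c j) ^+ 2) / 2 * k.
    apply: eq_bigr => i _; rewrite -!mulr_suml big_split/= sumr_const card_ord.
    by rewrite mulr_natl.
  rewrite -!mulr_suml big_split/= sumr_const card_ord -mulr_sumr -[X in _ + X]mulr_natl.
  by field.
apply: le_trans (nr_sum _ _ _) _; apply: ler_sum => i _.
apply: le_trans (nr_sum _ _ _) _; apply: ler_sum => j _.
rewrite !nrM nr_conj; apply: ler_pM (hk _ _ (ltn_ord i) (ltn_ord j)).
- exact: mulr_ge0 (nr_ge0 _) (nr_ge0 _).
- exact: nr_ge0.
- rewrite ler_pdivlMr// -subr_ge0.
  have -> : nr (c i) ^+ 2 + nr (c j) ^+ 2 - nr (c i) * nr (c j) * 2 = (nr (c i) - nr (c j)) ^+ 2 by ring.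
  exact: sqr_ge0.
Qed.

Lemma sip_near x y x' y' (M d : R) : sn s x <= M -> sn s y <= M -> d <= M ->
  sn s (x - x') <= d -> sn s (y - y') <= d -> nr (s x' y' - s x y) <= 3 * M * d.
Proof.
move=> xM yM dM hx hy; rewrite nrBC.
have d0 : 0 <= d := le_trans (sn_ge0 _ _) hx.
have M0 : 0 <= M := le_trans d0 dM.
have -> : s x y - s x' y' = s (x - x') y + s x (y - y') - s (x - x') (y - y').
  by rewrite !sipBl !sipBr; ring.
have h1 : nr (s (x - x') y) <= d * M.
  exact: le_trans (CauchySchwarz _ _ _) (ler_pM (sn_ge0 _ _) (sn_ge0 _ _) hx yM).
have h2 : nr (s x (y - y')) <= M * d.
  exact: le_trans (CauchySchwarz _ _ _) (ler_pM (sn_ge0 _ _) (sn_ge0 _ _) xM hy).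
have h3 : nr (s (x - x') (y - y')) <= M * d.
  apply: le_trans (CauchySchwarz _ _ _) _.
  exact: le_trans (ler_pM (sn_ge0 _ _) (sn_ge0 _ _) hx hy) (ler_wpM2r d0 dM).
apply: le_trans (ler_nrD _ _) _; rewrite nrN.
apply: le_trans (lerD (ler_nrD _ _) (lexx _)) _.
by apply: le_trans (lerD (lerD h1 h2) h3) _; rewrite le_eqVlt; apply/orP; left; apply/eqP; ring.
Qed.

End Gram.

Section semicontinuity.
Variables (R : realType) (X : topologicalType).
Implicit Types (f g : X -> R) (x : X).

Definition lsc f x := forall c, c < f x -> \forall y \near x, c < f y.
Definition usc f x := forall c, f x < c -> \forall y \near x, f y < c.

Lemma semicontinuousP f x : f @ x --> f x <-> lsc f x /\ usc f x.
Proof.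
split=> [/cvgrPdist_lt fc|[fl fu]].
  split=> c hc.
    have := fc (f x - c); rewrite subr_gt0 => /(_ hc); apply: filterS => y.
    by rewrite ltr_norml => /andP[_]; rewrite ltrD2l ltrN2.
  have := fc (c - f x); rewrite subr_gt0 => /(_ hc); apply: filterS => y.
  by rewrite distrC ltr_norml => /andP[_]; rewrite ltrD2r.
apply/cvgrPdist_lt => e e0.
have h1 : f x - e < f x by rewrite gtrDl oppr_lt0.
have h2 : f x < f x + e by rewrite ltrDl.
apply: filterS2 (fl _ h1) (fu _ h2) => y; rewrite ltrBlDr ltr_distl => ? ?.
by rewrite ltrBlDr; apply/andP.
Qed.

Lemma powR_inv_lt (q c t : R) : 0 < q -> 0 <= c -> 0 <= t -> (c < t `^ q) = (c `^ q^-1 < t).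
Proof.
move=> q0 c0 t0; have cE : c = (c `^ q^-1) `^ q.
  by rewrite -powRrM mulVf ?gt_eqF// powRr1.
apply/idP/idP => h; last first.
  by rewrite cE; apply: gt0_ltr_powR; rewrite ?nnegrE ?powR_ge0.
rewrite ltNge; apply/negP => ht; move: h; rewrite ltNge => /negP; apply.
by rewrite [leRHS]cE; apply: ge0_ler_powR => //; rewrite ?nnegrE ?powR_ge0 ?ltW.
Qed.

Lemma powR_inv_gt (q c t : R) : 0 < q -> 0 <= c -> 0 <= t -> (t `^ q < c) = (t < c `^ q^-1).
Proof.
move=> q0 c0 t0; have cE : c = (c `^ q^-1) `^ q.
  by rewrite -powRrM mulVf ?gt_eqF// powRr1.
apply/idP/idP => h; last first.
  by rewrite cE; apply: gt0_ltr_powR; rewrite ?nnegrE ?powR_ge0.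
rewrite ltNge; apply/negP => ht; move: h; rewrite ltNge => /negP; apply.
by rewrite [leLHS]cE; apply: ge0_ler_powR => //; rewrite ?nnegrE ?powR_ge0 ?ltW.
Qed.

Lemma lsc_powR f x (q : R) : 0 < q -> (forall y, 0 <= f y) -> lsc f x ->
  lsc (fun y => f y `^ q) x.
Proof.
move=> q0 f0 fl c; have [c0|c0 _] := leP 0 c; last first.
  by apply: nearW => y; exact: lt_le_trans c0 (powR_ge0 _ _).
rewrite powR_inv_lt// => /fl; apply: filterS => y.
by rewrite powR_inv_lt.
Qed.

Lemma usc_powR f x (q : R) : 0 < q -> (forall y, 0 <= f y) ->
  usc (fun y => f y `^ q) x <-> usc f x.
Proof.
move=> q0 f0; split=> fu c hc.
  have c0 : 0 < c by exact: le_lt_trans hc.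
  have : f x `^ q < c `^ q by apply: gt0_ltr_powR; rewrite ?nnegrE ?(ltW c0).
  move=> /fu; apply: filterS => y; apply: contraTT; rewrite -!leNgt => h.
  by apply: ge0_ler_powR; rewrite ?nnegrE ?(ltW c0) ?(ltW q0).
have c0 : 0 < c by apply: le_lt_trans hc; exact: powR_ge0.
move: hc; rewrite powR_inv_gt ?f0 ?(ltW c0)// => /fu; apply: filterS => y.
by rewrite powR_inv_gt ?f0 ?(ltW c0).
Qed.

(** Near x, f k is at most g minus the other terms of a partial sum that almost exhausts g at x; g
    is upper and the subtracted terms are lower semicontinuous. *)
Lemma usc_of_sum (f : nat -> X -> R) g x k : (forall j y, 0 <= f j y) ->
  (forall j, lsc (f j) x) -> (forall y n, \sum_(j < n) f j y <= g y) ->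
  (forall e, 0 < e -> exists n, g x <= \sum_(j < n) f j x + e) ->
  usc g x -> usc (f k) x.
Proof.
move=> f0 fl fg ga gu c hc.
pose d := c - f k x; have d0 : 0 < d by rewrite subr_gt0.
have d3 : 0 < d / 3 by rewrite divr_gt0.
have [n gn] := ga _ d3.
pose m := (n + k).+1; have km : (k < m)%N by rewrite ltnS leq_addl.
have gm : g x <= \sum_(j < m) f j x + d / 3.
  apply: le_trans gn _; rewrite lerD2r /m -addnS big_split_ord/= lerDl.
  by apply: sumr_ge0 => j _.
have m0 : 0 < m%:R :> R by rewrite ltr0n.
have dm : 0 < d / 3 / m%:R by rewrite divr_gt0.
have h1 : \forall y \near x, g y < g x + d / 3 by apply: gu; rewrite ltrDl.
have h2 : \forall y \near x, forall j : 'I_m, f j x - d / 3 / m%:R < f j y.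
  by apply: filter_forall => j; apply: fl; rewrite gtrDl oppr_lt0.
apply: filterS2 h1 h2 => y hg hf.
pose i := Ordinal km.
have := fg y m; rewrite (bigD1 i)//= => hy.
move: gm; rewrite (bigD1 i)//= => gm.
have hs : \sum_(j < m | j != i) f j x - d / 3 <= \sum_(j < m | j != i) f j y.
  have : \sum_(j < m | j != i) (f j x - d / 3 / m%:R) <= \sum_(j < m | j != i) f j y.
    by apply: ler_sum => j _; exact/ltW/hf.
  apply: le_trans; rewrite sumrB lerD2l lerN2 sumr_const.
  rewrite -[leLHS]mulr_natr mulrAC ler_pdivrMr// ler_wpM2l ?(ltW d3)// ler_nat.
  by apply: leq_trans (max_card _) _; rewrite card_ord.
by move: hg hy gm hs; rewrite /d; set A := \sum_(_ < _ | _) _; set B := \sum_(_ < _ | _) _; lra.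
Qed.

End semicontinuity.

Lemma sip_svd (R : realType) (V : lmodType R[i]) (s : semiInner V) T T' e i j :
  adjoints s T T' -> svd s T T' e ->
  s (T (e i)) (T (e j)) = (if i == j then sn s (T (e i)) ^+ 2 else 0)%:C.
Proof.
move=> TT [fon he _]; have [<-|ij] := eqVneq i j; first exact: sip_sqr.
by rewrite (dot_TT TT) he sipZl fon.1// mulr0.
Qed.

Lemma sip_onf (R : realType) (V : lmodType R[i]) (s : semiInner V) e i j :
  onf s e -> s (e i) (e j) = (if i == j then sn s (e i) ^+ 2 else 0)%:C.
Proof.
by move=> fon; have [<-|ij] := eqVneq i j; [exact: sip_sqr|exact: fon.1].
Qed.

Section local_approximation.
Variables (R : realType) (A : commCstarAlgebra R) (E : hilbertModule A).
Variables (chi0 : character A) (T T' : E -> E) (TT : hm_adjoints T T').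
Local Notation H0 := (localized_space E chi0).
Local Notation s0 := (hs_inner H0).
Local Notation T0 := (localized_op chi0 T).

(** By density the vectors are moved into E, where the finitely many inner products are elements of
    A and thus vary continuously with chi. *)
Lemma lift (e : nat -> H0) n (eta : R) : (forall i, sn s0 (e i) <= 1) -> 0 < eta ->
  exists v : nat -> E, \forall chi \near chi0, forall i j, (i < n)%N -> (j < n)%N ->
    nr ((chi : character A) (hm_inner (v i) (v j)) - s0 (e i) (e j)) <= eta /\
    nr (chi (hm_inner (T (v i)) (T (v j))) - s0 (T0 (e i)) (T0 (e j))) <= eta.
Proof.
move=> e1 eta0; have [C C0 TC] := adjointable_bounded TT.
have TC0 := localized_op_bounded (chi := chi0) TT C0 TC.
have T0l := adjoints_linear (@hs_definite R H0) (localized_op_adjoints (chi := chi0) TT C0 TC).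
pose M := C + 1; have M1 : 1 <= M by rewrite lerDr.
have M0 : 0 < M := lt_le_trans ltr01 M1.
have q0 : 0 < 6 * M ^+ 2 + eta by rewrite addr_gt0// mulr_gt0// exprn_gt0.
(* Keeps d at most 1 and the error 3 M (M d) from [sip_near] at most eta / 2; the other half of eta
   is for moving chi. *)
pose d := eta / (6 * M ^+ 2 + eta).
have d0 : 0 < d by rewrite divr_gt0.
have d1 : d <= 1 by rewrite ler_pdivrMr// mul1r lerDr mulr_ge0// sqr_ge0.
have dM : 3 * M * (M * d) <= eta / 2.
  rewrite /d ler_pdivlMr//.
  have -> : 3 * M * (M * (eta / (6 * M ^+ 2 + eta))) * 2 = 6 * M ^+ 2 * eta / (6 * M ^+ 2 + eta).
    by field; rewrite gt_eqF.
  by rewrite ler_pdivrMr// mulrC ler_wpM2l ?(ltW eta0)// lerDl ltW.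
have dM1 : 3 * 1 * d <= eta / 2.
  apply: le_trans dM; rewrite -!mulrA ler_wpM2l// ler_pM ?(ltW d0)//.
  by rewrite ler_peMl// ltW.
have [v hv] := choice (fun i => emb_dense (e i) d0).
have h1 i j : nr (chi0 (hm_inner (v i) (v j)) - s0 (e i) (e j)) <= eta / 2.
  have := sip_near (e1 i) (e1 j) d1 (hv i) (hv j).
  by rewrite dot_emb => h; exact: le_trans h dM1.
have T1 i : sn s0 (T0 (e i)) <= M.
  apply: le_trans (TC0 _) _; apply: le_trans (ler_wpM2l C0 (e1 i)) _.
  by rewrite mulr1 lerDl.
have Tv i : sn s0 (T0 (e i) - embed (localized_form E chi0) (T (v i))) <= M * d.
  rewrite -(localized_op_emb chi0 TT C0 TC) -(linB _ _ T0l).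
  apply: le_trans (TC0 _) _; apply: le_trans (ler_wpM2l C0 (hv i)) _.
  by rewrite ler_wpM2r ?(ltW d0)// lerDl.
have h2 i j : nr (chi0 (hm_inner (T (v i)) (T (v j))) - s0 (T0 (e i)) (T0 (e j))) <= eta / 2.
  have MdM : M * d <= M by rewrite ler_piMr// ltW.
  have := sip_near (T1 i) (T1 j) MdM (Tv i) (Tv j).
  by rewrite dot_emb => h; exact: le_trans h dM.
have e2 : 0 < eta / 2 by rewrite divr_gt0.
exists v.
have h3 : \forall chi \near chi0, forall q : 'I_n * 'I_n,
    nr ((chi : character A) (hm_inner (v q.1) (v q.2)) - chi0 (hm_inner (v q.1) (v q.2))) <= eta / 2 /\
    nr (chi (hm_inner (T (v q.1)) (T (v q.2))) - chi0 (hm_inner (T (v q.1)) (T (v q.2)))) <= eta / 2.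
  apply: (filter_forall (nbhs_filter chi0)) => q.
  exact: filterI (character_near chi0 _ e2) (character_near chi0 _ e2).
apply: filterS h3 => chi h i j ni nj.
have [a1 a2] := h (Ordinal ni, Ordinal nj).
split.
  have -> : chi (hm_inner (v i) (v j)) - s0 (e i) (e j) =
    (chi (hm_inner (v i) (v j)) - chi0 (hm_inner (v i) (v j))) +
    (chi0 (hm_inner (v i) (v j)) - s0 (e i) (e j)) by rewrite addrA subrK.
  rewrite (splitr eta); exact: le_trans (ler_nrD _ _) (lerD a1 (h1 i j)).
have -> : chi (hm_inner (T (v i)) (T (v j))) - s0 (T0 (e i)) (T0 (e j)) =
    (chi (hm_inner (T (v i)) (T (v j))) - chi0 (hm_inner (T (v i)) (T (v j)))) +
    (chi0 (hm_inner (T (v i)) (T (v j))) - s0 (T0 (e i)) (T0 (e j))) by rewrite addrA subrK.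
rewrite (splitr eta); exact: le_trans (ler_nrD _ _) (lerD a2 (h2 i j)).
Qed.

(* The vectors v i are almost singular vectors of T at every character near chi0. *)
Lemma lift_svd n (eta : R) : compact_op s0 T0 -> 0 < eta ->
  exists (v : nat -> E) (d : nat -> R),
    [/\ forall i, d i <= 1,
        forall i, d i * sv chi0 T i ^+ 2 = sv chi0 T i ^+ 2
      & \forall chi \near chi0, forall i j, (i < n)%N -> (j < n)%N ->
    nr ((chi : character A) (hm_inner (v i) (v j)) - (if i == j then d i else 0)%:C) <= eta /\
    nr (chi (hm_inner (T (v i)) (T (v j))) - (if i == j then sv chi0 T i ^+ 2 else 0)%:C) <= eta].
Proof.
move=> Tc eta0; have [C C0 TC] := adjointable_bounded TT.
have TA := localized_op_adjoints (chi := chi0) TT C0 TC.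
have TC0 := localized_op_bounded (chi := chi0) TT C0 TC.
have [e Te] := exists_svd (@hs_definite R H0) TA C0 TC0 Tc (@hs_complete R H0).
have svE i : sv chi0 T i = sn s0 (T0 (e i)) := svd_gelfand (@hs_definite R H0) TA Te i.
have [fon _ _] := Te.
have [v hv] := lift n (onf_le1 fon) eta0.
exists v, (fun i => sn s0 (e i) ^+ 2); split.
- by move=> i; rewrite -(expr1n R 2) lerXn2r ?nnegrE ?sn_ge0// onf_le1.
- move=> i; rewrite svE; have [e0|->] := fon.2 i; last by rewrite expr1n mul1r.
  by rewrite e0 (lin0 (adjoints_linear (@hs_definite R H0) TA)) !sn0 expr0n mulr0.
- apply: filterS hv => chi h i j ni nj; have := h i j ni nj.
  by rewrite (sip_onf i j fon) (sip_svd i j TA Te) svE.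
Qed.

(** Whatever k vectors are prescribed at chi, [kernel_comb] finds a combination of the k + 1 lifted
    singular vectors orthogonal to them, and T stretches it by almost [sv chi0 T k]. *)
Lemma sv_lsc k : compact_op s0 T0 -> lsc (fun chi => sv chi T k) chi0.
Proof.
move=> Tc c hc; have [c0|c0] := ltP c 0.
  apply: filterS (@filterT _ _ (nbhs_filter chi0)) => chi _.
  exact: lt_le_trans c0 (sv_ge0 _ _ _).
pose a := sv chi0 T k; pose b := (c + a) / 2.
have cb : c < b by rewrite /b ltr_pdivlMr// mulr_natr mulr2n ltrD2l.
have ba : b < a by rewrite /b ltr_pdivrMr// mulr_natr mulr2n ltrD2r.
have b0 : 0 <= b := le_trans c0 (ltW cb).
have q0 : 0 < 1 + b ^+ 2 by rewrite ltr_pwDl// sqr_ge0.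
have ab : 0 < a ^+ 2 - b ^+ 2 by rewrite subr_gt0 ltrXn2r// ?nnegrE ?(ltW ba) ?sv_ge0.
(* The solution of a^2 - eps = b^2 (1 + eps), so that Gram errors of size eps still leave the ratio
   b. The division by k + 1 below absorbs the factor n of [Gram_dist]. *)
pose eps := (a ^+ 2 - b ^+ 2) / (1 + b ^+ 2).
have eps0 : 0 < eps by rewrite divr_gt0.
have eta0 : 0 < eps / k.+1%:R by rewrite divr_gt0.
have [v [d [d1 _ hv]]] := lift_svd k.+1 Tc eta0.
apply: filterS hv => chi h; apply: (lt_le_trans cb).
have [C C0 TC] := adjointable_bounded TT.
have TA := localized_op_adjoints (chi := chi) TT C0 TC.
have TC1 := localized_op_bounded (chi := chi) TT C0 TC.
have Tl := adjoints_linear (@hs_definite R (localized_space E chi)) TA.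
apply: gelfand_ge.
  by exists C; split=> //; exact: gelfand_le_bounded.
move=> t t0 [f fk hf].
pose s := hs_inner (localized_space E chi).
pose w i : localized_space E chi := embed (localized_form E chi) (v i).
have [z [z1 zf]] := kernel_comb s w fk.
have epsE : eps / k.+1%:R * k.+1%:R * 1 = eps by rewrite mulr1 divfK// pnatr_eq0.
have g1 : sn s (\sum_(i < k.+1) z i *: w i) ^+ 2 <= 1 + eps.
  have := @Gram_dist R (localized_space E chi) s w d (eps / k.+1%:R) k.+1 z.
  rewrite z1 epsE => G; have := G _; rewrite ler_norml => /(_ _)/andP[|_].
    by move=> i j ni nj; rewrite dot_emb; exact: (h i j ni nj).1.
  rewrite lerBlDr addrC => h1; apply: le_trans h1 _; rewrite lerD2r -z1.
  by apply: ler_sum => i _; rewrite ler_piMr// sqr_ge0.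
have g2 : a ^+ 2 - eps <= sn s (localized_op chi T (\sum_(i < k.+1) z i *: w i)) ^+ 2.
  have -> : localized_op chi T (\sum_(i < k.+1) z i *: w i) =
      \sum_(i < k.+1) z i *: embed (localized_form E chi) (T (v i)).
    rewrite (big_morph _ (fun x y => linD x y Tl) (lin0 Tl)).
    apply: eq_bigr => i _.
    by rewrite (linZ _ _ Tl) (localized_op_emb chi TT C0 TC).
  have := @Gram_dist R (localized_space E chi) s
    (fun i => embed (localized_form E chi) (T (v i))) (fun i => sv chi0 T i ^+ 2)
    (eps / k.+1%:R) k.+1 z.
  rewrite z1 epsE => G; have := G _; rewrite ler_norml => /(_ _)/andP[|h1 _].
    by move=> i j ni nj; rewrite dot_emb; exact: (h i j ni nj).2.
  move: h1; rewrite lerBrDr addrC => h1; apply: le_trans h1; rewrite lerD2r.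
  rewrite -[a ^+ 2]mul1r -z1 mulr_suml; apply: ler_sum => i _.
  rewrite ler_wpM2l ?sqr_ge0// lerXn2r ?nnegrE ?sv_ge0//.
  by apply: (sv_anti chi0 TT); rewrite -ltnS.
have g3 := hf _ zf.
have g4 : a ^+ 2 - eps <= t ^+ 2 * (1 + eps).
  apply: le_trans g2 _; apply: le_trans (_ : (t * sn s (\sum_(i < k.+1) z i *: w i)) ^+ 2 <= _).
    by rewrite lerXn2r ?nnegrE ?mulr_ge0 ?sn_ge0.
  by rewrite exprMn ler_wpM2l ?sqr_ge0.
have epE : a ^+ 2 - eps = b ^+ 2 * (1 + eps).
  by rewrite /eps; field; rewrite gt_eqF.
move: g4; rewrite epE ler_pM2r ?addr_gt0// => g5.
by rewrite -(ler_pXn2r (n := 2)) ?nnegrE.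
Qed.

End local_approximation.

(** * From Schatten class to compactness *)

Section Bessel_families.
Variables (R : realType) (V : lmodType R[i]) (s : semiInner V).

(** The map z -> (<w_i, z>) is adjoint to forming combinations of the w_i and has the same norm; the
    test coefficients are c_i = <w_i, z>. *)
Lemma Bessel_of_comb (w : nat -> V) k (B : R) : 0 <= B ->
  (forall c : nat -> R[i], sn s (\sum_(i < k) c i *: w i) ^+ 2 <= B * \sum_(i < k) nr (c i) ^+ 2) ->
  forall z, \sum_(i < k) nr (s (w i) z) ^+ 2 <= B * sn s z ^+ 2.
Proof.
move=> B0 hw z; set N := \sum_(i < k) _.
have N0 : 0 <= N by apply: sumr_ge0 => i _; exact: sqr_ge0.
have [->|Nn] := eqVneq N 0; first by rewrite mulr_ge0// sqr_ge0.
have Np : 0 < N by rewrite lt_neqAle eq_sym Nn.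
have NE : nr (s (\sum_(i < k) s (w i) z *: w i) z) = N.
  have -> : s (\sum_(i < k) s (w i) z *: w i) z = N%:C.
    rewrite sip_suml rmorph_sum/=; apply: eq_bigr => i _.
    by rewrite sipZl nr_conjM.
  by rewrite nr_real ger0_norm.
have h := CauchySchwarz s (\sum_(i < k) s (w i) z *: w i) z.
rewrite NE in h.
have h2 : N ^+ 2 <= B * N * sn s z ^+ 2.
  apply: le_trans (_ : (sn s (\sum_(i < k) s (w i) z *: w i) * sn s z) ^+ 2 <= _).
    by rewrite lerXn2r ?nnegrE ?mulr_ge0 ?sn_ge0.
  by rewrite exprMn ler_wpM2r ?sqr_ge0//; exact: (hw (fun i => s (w i) z)).
by move: h2; rewrite expr2 [B * N]mulrC -mulrA ler_pM2l.
Qed.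

Variables (u : nat -> V) (k : nat).
Hypothesis uB : forall z, \sum_(j < k) nr (s (u j) z) ^+ 2 <= sn s z ^+ 2.

Definition defect_dot x y : R[i] := s x y - \sum_(j < k) s x (u j) * s (u j) y.

Lemma defect_linear x a y z :
  defect_dot x (a *: y + z) = a * defect_dot x y + defect_dot x z.
Proof.
rewrite /defect_dot sip_linear.
have -> : \sum_(j < k) s x (u j) * s (u j) (a *: y + z) =
    a * \sum_(j < k) s x (u j) * s (u j) y + \sum_(j < k) s x (u j) * s (u j) z.
  by rewrite mulr_sumr -big_split/=; apply: eq_bigr => j _; rewrite sip_linear; ring.
by ring.
Qed.

Lemma defect_conj x y : (defect_dot x y)^* = defect_dot y x.
Proof.
rewrite /defect_dot rmorphB/= sip_conj rmorph_sum/=; congr (_ - _).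
by apply: eq_bigr => j _; rewrite rmorphM/= !sip_conj mulrC.
Qed.

Lemma defect_sqr x : defect_dot x x = (sn s x ^+ 2 - \sum_(j < k) nr (s (u j) x) ^+ 2)%:C.
Proof.
rewrite /defect_dot sip_sqr rmorphB/=; congr (_ - _).
by rewrite rmorph_sum/=; apply: eq_bigr => j _; rewrite -sip_conj nr_conjM.
Qed.

Lemma defect_ge0 x : 0 <= defect_dot x x.
Proof. by rewrite defect_sqr lecR subr_ge0. Qed.

Definition defect_form := SemiInner defect_linear defect_conj defect_ge0.

(* Cauchy-Schwarz for the form <x, (1 - w) z> with w = sum_j |u_j><u_j| <= 1. *)
Lemma Bessel_extend x z :
  \sum_(j < k) nr (s (u j) z) ^+ 2 * sn s x ^+ 2 +
  nr (s (x - \sum_(j < k) s (u j) x *: u j) z) ^+ 2 <= sn s x ^+ 2 * sn s z ^+ 2.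
Proof.
have yE : s (x - \sum_(j < k) s (u j) x *: u j) z = defect_form x z.
  rewrite sipBl sip_suml; congr (_ - _); apply: eq_bigr => j _.
  by rewrite sipZl sip_conj.
have sqrE y : sn defect_form y ^+ 2 = sn s y ^+ 2 - \sum_(j < k) nr (s (u j) y) ^+ 2.
  by apply: complexI; rewrite -sip_sqr; exact: defect_sqr.
have h : nr (defect_form x z) ^+ 2 <= sn s x ^+ 2 * (sn s z ^+ 2 - \sum_(j < k) nr (s (u j) z) ^+ 2).
  apply: le_trans (_ : (sn defect_form x * sn defect_form z) ^+ 2 <= _).
    by rewrite lerXn2r ?nnegrE ?mulr_ge0 ?sn_ge0 ?nr_ge0// CauchySchwarz.
  rewrite exprMn !sqrE ler_wpM2r ?subr_ge0//.
  by rewrite lerBlDr lerDl; apply: sumr_ge0 => j _; exact: sqr_ge0.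
rewrite yE -mulr_suml; apply: le_trans (lerD (lexx _) h) _.
by rewrite le_eqVlt; apply/orP; left; apply/eqP; ring.
Qed.

(** The defect of x extends u to a Bessel family of k + 1 members, so Ky Fan leaves for its image
    only what the first k vectors do not exhaust. *)
Lemma KyFan_tail T T' e x : definite s -> adjoints s T T' -> svd s T T' e ->
  sn s (T (x - \sum_(j < k) s (u j) x *: u j)) ^+ 2 <=
  (\sum_(i < k.+1) sn s (T (e i)) ^+ 2 - \sum_(j < k) sn s (T (u j)) ^+ 2) * sn s x ^+ 2.
Proof.
move=> sd TT Te; have Tl := adjoints_linear sd TT.
have [x0|xn] := eqVneq (sn s x) 0.
  have -> : x = 0 := sd _ x0.
  have -> : \sum_(j < k) s (u j) 0 *: u j = 0.
    by rewrite big1// => j _; rewrite sip0r scale0r.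
  by rewrite subrr (lin0 Tl) sn0 expr0n mulr0.
have xp : 0 < sn s x by rewrite lt_neqAle eq_sym xn sn_ge0.
set y := x - _.
(* The division is by |x|, not by |y|: with this scaling [Bessel_extend] yields Bessel's inequality
   although u is not orthonormal. *)
pose f j := if (j < k)%N then u j else ((sn s x)^-1)%:C *: y.
have fu (j : 'I_k) : f j = u j by rewrite /f ltn_ord.
have fk : f k = ((sn s x)^-1)%:C *: y by rewrite /f ltnn.
have fB z : \sum_(j < k.+1) nr (s (f j) z) ^+ 2 <= sn s z ^+ 2.
  rewrite big_ord_recr/= fk sipZl conj_real nrM nr_real.
  under eq_bigr do rewrite fu.
  rewrite ger0_norm ?invr_ge0 ?sn_ge0// exprMn exprVn.
  have := Bessel_extend x z; rewrite -/y -mulr_suml => h.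
  have x2 : 0 < sn s x ^+ 2 by rewrite exprn_gt0.
  rewrite -(ler_pM2l x2) mulrDr [X in X + _]mulrC; apply: le_trans h.
  by rewrite lerD2l mulVKf// gt_eqF.
have := svd_KyFan sd TT Te fB; rewrite big_ord_recr/= fk (linZ _ _ Tl) snZ.
rewrite nr_real ger0_norm ?invr_ge0 ?sn_ge0// exprMn exprVn => h.
have -> : \sum_(j < k) sn s (T (u j)) ^+ 2 = \sum_(j < k) sn s (T (f j)) ^+ 2.
  by apply: eq_bigr => j _; rewrite fu.
have x2 : 0 < sn s x ^+ 2 by rewrite exprn_gt0.
by rewrite -ler_pdivrMr// lerBrDl mulrC.
Qed.

End Bessel_families.

Section compactness_estimate.
Variables (R : realType) (A : commCstarAlgebra R) (E : hilbertModule A).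
Variables (T T' : E -> E) (TT : hm_adjoints T T').

Definition almost_controlled (eps : R) (l : seq E) (chi : character A) :=
  forall x, sn (localized_form E chi) (T x) <= eps * sn (localized_form E chi) x +
    \sum_(v <- l) nr (chi (hm_inner v x)).

(** Bookkeeping for [near_estimate]: S sums the first k squared singular values at chi0, and s is
    the next one. Linearising the quotient by (1 + x)^-1 >= 1 - x produces the constant 2 k + 1 + k
    S. *)
Lemma KyFan_slack (k : nat) (eta s S sig Tu eps : R) : 0 <= eta -> 0 <= S ->
  sig <= S + s + eta * k.+1%:R -> (S - eta * k%:R) / (1 + eta * k%:R) <= Tu ->
  eta * (2 * k%:R + 1 + k%:R * S) <= eps - s -> sig - Tu <= eps.
Proof.
move=> eta0 S0 h1 h2 h3; have k0 : 0 <= k%:R :> R by [].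
have a0 : 0 <= eta * k%:R by rewrite mulr_ge0.
have b1 : 0 < 1 + eta * k%:R by rewrite ltr_pwDl.
have : S - S * (eta * k%:R) - eta * k%:R <= Tu.
  apply: le_trans h2; rewrite ler_pdivlMr//; nra.
by move: h1 h3; rewrite -natr1; lra.
Qed.

Lemma ler_of_sqr (t c : R) : t ^+ 2 <= c -> t <= 1 + c.
Proof. by move=> h; apply: le_trans (lerD (lexx 1) h); nra. Qed.

(** At nearby chi, upper semicontinuity bounds the first k + 1 singular values from above and the
    lifted vectors nearly exhaust the first k. So [KyFan_tail] bounds T by eps off these vectors,
    and the components along them are inner products with elements of E. *)
Lemma near_estimate chi0 k (eps : R) :
  (forall chi, compact_op (hs_inner (localized_space E chi)) (localized_op chi T)) ->
  (forall i, usc (fun chi => sv chi T i) chi0) -> sv chi0 T k < eps ->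
  exists l, \forall chi \near chi0, almost_controlled eps l chi.
Proof.
move=> Tc su hk; have [C C0 TC] := adjointable_bounded TT.
have eps0 : 0 < eps := le_lt_trans (sv_ge0 _ _ _) hk.
pose S := \sum_(j < k) sv chi0 T j ^+ 2.
have S0 : 0 <= S by apply: sumr_ge0 => j _; exact: sqr_ge0.
have kk : 0 <= k%:R :> R by [].
have k1 : 0 < 2 * k%:R + 1 + k%:R * S by rewrite ltr_pwDl ?mulr_ge0// ltr_wpDl// mulr_ge0.
have gap : 0 < eps ^+ 2 - sv chi0 T k ^+ 2.
  by rewrite subr_gt0 ltrXn2r ?nnegrE ?sv_ge0 ?ltW.
pose eta := (eps ^+ 2 - sv chi0 T k ^+ 2) / (2 * k%:R + 1 + k%:R * S).
have eta0 : 0 < eta by rewrite divr_gt0.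
have etaE : eta * (2 * k%:R + 1 + k%:R * S) <= eps ^+ 2 - sv chi0 T k ^+ 2.
  by rewrite divfK// gt_eqF.
have [v [d [d1 _ hv]]] := lift_svd TT k (Tc chi0) eta0.
(* Bounds the Gram matrix of the lifted vectors; division by the root of B makes them a Bessel
   family. *)
pose B := 1 + eta * k%:R.
have B1 : 1 <= B by rewrite lerDl mulr_ge0// ltW.
have B0 : 0 < B := lt_le_trans ltr01 B1.
(* Dominates |T w_j|, whose square is at most S + eta, through t <= 1 + t^2. *)
pose K := 1 + S + eta.
have K0 : 0 <= K by rewrite addr_ge0 ?(ltW eta0)// addr_ge0.
have hs : \forall chi \near chi0, forall i : 'I_k.+1,
    sv chi T i `^ 2%:R < sv chi0 T i ^+ 2 + eta.
  apply: (filter_forall (nbhs_filter chi0)) => i.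
  have p2 : 0 < 2%:R :> R by [].
  apply: ((usc_powR chi0 p2 (fun chi => sv_ge0 chi T i)).2 (su i)).
  by rewrite powR_mulrn ?sv_ge0// ltrDl.
exists [seq K%:C *: v i | i <- index_iota 0 k].
apply: filterS2 hv hs => chi hg hs x.
have TA := localized_op_adjoints (chi := chi) TT C0 TC.
have TC1 := localized_op_bounded (chi := chi) TT C0 TC.
have sd := @hs_definite R (localized_space E chi).
have Tl := adjoints_linear sd TA.
have [e Te] := exists_svd sd TA C0 TC1 (Tc chi) (@hs_complete R (localized_space E chi)).
pose s := hs_inner (localized_space E chi).
pose emb : E -> localized_space E chi := embed (localized_form E chi).
pose w i := emb (v i).
pose r := Num.sqrt B.
have rB : r ^+ 2 = B by rewrite sqr_sqrtr// ltW.
have r0 : 0 < r by rewrite sqrtr_gt0.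
have r1 : 1 <= r by rewrite -sqrtr1 ler_wsqrtr.
have ri1 : r^-1 <= 1 by rewrite invf_le1.
have ri0 : 0 <= r^-1 by rewrite invr_ge0 ltW.
pose u i := (r^-1)%:C *: w i.
have wB z : \sum_(i < k) nr (s (w i) z) ^+ 2 <= B * sn s z ^+ 2.
  apply: Bessel_of_comb (ltW B0) _ z => c.
  have G := @Gram_dist R (localized_space E chi) s w d eta k c.
  have := G _; rewrite ler_norml => /(_ _)/andP[|_].
    by move=> i j ni nj; rewrite dot_emb; exact: (hg i j ni nj).1.
  rewrite lerBlDr => h; apply: le_trans h _.
  rewrite /B mulrDl mul1r addrC lerD2r.
  by apply: ler_sum => i _; rewrite ler_piMr// sqr_ge0.
have uE i z : nr (s (u i) z) = r^-1 * nr (s (w i) z).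
  by rewrite sipZl conj_real nrM nr_real ger0_norm.
have uB z : \sum_(i < k) nr (s (u i) z) ^+ 2 <= sn s z ^+ 2.
  under eq_bigr do rewrite uE exprMn exprVn rB.
  rewrite -mulr_sumr -(ler_pM2l B0) mulVKf ?gt_eqF//; exact: wB.
have Tw i : (i < k)%N -> `|sn s (localized_op chi T (w i)) ^+ 2 - sv chi0 T i ^+ 2| <= eta.
  move=> ik; have := (hg i i ik ik).2; rewrite eqxx -nr_real rmorphB/= -sip_sqr.
  by rewrite (localized_op_emb chi TT C0 TC) dot_emb.
have Tu i : localized_op chi T (u i) = (r^-1)%:C *: localized_op chi T (w i).
  exact: linZ.
have snTu i : sn s (localized_op chi T (u i)) = r^-1 * sn s (localized_op chi T (w i)).
  by rewrite Tu snZ nr_real ger0_norm.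
have svE i : sn s (localized_op chi T (e i)) = sv chi T i := esym (svd_gelfand sd TA Te i).
have slack : \sum_(i < k.+1) sn s (localized_op chi T (e i)) ^+ 2 -
    \sum_(j < k) sn s (localized_op chi T (u j)) ^+ 2 <= eps ^+ 2.
  apply: (@KyFan_slack k eta (sv chi0 T k ^+ 2) S _ _ _ (ltW eta0) S0 _ _ etaE).
    have -> : S + sv chi0 T k ^+ 2 + eta * k.+1%:R = \sum_(i < k.+1) (sv chi0 T i ^+ 2 + eta).
      by rewrite big_split/= sumr_const card_ord big_ord_recr/= mulr_natr.
    apply: ler_sum => i _; rewrite svE; apply: ltW.
    by have := hs i; rewrite powR_mulrn ?sv_ge0.
  have -> : S - eta * k%:R = \sum_(i < k) (sv chi0 T i ^+ 2 - eta).
    by rewrite sumrB sumr_const card_ord mulr_natr.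
  rewrite mulr_suml; apply: ler_sum => i _.
  rewrite snTu exprMn exprVn rB mulrC ler_wpM2l ?invr_ge0 ?(ltW B0)//.
  by have := Tw i (ltn_ord i); rewrite ler_norml lerBrDl => /andP[].
pose X := emb x.
pose y := X - \sum_(j < k) s (u j) X *: u j.
have Ty : sn s (localized_op chi T y) <= eps * sn s X.
  rewrite -(ler_pXn2r (n := 2)) ?nnegrE ?sn_ge0 ?mulr_ge0 ?(ltW eps0) ?sn_ge0//.
  apply: le_trans (KyFan_tail uB X sd TA Te) _.
  by rewrite exprMn ler_wpM2r ?sqr_ge0.
have XE : X = y + \sum_(j < k) s (u j) X *: u j by rewrite subrK.
have TX : sn (localized_form E chi) (T x) = sn s (localized_op chi T X).
  by rewrite (localized_op_emb chi TT C0 TC) sn_emb.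
have xX : sn (localized_form E chi) x = sn s X by rewrite sn_emb.
rewrite TX xX {1}XE (linD _ _ Tl); apply: le_trans (ler_snD _ _ _) (lerD Ty _).
rewrite (big_morph _ (fun x y => linD x y Tl) (lin0 Tl)).
apply: le_trans (sn_sum _ _ _ _) _.
rewrite big_map big_mkord; apply: ler_sum => j _.
rewrite (linZ _ _ Tl) snZ uE snTu.
have -> : nr (chi (hm_inner (K%:C *: v j) x)) = K * nr (s (w j) X).
  rewrite dot_emb -[chi _]/(localized_form E chi (K%:C *: v j) x) sipZl conj_real.
  by rewrite nrM nr_real ger0_norm.
have TwK : sn s (localized_op chi T (w j)) <= K.
  have h : sn s (localized_op chi T (w j)) ^+ 2 <= S + eta.
    have := Tw j (ltn_ord j); rewrite ler_norml lerBlDl => /andP[_ h].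
    apply: le_trans h _; rewrite lerD2r /S (bigD1 j)//= lerDl.
    by apply: sumr_ge0 => i _; exact: sqr_ge0.
  by rewrite /K -addrA; exact: ler_of_sqr h.
rewrite [leRHS]mulrC; apply: ler_pM.
- exact: mulr_ge0 ri0 (nr_ge0 _).
- exact: mulr_ge0 ri0 (sn_ge0 _ _).
- by rewrite ler_piMl ?nr_ge0.
- by apply: le_trans TwK; rewrite ler_piMl ?sn_ge0.
Qed.

End compactness_estimate.

(** * Damping by a positive finite rank operator *)

Section damping.
Variables (R : realType) (V : lmodType R[i]) (s : semiInner V) (h : V -> V) (M : R).
Hypotheses (M0 : 0 < M) (hl : linear h) (hh : adjoints s h h).
Hypothesis hM : forall x, sn s (h x) ^+ 2 <= M * complex.Re (s x (h x)).

Definition damp x := x - (M^-1)%:C *: h x.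
Let q x := complex.Re (s x (h x)).

Lemma damp_form_ge0 x : 0 <= q x.
Proof. by rewrite -(pmulr_rge0 _ M0); apply: le_trans (hM x); exact: sqr_ge0. Qed.

Lemma damp_bounded x : sn s (h x) <= M * sn s x.
Proof.
have [->|hn] := eqVneq (sn s (h x)) 0; first by rewrite mulr_ge0 ?sn_ge0 ?ltW.
have hp : 0 < sn s (h x) by rewrite lt_neqAle eq_sym hn sn_ge0.
rewrite -(ler_pM2l hp) -expr2; apply: le_trans (hM x) _.
rewrite mulrCA ler_wpM2l ?(ltW M0)// mulrC.
exact: le_trans (Re_le_nr _) (CauchySchwarz _ _ _).
Qed.

Lemma sn_damp x : sn s (damp x) ^+ 2 <= sn s x ^+ 2 - M^-1 * q x.
Proof.
have Mi : 0 < M^-1 by rewrite invr_gt0.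
rewrite sn_sqrB sipZr Re_realM snZ nr_real ger0_norm ?(ltW Mi)// exprMn -/(q x).
have := ler_wpM2l (ltW (exprn_gt0 2 Mi)) (hM x); rewrite -/(q x).
have -> : M^-1 ^+ 2 * (M * q x) = M^-1 * q x by field; rewrite gt_eqF.
set a := M^-1 * q x; set b := M^-1 ^+ 2 * _ => h1; lra.
Qed.

Lemma damp_form_le x : q (damp x) <= q x.
Proof.
have Mi : 0 < M^-1 by rewrite invr_gt0.
have hE : h (damp x) = h x - (M^-1)%:C *: h (h x) by rewrite (linB _ _ hl) (linZ _ _ hl).
have hhx : complex.Re (s (h x) (h (h x))) <= M * sn s (h x) ^+ 2.
  apply: le_trans (Re_le_nr _) _; apply: le_trans (CauchySchwarz _ _ _) _.
  by rewrite expr2 mulrCA ler_wpM2l ?sn_ge0// damp_bounded.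
have qE : q (damp x) = q x - 2 * M^-1 * sn s (h x) ^+ 2 +
    M^-1 ^+ 2 * complex.Re (s (h x) (h (h x))).
  have e1 : s x (h (h x)) = s (h x) (h x) by rewrite hh.
  rewrite /q hE sipBr !sipBl !sipZr !sipZl conj_real e1 !ReB !Re_realM sn_sqr.
  by rewrite /q; ring.
rewrite qE; have := ler_wpM2l (ltW (exprn_gt0 2 Mi)) hhx.
have -> : M^-1 ^+ 2 * (M * sn s (h x) ^+ 2) = M^-1 * sn s (h x) ^+ 2.
  by field; rewrite gt_eqF.
have : 0 <= M^-1 * sn s (h x) ^+ 2 by rewrite mulr_ge0 ?sqr_ge0 ?ltW.
rewrite -mulrA; set a := M^-1 * _; set b := M^-1 ^+ 2 * _ => h0 h1; lra.
Qed.

(** Every step lowers the squared seminorm by at least q / M, and q decreases along the iteration,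
    so n copies of the last value are covered. This gives a rate 1 / n without spectral calculus. *)
Lemma iter_damp n x :
  sn s (iter n damp x) ^+ 2 + n%:R * (M^-1 * q (iter n damp x)) <= sn s x ^+ 2.
Proof.
elim: n => [|n IH] /=; first by rewrite mul0r addr0.
apply: le_trans IH; set y := iter n damp x.
have Mi : 0 < M^-1 by rewrite invr_gt0.
have h1 := sn_damp y.
have h2 : n.+1%:R * (M^-1 * q (damp y)) <= n.+1%:R * (M^-1 * q y).
  by rewrite ler_wpM2l// ler_wpM2l ?(ltW Mi)// damp_form_le.
apply: le_trans (lerD h1 h2) _.
by rewrite -natr1 mulrDl mul1r; lra.
Qed.

End damping.

Section controlled_operators.
Variables (R : realType) (A : commCstarAlgebra R) (E : hilbertModule A).
Variables (T T' : E -> E) (TT : hm_adjoints T T').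

Lemma sn_act (chi : character A) (v : E) a :
  sn (localized_form E chi) (hm_act v a) = nr (chi a) * sn (localized_form E chi) v.
Proof. by rewrite -!sn_emb emb_act snZ. Qed.

Definition frame_op (l : seq E) : E -> E := finite_rank [seq (v, v) | v <- l].

Lemma frame_op_adjoints l : hm_adjoints (frame_op l) (frame_op l).
Proof.
have := finite_rank_adjoints [seq (v, v) | v <- l].
by rewrite -map_comp.
Qed.

Lemma frame_op_form (chi : character A) l x :
  complex.Re (localized_form E chi x (frame_op l x)) = \sum_(v <- l) nr (chi (hm_inner v x)) ^+ 2.
Proof.
rewrite /frame_op /finite_rank big_map sip_sumr Re_sum; apply: eq_bigr => v _.
rewrite -[localized_form _ _ _ _]/(chi (hm_inner x (hm_act v (hm_inner v x)))).
by rewrite hm_inner_act characterM -hm_inner_star character_star nr_conjM.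
Qed.

Lemma frame_op_sqr (chi : character A) l x :
  sn (localized_form E chi) (frame_op l x) ^+ 2 <=
  (\sum_(v <- l) nr v ^+ 2 + 1) * complex.Re (localized_form E chi x (frame_op l x)).
Proof.
rewrite frame_op_form /frame_op /finite_rank big_map.
set q := \sum_(v <- l) nr (chi _) ^+ 2.
have q0 : 0 <= q by apply: sumr_ge0 => v _; exact: sqr_ge0.
have S0 : 0 <= \sum_(v <- l) nr (chi (hm_inner v x)) * nr v.
  by apply: sumr_ge0 => v _; rewrite mulr_ge0 ?nr_ge0.
have h : sn (localized_form E chi) (\sum_(v <- l) rank_one v v x) <=
    \sum_(v <- l) nr (chi (hm_inner v x)) * nr v.
  apply: le_trans (sn_sum _ _ _ _) _; apply: ler_sum => v _.
  by rewrite sn_act ler_wpM2l ?nr_ge0 ?ns_le.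
apply: le_trans (_ : (\sum_(v <- l) nr (chi (hm_inner v x)) * nr v) ^+ 2 <= _).
  by rewrite lerXn2r ?nnegrE ?sn_ge0.
apply: le_trans (sum_CauchySchwarz _ (fun v => nr_ge0 _) (fun v => nr_ge0 _)) _.
by rewrite -/q mulrC ler_wpM2r// lerDl.
Qed.

Lemma sum_frame_sqr (chi : character A) l x :
  (\sum_(v <- l) nr (chi (hm_inner v x))) ^+ 2 <=
  (size l)%:R * complex.Re (localized_form E chi x (frame_op l x)).
Proof.
have := sum_CauchySchwarz l (a := fun=> 1) (b := fun v => nr (chi (hm_inner v x)))
  (fun=> ler01) (fun v => nr_ge0 _).
rewrite frame_op_form; under eq_bigr do rewrite mul1r.
by under [X in X * _]eq_bigr do rewrite expr1n; rewrite big_const_seq count_predT iter_addr_0.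
Qed.

Lemma controlled_compact :
  (forall eps : R, 0 < eps -> exists l, forall chi, almost_controlled T eps l chi) ->
  compact_operators E T.
Proof.
move=> hT; apply/compact_operatorsP; split; first by exists T'.
move=> e e0; have e2 : 0 < e / 2 by rewrite divr_gt0.
have [l hl] := hT _ e2.
(* The summand 1 keeps M positive when all v vanish or l is empty. *)
pose h := frame_op l; pose M := \sum_(v <- l) nr v ^+ 2 + 1.
have M0 : 0 < M by rewrite ltr_wpDl// sumr_ge0// => v _; exact: sqr_ge0.
have hh := frame_op_adjoints l.
have hlin := hm_adjoints_linear hh.
have Tl := hm_adjoints_linear TT.
have hM chi := @frame_op_sqr chi l.
pose D := damp h M.
pose m : R := (size l)%:R.
(* Makes m M / N at most (e / 2)^2: the squared control sum is at most m q, and q <= M |u|^2 / N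
   after N steps. *)
pose N := (Num.truncn (m * M / (e / 2) ^+ 2)).+1.
have N0 : 0 < N%:R :> R by rewrite ltr0n.
have hN : m * M / (e / 2) ^+ 2 <= N%:R by exact: ltW (truncnS_gt _).
have TD u : nr (T (iter N D u)) <= e * nr u.
  apply: le_ns => [|chi]; first by rewrite mulr_ge0 ?nr_ge0 ?ltW.
  pose s := localized_form E chi.
  pose q := complex.Re (s (iter N D u) (h (iter N D u))).
  have q0 : 0 <= q := damp_form_ge0 M0 (hM chi) _.
  have it := iter_damp M0 hlin (hm_adjoints_localized chi hh) (hM chi) N u.
  have Mi : 0 < M^-1 by rewrite invr_gt0.
  have t0 : 0 <= N%:R * (M^-1 * q) by rewrite mulr_ge0// mulr_ge0// ltW.
  have y1 : sn s (iter N D u) <= sn s u.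
    rewrite -(ler_pXn2r (n := 2)) ?nnegrE ?sn_ge0//; apply: le_trans it.
    by rewrite lerDl.
  have y2 : N%:R * (M^-1 * q) <= sn s u ^+ 2.
    by apply: le_trans it; rewrite lerDr sqr_ge0.
  have y3 : m * q <= (e / 2 * sn s u) ^+ 2.
    have e22 : 0 < (e / 2) ^+ 2 by rewrite exprn_gt0.
    rewrite exprMn -ler_pdivrMl//; apply: le_trans y2.
    have -> : ((e / 2) ^+ 2)^-1 * (m * q) = (m * M / (e / 2) ^+ 2) * (M^-1 * q).
      by field; rewrite !gt_eqF.
    by rewrite ler_wpM2r// mulr_ge0// ltW.
  have y4 : \sum_(v <- l) nr (chi (hm_inner v (iter N D u))) <= e / 2 * sn s u.
    have c0 : 0 <= e / 2 * sn s u := mulr_ge0 (ltW e2) (sn_ge0 _ _).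
    have d0 : 0 <= \sum_(v <- l) nr (chi (hm_inner v (iter N D u))).
      by apply: sumr_ge0 => v _; exact: nr_ge0.
    rewrite -(ler_pXn2r (n := 2)) ?nnegrE//.
    exact: le_trans (sum_frame_sqr chi l _) y3.
  have hlu := hl chi (iter N D u); apply: le_trans hlu _.
  apply: le_trans (lerD (ler_wpM2l (ltW e2) y1) y4) _.
  by rewrite -mulrDl -splitr ler_wpM2l ?(ltW e0)// ns_le.
have TDA n : exists S, hm_adjoints (fun u => T (iter n D u)) S.
  elim: n => [|n [S HS]]; first by exists T'.
  have DD := hm_adjointsD (fun u v => erefl (hm_inner u v))
    (hm_adjointsZ (- (M^-1)%:C) hh).
  have -> : (fun u => T (iter n.+1 D u)) =
      (fun u => T (iter n D u)) \o (fun u => u + - (M^-1)%:C *: h u).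
    by apply/funext => u; rewrite iterSr /= scaleNr.
  by eexists; exact: hm_adjoints_comp HS DD.
(* Telescoping: T D^n - T D^(n + 1) = M^-1 T D^n h, which has finite rank along with h. *)
have fr n : exists l', forall u, T u - T (iter n D u) = finite_rank l' u.
  elim: n => [|n [l' IH]]; first by exists [::] => u; rewrite subrr /finite_rank big_nil.
  have [S HS] := TDA n; have Sl := hm_adjoints_linear HS.
  exists (l' ++ [seq ((M^-1)%:C *: q.1, q.2) | q <-
    [seq (T (iter n D q.1), q.2) | q <- [seq (v, v) | v <- l]]]) => u.
  rewrite finite_rank_cat -IH -finite_rankZ -(finite_rank_comp _ _ HS).
  rewrite -(linZ _ _ Sl) -[finite_rank _ _]/(h u).
  have -> : T (iter n D ((M^-1)%:C *: h u)) = T (iter n D u) - T (iter n D (D u)).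
    by rewrite -(linB _ _ Sl) /D /damp opprB addrC subrK.
  by rewrite iterSr addrA subrK.
have [l' hl'] := fr N; exists l' => u.
by rewrite -hl' opprB addrC subrK; exact: TD.
Qed.

End controlled_operators.

(** * Uniform tails *)

(** If P failed for K, the sets B for which P holds on K minus B would form a proper filter
    containing K, and a cluster point in K contradicts the local hypothesis. *)
Lemma compact_local_ind (X : topologicalType) (K : set X) (P : set X -> Prop) :
  P set0 -> (forall A B, P A -> P B -> P (A `|` B)) ->
  (forall A B, A `<=` B -> P B -> P A) ->
  (forall x, K x -> exists2 U, nbhs x U & P U) -> compact K -> P K.
Proof.
move=> P0 PU PS Pl cK; apply: contrapT => nPK.
pose F : set_system X := [set B | P (K `\` B)].
have FF : ProperFilter F.
  apply: Build_ProperFilter_ex.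
    move=> B FB; apply: contrapT => nB; apply: nPK.
    apply: PS FB => x Kx; split=> // Bx; apply: nB; by exists x.
  split.
  - by rewrite /F /= setDT.
  - by move=> B C FB FC; rewrite /F /= setDIr; exact: PU.
  - by move=> B C BC; apply: PS => x [Kx nCx]; split=> // /BC.
have [|x [Kx clx]] := cK F FF; first by rewrite /F /= setDv.
have [U xU PUx] := Pl x Kx.
have FU : F (~` U) by apply: PS PUx => y [_ /contrapT].
by have [y [nU yU]] := clx _ _ FU xU.
Qed.

Section series.
Variables (R : realType) (u : nat -> R).
Hypothesis u0 : forall k, 0 <= u k.

Lemma nneseries_partial t : (\sum_(0 <= k <oo) (u k)%:E = t%:E)%E ->
  (forall n, \sum_(k < n) u k <= t) /\
  (forall e, 0 < e -> exists n, t <= \sum_(k < n) u k + e).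
Proof.
have uE k : (0 <= (u k)%:E)%E by rewrite lee_fin.
move=> ut; split=> [n|e e0].
  have := @nneseries_lim_ge R (fun k => (u k)%:E) xpredT 0 n (fun k _ _ => uE k).
  by rewrite ut sumEFin lee_fin big_mkord.
apply: contrapT => h.
have : (t%:E <= (t - e)%:E)%E.
  rewrite -ut; apply: lime_le; first by apply: is_cvg_nneseries => k _ _.
  apply: nearW => n; rewrite sumEFin lee_fin big_mkord lerBrDr leNgt.
  by apply/negP => hn; apply: h; exists n; exact: ltW.
by rewrite lee_fin lerBrDr gerDl leNgt e0.
Qed.

Lemma sum_halves N n : (N <= n)%N ->
  \sum_(N.*2 <= k < n.*2) u k./2 = 2 * \sum_(N <= j < n) u j.
Proof.
elim: n => [|n IH]; first by rewrite leqn0 => /eqP->; rewrite !big_geq ?mulr0.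
rewrite leq_eqVlt => /predU1P[->|]; first by rewrite !big_geq ?mulr0.
rewrite ltnS => Nn; have N2 : (N.*2 <= n.*2)%N by rewrite leq_double.
rewrite doubleS big_nat_recr/=; last exact: leqW.
rewrite big_nat_recr//= IH// [in RHS]big_nat_recr//= doubleK uphalf_double.
by ring.
Qed.

Lemma sum_widen N N' n n' : (N <= N')%N -> (n' <= n)%N ->
  \sum_(N' <= k < n') u k <= \sum_(N <= k < n) u k.
Proof.
move=> NN nn; have [h|h] := leqP n' N'.
  by rewrite big_geq//; apply: sumr_ge0.
rewrite (@big_cat_nat _ _ _ N' N n)//=; last exact: leq_trans (ltnW h) nn.
rewrite (@big_cat_nat _ _ _ n' N' n)//=; last exact: ltnW.
by rewrite addrCA lerDl addr_ge0//; apply: sumr_ge0.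
Qed.

End series.

(** The halved index comes from sigma_{2k}(S + T) <= sigma_k(S) + sigma_k(T). Every j equals k./2
    for two values of k, which doubles each of the two sums. *)
Lemma sum_dominated (R : realType) (a b c : nat -> R) (C e : R) N n :
  (forall k, 0 <= a k) -> (forall k, 0 <= b k) -> (forall k, 0 <= c k) -> 0 <= C ->
  (forall k, a k <= C * (b k./2 + c k./2)) ->
  (forall m, \sum_(N <= k < m) b k <= e) -> (forall m, \sum_(N <= k < m) c k <= e) ->
  \sum_(N.*2 <= k < n) a k <= 4 * C * e.
Proof.
move=> a0 b0 c0 C0 h hb hc; have N' : (N <= maxn N n)%N := leq_maxl _ _.
apply: le_trans (_ : \sum_(N.*2 <= k < (maxn N n).*2) a k <= _).
  apply: sum_widen => //; apply: leq_trans (leq_maxr N n) _.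
  by rewrite -addnn leq_addr.
apply: le_trans (ler_sum _ (fun k _ => h k)) _.
rewrite -mulr_sumr big_split/= (sum_halves b)// (sum_halves c)//.
have -> : 4 * C * e = C * (2 * e + 2 * e) by ring.
by rewrite ler_wpM2l// lerD// ler_wpM2l.
Qed.

Lemma cvg_sum_ord (R : realType) (X : topologicalType) (f : nat -> X -> R) x n :
  (forall k, f k @ x --> f k x) -> (fun y => \sum_(k < n) f k y) @ x --> \sum_(k < n) f k x.
Proof.
move=> fc; elim: n => [|n IH].
  by under eq_fun do rewrite big_ord0; rewrite big_ord0; exact: cvg_cst.
under eq_fun do rewrite big_ord_recr/=; rewrite big_ord_recr/=.
exact: cvgD.
Qed.

Lemma powR_le_inv (R : realType) (p a b : R) : 0 < p -> 0 <= a -> 0 <= b ->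
  a `^ p <= b `^ p -> a <= b.
Proof.
move=> p0 a0 b0; rewrite leNgt => /negP h; rewrite leNgt; apply/negP => ba; apply: h.
by apply: gt0_ltr_powR.
Qed.

Section tails.
Variables (R : realType) (A : commCstarAlgebra R) (E : hilbertModule A) (p : R).
Implicit Types (S T : E -> E) (chi : character A).

Definition tail_le T N (e : R) chi := forall n, \sum_(N <= k < n) sv chi T k `^ p <= e.

(** Uniform convergence together with vanishing at infinity, phrased with finite sums so that no
    limit has to exist beforehand. *)
Definition uniform_tails T :=
  (forall e : R, 0 < e -> exists N, forall chi, tail_le T N e chi) /\
  (forall e : R, 0 < e -> exists2 K : set (character A), compact K &
    forall chi, ~ K chi -> tail_le T 0 e chi).

Lemma tail_le_leq T N N' e chi : (N <= N')%N -> tail_le T N e chi -> tail_le T N' e chi.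
Proof.
move=> NN h n; apply: le_trans (h n); apply: sum_widen => // k; exact: powR_ge0.
Qed.

Lemma tail_le_dominated X S T (C e : R) N chi : 0 <= C ->
  (forall k, sv chi X k `^ p <= C * (sv chi S k./2 `^ p + sv chi T k./2 `^ p)) ->
  tail_le S N e chi -> tail_le T N e chi -> tail_le X N.*2 (4 * C * e) chi.
Proof.
move=> C0 h hS hT n.
exact: (sum_dominated n (fun k => powR_ge0 (sv chi X k) p) (fun k => powR_ge0 (sv chi S k) p)
  (fun k => powR_ge0 (sv chi T k) p) C0 h hS hT).
Qed.

(** The common route for sums, and with S = T also for scalar multiples and products. *)
Lemma uniform_tails_dominated X S T (C : R) : 0 <= C ->
  (forall chi k, sv chi X k `^ p <= C * (sv chi S k./2 `^ p + sv chi T k./2 `^ p)) ->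
  uniform_tails S -> uniform_tails T -> uniform_tails X.
Proof.
move=> C0 h [S1 S2] [T1 T2].
have C1 : 0 < 4 * C + 1 by rewrite ltr_wpDl// mulr_ge0.
have small (e : R) : 0 < e -> 0 < e / (4 * C + 1) /\ 4 * C * (e / (4 * C + 1)) <= e.
  move=> e0; split; first exact: divr_gt0.
  by rewrite mulrCA ler_piMr ?(ltW e0)// ler_pdivrMr// mul1r lerDl.
split=> e e0; have [d0 dle] := small e e0.
  have [N1 h1] := S1 _ d0; have [N2 h2] := T1 _ d0.
  exists (maxn N1 N2).*2 => chi n; apply: le_trans dle.
  apply: (tail_le_dominated C0 (h chi)).
    exact: tail_le_leq (leq_maxl _ _) (h1 chi).
  exact: tail_le_leq (leq_maxr _ _) (h2 chi).
have [K1 c1 h1] := S2 _ d0; have [K2 c2 h2] := T2 _ d0.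
exists (K1 `|` K2); first exact: compactU.
move=> chi nK n; apply: le_trans dle.
apply: (tail_le_dominated (N := 0) C0 (h chi)).
  by apply: h1 => K1c; apply: nK; left.
by apply: h2 => K2c; apply: nK; right.
Qed.

End tails.

Section Schatten.
Variables (R : realType) (A : commCstarAlgebra R) (E : hilbertModule A) (p : R) (p1 : 1 <= p).
Implicit Types (S T : E -> E) (chi : character A).

Let p0 : 0 < p := lt_le_trans ltr01 p1.

Lemma sv_pow_ge0 T chi k : 0 <= sv chi T k `^ p.
Proof. exact: powR_ge0. Qed.

Lemma sv_cvg T T' chi k : hm_adjoints T T' ->
  compact_op (hs_inner (localized_space E chi)) (localized_op chi T) ->
  usc (fun x => sv x T k) chi ->
  (fun x => sv x T k `^ p) @ chi --> sv chi T k `^ p.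
Proof.
move=> TT Tc Tu; apply/semicontinuousP; split.
  exact: (lsc_powR p0 (fun x => sv_ge0 x T k) (sv_lsc TT Tc)).
exact: ((usc_powR chi p0 (fun x => sv_ge0 x T k)).2 Tu).
Qed.

Section trace_class.
Variables (T T' : E -> E) (g : character A -> R).
Hypotheses (TT : hm_adjoints T T')
  (Tg : forall chi, trace (op_abs_powR (localized_op chi T) p) = (g chi)%:E).

Lemma trace_class_compact chi :
  compact_op (hs_inner (localized_space E chi)) (localized_op chi T).
Proof.
have [C C0 TC] := adjointable_bounded TT.
exact: (trace_finite_compact (localized_op_adjoints TT C0 TC) (localized_op_bounded TT C0 TC) p1 (Tg chi)).
Qed.

Lemma trace_class_series chi :
  (\sum_(0 <= k <oo) (sv chi T k `^ p)%:E = (g chi)%:E)%E.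
Proof.
have [C C0 TC] := adjointable_bounded TT.
rewrite -Tg; apply: esym.
exact: (trace_gelfand (localized_op_adjoints TT C0 TC) C0 (localized_op_bounded TT C0 TC) p1
  (@trace_class_compact chi)).
Qed.

Let partial chi := nneseries_partial (sv_pow_ge0 T chi) (trace_class_series chi).

Hypothesis gc : continuous g.

Lemma trace_class_usc chi k : usc (fun x => sv x T k) chi.
Proof.
apply: (usc_powR chi p0 (fun x => sv_ge0 x T k)).1.
apply: (@usc_of_sum R (character A) (fun j x => sv x T j `^ p) g chi k).
- move=> j x; exact: sv_pow_ge0.
- move=> j; exact: (lsc_powR p0 (fun x => sv_ge0 x T j) (sv_lsc TT (@trace_class_compact chi))).
- by move=> x n; exact: (partial x).1.
- by move=> e e0; exact: (partial chi).2.
- by have [_ gu] := (@semicontinuousP R (character A) g chi).1 (@gc chi).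
Qed.

(* Dini's theorem on the compact set outside of which g is small. *)
Lemma trace_class_tails :
  (forall e : R, 0 < e -> exists2 K, compact K & forall chi, ~ K chi -> `|g chi| < e) ->
  uniform_tails p T.
Proof.
have part x n : \sum_(0 <= k < n) sv x T k `^ p <= g x by rewrite big_mkord; exact: (partial x).1.
move=> g0; split=> e e0; have [K cK hK] := g0 _ e0; last first.
  exists K => // chi nK n; apply: le_trans (part chi n) _.
  by apply: ltW; apply: le_lt_trans (hK _ nK); exact: ler_norm.
suff [N hN] : exists N, forall chi, K chi -> g chi <= \sum_(k < N) sv chi T k `^ p + e.
  exists N => chi n; have [Kc|nK] := pselect (K chi); last first.
    apply: le_trans (sum_widen (sv_pow_ge0 T chi) (leq0n N) (leqnn n)) _.
    apply: le_trans (part chi n) _.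
    by apply: ltW; apply: le_lt_trans (hK _ nK); exact: ler_norm.
  have [Nn|nN] := leqP N n; last by rewrite big_geq ?ltW//; exact: ltnW.
  have := le_trans (part chi n) (hN _ Kc).
  by rewrite (@big_cat_nat _ _ _ N 0 n)//= big_mkord lerD2l.
apply: (compact_local_ind (P := fun B : set (character A) => exists N, forall chi, B chi ->
  g chi <= \sum_(k < N) sv chi T k `^ p + e)) cK.
- by exists 0%N.
- move=> B D [N hN] [M hM]; exists (maxn N M).
  have mono x n m : (n <= m)%N -> \sum_(k < n) sv x T k `^ p <= \sum_(k < m) sv x T k `^ p.
    by move=> nm; rewrite -!(big_mkord xpredT (fun k => sv x T k `^ p)); exact: (sum_widen (sv_pow_ge0 T x)).
  move=> chi [/hN h|/hM h]; apply: le_trans h _; rewrite lerD2r mono//.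
    exact: leq_maxl.
  exact: leq_maxr.
- by move=> B D BD [N hN]; exists N => chi /BD; exact: hN.
(* One third each for the tail at chi0, for g at nearby characters and for the partial sum there. *)
move=> chi0 _; have e3 : 0 < e / 3 by rewrite divr_gt0.
have [N hN] := (partial chi0).2 _ e3.
have c1 := cvg_sum_ord (n := N) (fun k => sv_cvg TT (@trace_class_compact chi0) (@trace_class_usc chi0 k)).
have := (@semicontinuousP R (character A) _ chi0).1 c1 => -[l1 _].
have := (@semicontinuousP R (character A) _ chi0).1 (@gc chi0) => -[_ u1].
have h1 : \forall chi \near chi0, g chi < g chi0 + e / 3 by apply: u1; rewrite ltrDl.
have h2 : \forall chi \near chi0, \sum_(k < N) sv chi0 T k `^ p - e / 3 < \sum_(k < N) sv chi T k `^ p.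
  by apply: l1; rewrite gtrDl oppr_lt0.
exists [set chi | g chi <= \sum_(k < N) sv chi T k `^ p + e]; last by exists N.
apply: filterS2 h1 h2 => chi a1 a2.
apply: le_trans (ltW a1) _; apply: le_trans (lerD hN (lexx _)) _.
have a3 : \sum_(k < N) sv chi0 T k `^ p <= \sum_(k < N) sv chi T k `^ p + e / 3.
  by rewrite -lerBlDr; exact: ltW a2.
apply: le_trans (lerD (lerD a3 (lexx _)) (lexx _)) _.
rewrite -!addrA lerD2l.
by have -> : e / 3 + (e / 3 + e / 3) = e by field.
Qed.

(** The Gelfand number of index 0 is the operator norm; where it is small, outside a compact set, no
    vectors are needed. *)
Lemma sv_controlled (eps : R) chi : 0 < eps -> sv chi T 0 < eps ->
  almost_controlled T eps [::] chi.
Proof.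
have [C C0 TC] := adjointable_bounded TT.
move=> e0 h x; rewrite big_nil addr0.
have [b b0 hb] := sv_lt TT h.
have := hb (embed (localized_form E chi) x) _.
rewrite (localized_op_emb chi TT C0 TC) !sn_emb; apply.
by move=> y; case: b b0 hb.
Qed.

(** Control survives enlarging the list, so the lists found locally on the compact set can be
    concatenated. *)
Lemma trace_class_module_compact : uniform_tails p T -> compact_operators E T.
Proof.
move=> [t1 t2]; apply: (controlled_compact TT) => eps eps0.
have e2 : 0 < eps / 2 by rewrite divr_gt0.
have small chi k : sv chi T k `^ p <= (eps / 2) `^ p -> sv chi T k < eps.
  move=> h; apply: le_lt_trans (powR_le_inv p0 (sv_ge0 _ _ _) (ltW e2) h) _.
  by rewrite ltr_pdivrMr// ltr_pMr// ltr1n.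
have d0 : 0 < (eps / 2) `^ p by rewrite powR_gt0.
have [N hN] := t1 _ d0; have [K cK hK] := t2 _ d0.
suff [l hl] : exists l, forall chi, K chi -> almost_controlled T eps l chi.
  exists l => chi; have [/hl//|nK] := pselect (K chi).
  move=> x; apply: le_trans (@sv_controlled eps chi eps0 _ x) _.
    by apply: small; have := hK _ nK 1%N; rewrite big_nat1.
  by rewrite big_nil lerD2l; apply: sumr_ge0 => v _; exact: nr_ge0.
apply: (compact_local_ind (P := fun B : set (character A) => exists l, forall chi, B chi ->
  almost_controlled T eps l chi)) cK.
- by exists [::].
- move=> B D [l hl] [m hm]; exists (l ++ m) => chi [/hl h|/hm h] x; apply: le_trans (h x) _;
    rewrite lerD2l big_cat/= ?lerDl ?lerDr; apply: sumr_ge0 => v _; exact: nr_ge0.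
- by move=> B D BD [l hl]; exists l => chi /BD; exact: hl.
move=> chi0 _.
have hk : sv chi0 T N < eps by apply: small; have := hN chi0 N.+1; rewrite big_nat1.
have [l hl] := near_estimate TT trace_class_compact (@trace_class_usc chi0) hk.
by exists [set chi | almost_controlled T eps l chi] => //; exists l.
Qed.

End trace_class.
End Schatten.

(** * From compactness and small tails to the Schatten class *)

Section compact_operators_localize.
Variables (R : realType) (A : commCstarAlgebra R) (E : hilbertModule A).

Lemma compact_localized (X : E -> E) chi : compact_operators E X ->
  compact_op (hs_inner (localized_space E chi)) (localized_op chi X).
Proof.
move=> /compact_operatorsP[[X' XX] hX] e e0.
have e2 : 0 < e / 2 by rewrite divr_gt0.
have [l hl] := hX _ e2; exists (size l); apply: (sv_lt XX).
apply: le_lt_trans (sv_dist chi (size l) XX (finite_rank_adjoints l) (ltW e2) hl) _.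
rewrite finite_rank_sv// add0r; by rewrite ltr_pdivrMr// ltr_pMr// ltr1n.
Qed.

(** The exponent is 2 whatever p is: the sum of squares is algebraic in the entries of l and hence
    continuous in the character. *)
Lemma finite_rank_usc (l : seq (E * E)) chi k : usc (fun x => sv x (finite_rank l) k) chi.
Proof.
have p2 : 0 < 2%:R :> R by [].
apply: (usc_powR chi p2 (fun x => sv_ge0 x (finite_rank l) k)).1.
pose a : A := \sum_(i < size l) \sum_(j < size l)
  ca_mul (hm_inner (nth (0, 0) l j).2 (nth (0, 0) l i).2)
    (hm_inner (nth (0, 0) l i).1 (nth (0, 0) l j).1).
have sqE x j : sv x (finite_rank l) j `^ 2%:R = sv x (finite_rank l) j ^+ 2.
  by rewrite powR_mulrn// sv_ge0.
have total (x : character A) : \sum_(j < size l) sv x (finite_rank l) j `^ 2%:R = complex.Re (x a).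
  by under eq_bigr do rewrite sqE; exact: finite_rank_sv_sum.
have pow0 x j : 0 <= sv x (finite_rank l) j `^ 2%:R := powR_ge0 _ _.
apply: (@usc_of_sum R (character A) (fun j x => sv x (finite_rank l) j `^ 2%:R)
  (fun x : character A => complex.Re (x a)) chi k).
- by move=> j x; exact: pow0.
- move=> j; apply: (lsc_powR p2 (fun x => sv_ge0 x _ j)).
  exact: (sv_lsc (finite_rank_adjoints l) (finite_rank_compact chi l)).
- move=> x n; rewrite -total -!(big_mkord xpredT (fun j => sv x (finite_rank l) j `^ 2%:R)).
  have [nl|ln] := leqP n (size l); first exact: (sum_widen (pow0 x)).
  rewrite (@big_cat_nat _ _ _ (size l) 0 n)//=; last exact: ltnW.
  rewrite [X in _ + X]big_nat_cond [X in _ + X]big1 ?addr0// => j /andP[/andP[lj _] _].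
  by rewrite finite_rank_sv// powR0// gt_eqF.
- by move=> e e0; exists (size l); rewrite total lerDl ltW.
move=> c hc; have d0 : 0 < (c - complex.Re (chi a)) / 2 by rewrite divr_gt0// subr_gt0.
apply: filterS (character_near chi a d0) => x h.
have := le_trans (Re_le_nr _) h; rewrite ReB ler_pdivlMr//; move: hc.
by set u := complex.Re (chi a); set v := complex.Re _ => h1 h2; lra.
Qed.

(** A perturbation of norm e moves the singular values by at most e at all characters at once, so
    upper semicontinuity passes from finite rank operators to their limits. *)
Lemma compact_usc (X : E -> E) chi k : compact_operators E X -> usc (fun x => sv x X k) chi.
Proof.
move=> /compact_operatorsP[[X' XX] hX] c hc.
pose e := (c - sv chi X k) / 3.
have e0 : 0 < e by rewrite divr_gt0// subr_gt0.
have [l hl] := hX _ e0; have FF := finite_rank_adjoints l.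
have hl' u : nr (finite_rank l u - X u) <= e * nr u by rewrite nrBC.
have d1 x := sv_dist x k XX FF (ltW e0) hl.
have d2 := sv_dist chi k FF XX (ltW e0) hl'.
have h : sv chi (finite_rank l) k < c - e.
  apply: le_lt_trans d2 _; rewrite ltrBrDr -addrA -ltrBrDl -/e.
  have -> : c - sv chi X k = e * 3 by rewrite divfK.
  by rewrite -mulr2n -[ltLHS]mulr_natr ltr_pM2l// ltr_nat.
apply: filterS (@finite_rank_usc l chi k _ h) => x hx.
by apply: le_lt_trans (d1 x) _; rewrite -ltrBrDr.
Qed.

End compact_operators_localize.

Lemma dist_three_eps (R : realType) (a b x y e : R) : a <= x -> x <= a + e / 3 ->
  b <= y -> y <= b + e / 3 -> `|a - b| < e / 3 -> `|x - y| < e.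
Proof.
by rewrite !ltr_norml => h1 h2 h3 h4 /andP[h5 h6]; apply/andP; split; lra.
Qed.

Section schatten_characterization.
Variables (R : realType) (A : commCstarAlgebra R) (E : hilbertModule A) (p : R) (p1 : 1 <= p).

Let p0 : 0 < p := lt_le_trans ltr01 p1.

(** The trace function is a uniform limit of partial sums, which are continuous because T is
    compact. *)
Lemma schatten_of_tails (T : E -> E) : compact_operators E T -> uniform_tails p T ->
  schatten_class E p T.
Proof.
move=> Tc [t1 t2]; have [aT _] := Tc; have [T' TT] := aT.
have [C C0 TC] := adjointable_bounded TT.
pose S chi : \bar R := (\sum_(0 <= k <oo) (sv chi T k `^ p)%:E)%E.
have trE chi : trace (op_abs_powR (localized_op chi T) p) = S chi.
  exact: (trace_gelfand (localized_op_adjoints TT C0 TC) C0 (localized_op_bounded TT C0 TC) p1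
    (@compact_localized R A E T chi Tc)).
have S0 chi : (0 <= S chi)%E.
  by apply: nneseries_ge0 => k _ _; rewrite lee_fin sv_pow_ge0.
(* Tails of size 1 suffice for the finiteness of the series at every character. *)
have [N1 hN1] := t1 _ (@ltr01 R).
have Sfin chi : S chi \is a fin_num.
  rewrite ge0_fin_numE//.
  apply: le_lt_trans (_ : ((\sum_(0 <= k < N1) sv chi T k `^ p + 1)%:E < +oo)%E); last exact: ltry.
  apply: lime_le; first by apply: is_cvg_nneseries => k _ _; rewrite lee_fin sv_pow_ge0.
  apply: nearW => n; rewrite sumEFin lee_fin.
  have [h|h] := leqP n N1.
    by apply: le_trans (sum_widen (sv_pow_ge0 p T chi) (leqnn 0) h) _; rewrite lerDl.
  rewrite (@big_cat_nat _ _ _ N1 0 n)//=; last exact: ltnW.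
  by rewrite lerD2l; exact: hN1.
pose g chi := fine (S chi).
have gE chi : S chi = (g chi)%:E by rewrite fineK.
have part chi := nneseries_partial (sv_pow_ge0 p T chi) (gE chi).
have tail e chi N : 0 < e -> tail_le p T N e chi -> g chi <= \sum_(k < N) sv chi T k `^ p + e.
  move=> e0 h; apply/ler_addgt0Pr => d d0.
  have [n hn] := (part chi).2 _ d0; apply: le_trans hn _; rewrite lerD2r.
  rewrite -!(big_mkord xpredT (fun k => sv chi T k `^ p)).
  have [nN|Nn] := leqP n N.
    by apply: le_trans (sum_widen (sv_pow_ge0 p T chi) (leqnn 0) nN) _; rewrite lerDl ltW.
  rewrite (@big_cat_nat _ _ _ N 0 n)//=; last exact: ltnW.
  by rewrite lerD2l; exact: h.
have g0 chi : 0 <= g chi by rewrite fine_ge0.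
split=> //; exists g; split.
- by move=> chi; rewrite trE gE.
- move=> chi0; apply/(@cvgrPdist_lt R R (character A) (nbhs chi0) (nbhs_filter chi0)) => e e0.
  have e3 : 0 < e / 3 by rewrite divr_gt0.
  have [N hN] := t1 _ e3.
  have c1 := cvg_sum_ord (n := N) (fun k => sv_cvg p1 TT (@compact_localized R A E T chi0 Tc)
    (@compact_usc R A E T chi0 k Tc)).
  move/(@cvgrPdist_lt R R (character A) (nbhs chi0) (nbhs_filter chi0)) : c1 => /(_ _ e3); apply: filterS => chi.
  exact: (dist_three_eps ((part chi0).1 N) (tail _ chi0 N e3 (hN chi0)) ((part chi).1 N)
    (tail _ chi N e3 (hN chi))).
move=> e e0; have e2 : 0 < e / 2 by rewrite divr_gt0.
have [K cK hK] := t2 _ e2; exists K => // chi nK.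
rewrite ger0_norm//; apply: le_lt_trans (tail _ chi 0%N e2 (hK _ nK)) _.
by rewrite big_ord0 add0r ltr_pdivrMr// ltr_pMr// ltr1n.
Qed.

Lemma schatten_tails (T : E -> E) : schatten_class E p T ->
  compact_operators E T /\ uniform_tails p T.
Proof.
move=> [[T' TT] [g [Tg gc g0]]].
have ut := trace_class_tails p1 TT Tg gc g0.
by split=> //; exact: (trace_class_module_compact p1 TT Tg gc ut).
Qed.

Lemma sv_pow_scale (C a b : R) : 0 <= C -> 0 <= a -> 0 <= b -> b <= C * a ->
  b `^ p <= C `^ p * a `^ p.
Proof.
move=> C0 a0 b0 h; rewrite -powRM//.
by apply: ge0_ler_powR; rewrite ?nnegrE ?mulr_ge0// ltW.
Qed.

Lemma powRD_le (a b : R) : 0 <= a -> 0 <= b ->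
  (a + b) `^ p <= 2 `^ p * (a `^ p + b `^ p).
Proof.
move=> a0 b0; wlog ab : a b a0 b0 / a <= b.
  move=> h; have [ab|/ltW ba] := leP a b; first exact: h.
  by rewrite addrC [X in _ * X]addrC; exact: h.
apply: le_trans (_ : 2 `^ p * b `^ p <= _).
  apply: sv_pow_scale => //; first exact: addr_ge0.
  by rewrite mulr_natl mulr2n lerD2r.
by rewrite ler_wpM2l ?powR_ge0// lerDr powR_ge0.
Qed.

Lemma tails_scaled (X T T' : E -> E) (C : R) : hm_adjoints T T' -> 0 <= C ->
  (forall chi k, sv chi X k <= C * sv chi T k) -> uniform_tails p T -> uniform_tails p X.
Proof.
move=> TT C0 h ut; apply: (uniform_tails_dominated (powR_ge0 C p) _ ut ut) => chi k.
apply: le_trans (_ : C `^ p * sv chi T k./2 `^ p <= _).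
  apply: sv_pow_scale (sv_ge0 _ _ _) (sv_ge0 _ _ _) _ => //.
  apply: le_trans (h chi k) (ler_wpM2l C0 (sv_anti chi TT _)).
  by rewrite -divn2 leq_div.
by rewrite ler_wpM2l ?powR_ge0// lerDl powR_ge0.
Qed.

Lemma tailsD (S S' T T' : E -> E) : hm_adjoints S S' -> hm_adjoints T T' ->
  uniform_tails p S -> uniform_tails p T -> uniform_tails p (fun u => S u + T u).
Proof.
move=> SS TT uS uT; apply: (uniform_tails_dominated (powR_ge0 2 p) _ uS uT) => chi k.
apply: le_trans (powRD_le (sv_ge0 chi S k./2) (sv_ge0 chi T k./2)).
have ST := hm_adjointsD SS TT.
apply: ge0_ler_powR; rewrite ?nnegrE ?addr_ge0 ?sv_ge0//; first exact: ltW.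
apply: le_trans (svD chi k./2 k./2 SS TT).
(* For odd k the doubled half is k - 1, and monotonicity absorbs the missing index. *)
by apply: (sv_anti chi ST); rewrite addnn -{2}(odd_double_half k) leq_addl.
Qed.

End schatten_characterization.

Theorem theorem3p25 (R : realType) (A : commCstarAlgebra R)
    (E : hilbertModule A) (hE : countably_generated E) (p : R) (hp : 1 <= p) :
  two_sided_ideal E (schatten_class E p) /\
  schatten_class E p `<=` compact_operators E.
Proof.
split; last by move=> T /(schatten_tails hp)[].
split.
- by move=> T [].
- apply: (schatten_of_tails hp); first exact: zero_compact.
  have sv0 chi k : sv chi (fun=> 0 : E) k = 0.
    apply/eqP; rewrite eq_le sv_ge0 andbT.
    have zz : hm_adjoints (fun=> 0 : E) (fun=> 0).
      by move=> u v; rewrite -hm_inner_star !hm_inner0r ca_star0.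
    by apply: (sv_le chi k zz) => // u; rewrite nr0 mul0r.
  have t0 N (e : R) chi : 0 < e -> tail_le p (fun=> 0 : E) N e chi.
    move=> e0 n; rewrite big1 ?ltW// => k _.
    by rewrite sv0 powR0// gt_eqF// (lt_le_trans ltr01).
  split=> e e0; first by exists 0%N => chi; exact: t0.
  by exists set0 => [|chi _]; [exact: compact0|exact: t0].
- move=> S T /(schatten_tails hp)[cS uS] /(schatten_tails hp)[cT uT].
  apply: (schatten_of_tails hp); first exact: compactD.
  by have [[S' SS] _] := cS; have [[T' TT] _] := cT; exact: (tailsD hp SS TT).
- move=> z T /(schatten_tails hp)[cT uT].
  apply: (schatten_of_tails hp); first exact: compactZ.
  have [[T' TT] _] := cT; apply: (tails_scaled hp TT (nr_ge0 z) _ uT) => chi k.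
  exact: (svZ chi z k TT).
move=> S T aS /(schatten_tails hp)[cT uT].
have [S' SS] := aS; have [[T' TT] _] := cT.
have [C C0 SC] := adjointable_bounded SS.
split; apply: (schatten_of_tails hp).
- exact: compact_comp.
- by apply: (tails_scaled hp TT C0 _ uT) => chi k; exact: (sv_comp chi k SS TT C0 SC).
- exact: compact_precomp.
- by apply: (tails_scaled hp TT C0 _ uT) => chi k; exact: (sv_precomp chi k SS TT C0 SC).
Qed.
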